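(* Let $F(t,z)$ be an entire function on $\mathbb{C}^2$ satisfying the heat equation $\partial_tF=\partial_z^2F$, whose $z$-order $\rho$ satisfies $0<\rho<2$ (equivalently, whose caloric $t$-order $\rho_t$ satisfies $0<\rho_t<\infty$), and let $\tau\in[0,\infty]$ be the $z$-type of $F$. Let $$\mathcal{E}_0=\{z\in\mathbb{C}: \rho_{t,0}(z)=\rho_t\},\qquad \mathcal{E}_1=\{z\in\mathbb{C}: \rho_{t,1}(z)=\rho_t\},\qquad \mathcal{E}=\mathcal{E}_0\cap\mathcal{E}_1 .$$ Let $\tau_{t,0}(z)$, for $z\in\mathcal{E}_0$, be the type of the entire function $t\mapsto F(t,z)$, let $\tau_{t,1}(z)$, for $z\in\mathcal{E}_1$, be the type of the entire function $t\mapsto\partial_zF(t,z)$, and set $$\tau_t:=\max\{\tau_{t,0}(z),\,\tau_{t,1}(z)\},\qquad z\in\mathcal{E}.$$ Then: (i) The quantity $\tau_t$ is independent of $z\in\mathcal{E}$ and $$\tau_t=\left(1-\frac{\rho}{2}\right)(2\rho)^{\frac{\rho}{2-\rho}}\,\tau^{\frac{2}{2-\rho}} .$$ In particular, $\tau_t=0$ if and only if $\tau=0$, and $\tau_t=\infty$ if and only if $\tau=\infty$. (ii) If $\tau_t<\infty$, then $\tau_{t,0}(z)=\tau_t$ and $\tau_{t,1}(z)=\tau_t$ for almost every $z\in\mathbb{C}$ (with respect to Lebesgue area measure).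
   Context: For an entire function $g$ with $M(r)=\max_{|w|=r}|g(w)|$, the order is $\limsup_{r\to\infty}\frac{\ln\ln M(r)}{\ln r}\in[0,\infty]$ (polynomials, including the zero function, have order $0$); if the order $\sigma$ satisfies $0<\sigma<\infty$, the type is $\limsup_{r\to\infty}\frac{\ln M(r)}{r^{\sigma}}\in[0,\infty]$. The $z$-order $\rho$ and $z$-type $\tau$ of $F$ are the order and type of $z\mapsto F(t,z)$ for fixed $t$; they do not depend on $t$, so they are the order and type of $f(z)=F(0,z)$. For $z\in\mathbb{C}$, $\rho_{t,0}(z)$ denotes the order of $t\mapsto F(t,z)$, $\rho_{t,1}(z)$ the order of $t\mapsto\partial_zF(t,z)$, and the caloric $t$-order of $F$ is $\rho_t=\max\{\rho_{t,0}(z),\rho_{t,1}(z)\}$. This quantity is independent of $z$, equals $\rho/(2-\rho)$, and the sets $\mathcal{E}_0$, $\mathcal{E}_1$ (hence $\mathcal{E}$) have full Lebesgue measure in $\mathbb{C}$. *)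

(* Defs.v *)
From HB Require Import structures.
From mathcomp Require Import all_boot all_order all_algebra.
From mathcomp Require Import all_classical all_reals all_analysis.
From mathcomp Require Import complex.

Set Implicit Arguments.
Unset Strict Implicit.
Unset Printing Implicit Defensive.

Import Order.TTheory GRing.Theory Num.Theory.
Import numFieldNormedType.Exports.

Local Open Scope complex_scope.
Local Open Scope ring_scope.
Local Open Scope classical_set_scope.

(* The library puts the standard norm topology on every numFieldType variable,
   but the instances are not found for the concrete field [R[i]]. *)
#[non_forgetful_inheritance, warnings="-redundant-canonical-projection"]
HB.instance Definition _ (R : realType) := NormedModule.copy R[i] R[i]^o.

Section GrowthOneVariable.
Context {R : realType}.
Local Notation C := (R[i]).

(* [Normc.normc] is the real-valued modulus. For continuous [g] and [r >= 0] the
   supremum is attained, so this is the maximum of |g| on the circle |w| = r. *)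
Definition max_modulus (g : C -> C) (r : R) : R :=
  sup [set Normc.normc (g w) | w in [set w : C | Normc.normc w = r]].

(* Since [ln x = 0] for [x <= 0], the formula gives order 0 to every polynomial,
   including 0 and the constants of modulus at most 1 (for a non-constant
   polynomial, and for a non-polynomial entire function, the iterated logarithm
   is the genuine one for large r). *)
Definition growth_order (g : C -> C) : \bar R :=
  limf_esup (fun r : R => (ln (ln (max_modulus g r)) / ln r)%:E) +oo%R.

(* Only meaningful when [0 < growth_order g < +oo]. *)
Definition growth_type (g : C -> C) : \bar R :=
  limf_esup
    (fun r : R => (ln (max_modulus g r) / r `^ fine (growth_order g))%:E) +oo%R.

End GrowthOneVariable.

Section HeatEquation.
Context {R : realType}.
Local Notation C := (R[i]).
Implicit Types (F : C * C -> C) (t z : C).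

(* The scalar field of the normed module [C * C] is [C] itself, so this is
   complex (Frechet) differentiability at every point of C^2. *)
Definition entire2 F : Prop := forall p : C * C, differentiable F p.

Definition slice_t F z : C -> C := fun t => F (t, z).
Definition slice_z F t : C -> C := fun z => F (t, z).

Definition dz F t z : C := (slice_z F t)^`() z.

Definition heat_equation F : Prop :=
  forall t z, (slice_t F z)^`() t = (slice_z F t)^`(2) z.

(* Order and type of z |-> F(t, z) do not depend on t for solutions of the heat
   equation; they are read off at t = 0. *)
Definition z_order F : \bar R := growth_order (slice_z F 0).
Definition z_type F : \bar R := growth_type (slice_z F 0).

Definition t_order0 F z : \bar R := growth_order (slice_t F z).
Definition t_order1 F z : \bar R := growth_order (fun t => dz F t z).
(* Independent of z for solutions of the heat equation; the point z is kept as
   an argument so that any reference point may be used. *)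
Definition caloric_t_order F z : \bar R := maxe (t_order0 F z) (t_order1 F z).

Definition t_type0 F z : \bar R := growth_type (slice_t F z).
Definition t_type1 F z : \bar R := growth_type (fun t => dz F t z).
Definition caloric_t_type F z : \bar R := maxe (t_type0 F z) (t_type1 F z).

Definition max_order_set0 F (rho_t : \bar R) : set C :=
  [set z | t_order0 F z = rho_t].
Definition max_order_set1 F (rho_t : \bar R) : set C :=
  [set z | t_order1 F z = rho_t].

(* Almost everywhere for the area measure, identifying x + iy with (x, y). *)
Definition ae_area (P : C -> Prop) : Prop :=
  {ae (lebesgue_measure \x lebesgue_measure)%E,
     forall p : R * R, P (p.1 +i* p.2)}.

End HeatEquation.

(* Main.v *)
Require Import Defs.
From HB Require Import structures.
From mathcomp Require Import all_boot all_order all_algebra.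
From mathcomp Require Import all_classical all_reals all_analysis.
From mathcomp Require Import unstable measurable_realfun.
From mathcomp Require Import complex zify ring lra.

Set Implicit Arguments.
Unset Strict Implicit.
Unset Printing Implicit Defensive.

Import Order.TTheory GRing.Theory Num.Theory.
Import numFieldNormedType.Exports.

Local Open Scope complex_scope.
Local Open Scope ring_scope.
Local Open Scope classical_set_scope.

(** Two estimates relate the growth of the initial value [f = F (0, _)] to the
    growth of the slices of [F].

    The heat equation gives the Taylor coefficients in [t] at a point [z]:
    [F (t, z) = sum_k f^(2k)(z) t^k / k!] and
    [dz F t z = sum_k f^(2k+1)(z) t^k / k!] (lemma [tcoef_zcoef]). An entire
    function grows at most with order [s] and type [T] exactly when, for every
    [T' > T], its coefficients satisfy [|a_k| r^k <= B exp (T' r^s)] for all [r]: one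
    direction is Cauchy's estimate ([growth_le_coef]), the other one sums a
    geometric series ([coef_growth_le]). Since (2k)! / k! is (4k / e)^k up to
    subexponential factors, and (4k / e)^k is the maximum of [u^k exp (- u / 4)],
    a bound of order [rho] and type [T] for the coefficients
    [f^(2k)(z) / (2k)!] becomes a bound for [f^(2k)(z) / k!] with exponent
    [max_u (T (u r)^(rho / 2) - u / 4) = caloric_type rho T * r^(rho / (2 - rho))]
    ([caloric_young], [caloric_young_eq]). This works in both directions, so
    the [z]-growth bounds the [t]-growth locally uniformly in [z]
    ([heat_growth_up]), and the [t]-growths of [F] and [dz F] at a single [z],
    which see the even and the odd derivatives of [f], together bound the
    [z]-growth ([heat_growth_down]). The formula for the caloric type follows.

    For the almost everywhere statements, suppose that on a set of positive measure of a vertical line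
    the coefficients obey a bound with a type [T] smaller than the maximal one.
    Everywhere they obey a bound with a type [T2] as close to the maximal one as
    desired, on discs of any radius. A two-constants inequality
    ([two_constants]) then gives the bound with type [sqrt (T * T2)] on a whole
    disc; it comes from a Remez inequality for Taylor polynomials ([remez_line]),
    itself Lagrange interpolation at well separated points of the set. On a disc
    Cauchy's estimate passes from the coefficients of [F] to those of [dz F] and,
    by the heat equation, back; so both families have too small a type at a
    point, against [heat_growth_down]. Hence every vertical section of the exceptional set
    is a null set, and Fubini concludes ([growth_set_negligible]). The same
    argument with harmonic means of orders shows that the order is maximal almost
    everywhere.

    The function theory needed is that of entire functions of one variable with a
    parameter: Goursat's theorem on rectangles, transported to circles by the
    exponential ([mean_circle_const]), gives Taylor coefficients that are
    independent of the radius and a Taylor formula with remainder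
    ([taylor_remainder]). *)

(** * Complex numbers as a normed plane *)

Definition nrm {R : realType} (z : R[i]) : R := Normc.normc z.
Arguments nrm : simpl never.

Section ComplexNorm.
Context {R : realType}.
Local Notation C := (R[i]).
Implicit Types (z w : C) (x y : R).

Lemma nrmE z : nrm z = Normc.normc z. Proof. by []. Qed.

Lemma nrm_ge0 z : 0 <= nrm z.
Proof. by case: z => a b; rewrite /nrm /Normc.normc sqrtr_ge0. Qed.

Lemma nrm0 : nrm (0 : C) = 0. Proof. exact: Normc.normc0. Qed.

Lemma nrm1 : nrm (1 : C) = 1. Proof. exact: Normc.normc1. Qed.

Lemma nrm_eq0 z : (nrm z == 0) = (z == 0).
Proof.
apply/eqP/eqP => [|->]; [exact: Normc.eq0_normc | exact: nrm0].
Qed.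

Lemma nrm_gt0 z : (0 < nrm z) = (z != 0).
Proof. by rewrite lt0r nrm_eq0 nrm_ge0 andbT. Qed.

Lemma nrmM z w : nrm (z * w) = nrm z * nrm w.
Proof. exact: Normc.normcM. Qed.

Lemma nrmV z : nrm z^-1 = (nrm z)^-1.
Proof. exact: Normc.normcV. Qed.

Lemma nrmX z n : nrm (z ^+ n) = nrm z ^+ n.
Proof. by elim: n => [|n IH]; rewrite ?expr0 ?nrm1// !exprS nrmM IH. Qed.

Lemma nrmD z w : nrm (z + w) <= nrm z + nrm w.
Proof. exact: le_normcD. Qed.

Lemma nrmN z : nrm (- z) = nrm z.
Proof. exact: normcN. Qed.

Lemma nrmB z w : nrm (z - w) <= nrm z + nrm w.
Proof. by rewrite (le_trans (nrmD _ _))// nrmN. Qed.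

Lemma nrm_distC z w : nrm (z - w) = nrm (w - z).
Proof. by rewrite -nrmN opprB. Qed.

Lemma nrm_real x : nrm (x%:C : C) = `|x|.
Proof. by rewrite /nrm /Normc.normc /= expr0n addr0 sqrtr_sqr. Qed.

Lemma nrm_nat n : nrm (n%:R : C) = n%:R.
Proof. by rewrite -(rmorph_nat (real_complex R)) nrm_real ger0_norm. Qed.

Lemma nrm_sum (I : Type) (s : seq I) (P : pred I) (f : I -> C) :
  nrm (\sum_(i <- s | P i) f i) <= \sum_(i <- s | P i) nrm (f i).
Proof.
elim/big_ind2 : _ => //; first by rewrite nrm0.
by move=> a b c d ab cd; rewrite (le_trans (nrmD _ _))// lerD.
Qed.

Lemma ler_Re_nrm z : `|complex.Re z| <= nrm z.
Proof.
case: z => a b /=; rewrite -[leLHS]sqrtr_sqr ler_wsqrtr//.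
by rewrite lerDl sqr_ge0.
Qed.

Lemma ler_Im_nrm z : `|complex.Im z| <= nrm z.
Proof.
case: z => a b /=; rewrite -[leLHS]sqrtr_sqr ler_wsqrtr//.
by rewrite lerDr sqr_ge0.
Qed.

Lemma nrm_le_ReIm z : nrm z <= `|complex.Re z| + `|complex.Im z|.
Proof.
rewrite {1}[z]complexE (le_trans (nrmD _ _))// nrmM !nrm_real.
by rewrite /nrm /Normc.normc /= expr0n expr1n add0r sqrtr1 mul1r.
Qed.

Lemma normcE_real z : `|z| = (nrm z)%:C.
Proof. by case: z. Qed.

Lemma nbhs_nrmP z (P : set C) :
  nbhs z P <-> exists2 d : R, 0 < d & forall h, nrm h < d -> P (z + h).
Proof.
split=> [/nbhs_ballP [d /= d0 H]|[d d0 H]].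
- have [dE d'] : d = (complex.Re d)%:C /\ 0 < complex.Re d.
    by move: d0; rewrite ltcE /= => /andP[/eqP d1 d2]; split=> //;
       case: d d1 {d2 H} => a b /= ->.
  exists (complex.Re d) => // h hd; apply: H.
  rewrite /ball /= /ball_ /= opprD addrA subrr sub0r normrN normcE_real dE.
  by rewrite ltcR.
- apply/nbhs_ballP; exists d%:C; first by rewrite /= ltcR.
  move=> w /=; rewrite /ball /= /ball_ /= normcE_real ltcR => hw.
  by have := H (w - z); rewrite subrKC; apply; rewrite nrm_distC.
Qed.

Lemma cvg_nrmP (T : Type) (F : set_system T) (FF : Filter F) (f : T -> C) z :
  f @ F --> z <-> forall e : R, 0 < e -> \forall x \near F, nrm (f x - z) < e.
Proof.
split=> [fz e e0|H].
- apply: (fz [set w | nrm (w - z) < e]).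
  by apply/nbhs_nrmP; exists e => // h hd /=; rewrite addrC addKr.
- move=> A /nbhs_nrmP[d d0 HA]; have := H _ d0.
  rewrite nbhs_filterE /= => K; apply: filterS K => x xd /=.
  by rewrite -(subrKC z (f x)); apply: HA.
Qed.

Lemma continuous_nrmP (f : C -> C) z :
  {for z, continuous f} <->
  forall e : R, 0 < e -> exists2 d : R, 0 < d &
    forall h, nrm h < d -> nrm (f (z + h) - f z) < e.
Proof.
have P := @cvg_nrmP _ (nbhs z) (nbhs_filter z) f (f z).
split=> [/P H e e0|H]; last apply/P => e e0.
- by have /nbhs_nrmP := H _ e0.
- by apply/nbhs_nrmP; exact: H.
Qed.

Lemma continuous_Re : continuous (@complex.Re R : C -> R).
Proof.
move=> z; apply/(@cvgrPdist_lt _ _ _ (nbhs z) (nbhs_filter z)) => e e0.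
apply/nbhs_nrmP; exists e => // h hd.
rewrite -raddfB /= (le_lt_trans (ler_Re_nrm _))//.
by rewrite opprD addrA subrr sub0r nrmN.
Qed.

Lemma continuous_Im : continuous (@complex.Im R : C -> R).
Proof.
move=> z; apply/(@cvgrPdist_lt _ _ _ (nbhs z) (nbhs_filter z)) => e e0.
apply/nbhs_nrmP; exists e => // h hd.
rewrite -raddfB /= (le_lt_trans (ler_Im_nrm _))//.
by rewrite opprD addrA subrr sub0r nrmN.
Qed.

Lemma continuous_complex (T : topologicalType) (f g : T -> R) :
  continuous f -> continuous g -> continuous (fun t => f t +i* g t : C).
Proof.
move=> cf cg t; apply/(@cvg_nrmP _ (nbhs t) (nbhs_filter t)) => e e0.
have e20 : 0 < e / 2 by rewrite divr_gt0.
have /cvgrPdist_lt/(_ _ e20) Hf := cf t.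
have /cvgrPdist_lt/(_ _ e20) Hg := cg t.
near=> u; rewrite (le_lt_trans (nrm_le_ReIm _))//= [ltRHS](splitr e).
by apply: ltrD; rewrite distrC; near: u.
Unshelve. all: by end_near. Qed.

Lemma continuous_nrm : continuous (@nrm R).
Proof.
move=> z; apply/(@cvgrPdist_lt _ _ _ (nbhs z) (nbhs_filter z)) => e e0.
apply/nbhs_nrmP; exists e => // h hd.
rewrite ltr_norml; have := nrmD (z + h) (- h); have := nrmD z h.
by rewrite addrK nrmN; move: hd; lra.
Qed.

Lemma derivable_nrmP (f : C -> C) z l :
  is_derive z 1 f l <->
  forall e : R, 0 < e -> exists2 d : R, 0 < d &
    forall h, nrm h < d -> nrm (f (z + h) - f z - l * h) <= e * nrm h.
Proof.
split=> [[df fl] e e0|H].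
- have := df; rewrite /derivable cvg_ex => -[l' /[dup] Hl'].
  have -> : l' = l by rewrite -fl; apply/esym/cvg_lim => //.
  move=> /(@cvg_nrmP _ _ (dnbhs_filter 0))/(_ _ e0).
  move=> /nbhs_nrmP [d d0 H]; exists d => // h hd.
  have [->|h0] := eqVneq h 0.
    by rewrite addr0 subrr mulr0 subr0 nrm0 mulr0.
  have := H h hd; rewrite add0r => /(_ h0) /ltW.
  rewrite /GRing.scale /= mulr1 addrC => Hh.
  have -> : f (z + h) - f z - l * h = (h^-1 * (f (z + h) - f z) - l) * h.
    by field.
  rewrite nrmM ler_wpM2r ?nrm_ge0//; move: Hh.
  by rewrite [_ - f z]addrC [h + z]addrC (addrC (- f z)) addrC.
- have K : h^-1 *: (f (h *: 1 + z) - f z) @[h --> 0^'] --> l.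
    apply/(@cvg_nrmP _ _ (dnbhs_filter 0)) => e e0; have e20 : 0 < e / 2 by rewrite divr_gt0.
    have [d d0 Hd] := H _ e20.
    apply/nbhs_nrmP; exists d => // h hd; rewrite add0r => h0.
    rewrite /GRing.scale /= mulr1 (addrC h).
    have -> : h^-1 * (f (z + h) - f z) - l = (f (z + h) - f z - l * h) / h.
      by field.
    rewrite nrmM nrmV ltr_pdivrMr ?nrm_gt0//.
    rewrite (le_lt_trans (Hd _ hd))// ltr_pM2r ?nrm_gt0//.
    by rewrite ltr_pdivrMr// ltr_pMr// ltr1n.
  split; first by apply/cvg_ex; exists l.
  by apply: cvg_lim => //; exact: K.
Qed.

Lemma is_derive_quadratic (f : C -> C) z l (A d : R) : 0 < d ->
  (forall h, nrm h < d -> nrm (f (z + h) - f z - l * h) <= A * nrm h ^+ 2) ->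
  is_derive z 1 f l.
Proof.
move=> d0 H; apply/derivable_nrmP => e e0.
have A1 : 0 < `|A| + 1 by rewrite ltr_wpDl.
exists (Num.min d (e / (`|A| + 1))).
  by rewrite lt_min d0 divr_gt0.
move=> h; rewrite lt_min => /andP[hd he]; apply: (le_trans (H h hd)).
rewrite expr2 mulrA ler_wpM2r ?nrm_ge0//.
apply: (@le_trans _ _ ((`|A| + 1) * nrm h)).
  by rewrite ler_wpM2r ?nrm_ge0// (le_trans (ler_norm A))// lerDl.
by move: he; rewrite ltr_pdivlMr// mulrC => /ltW.
Qed.

End ComplexNorm.

(** * Integrals of complex-valued functions *)

Section ComplexIntegral.
Context {R : realType}.
Local Notation C := (R[i]).
Local Notation mu := (@lebesgue_measure R).
Implicit Types (a b : R) (f g : R -> C).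

(** Integrating the two components separately costs a factor 2 in the norm
    estimates below; orders and types do not see constant factors. *)
Definition Cint a b f : C :=
  (\int[mu]_(x in `[a, b]) complex.Re (f x)) +i*
  (\int[mu]_(x in `[a, b]) complex.Im (f x)).


Lemma continuous_integrable_itv (f : R -> R) a b : continuous f ->
  mu.-integrable `[a, b] (EFin \o f).
Proof.
move=> cf; apply: continuous_compact_integrable; first exact: segment_compact.
exact: continuous_subspaceT.
Qed.

Lemma continuous_ReP f : continuous f -> continuous (fun x => complex.Re (f x)).
Proof.
by move=> cf x; apply: continuous_comp; [exact: cf|exact: continuous_Re].
Qed.

Lemma continuous_ImP f : continuous f -> continuous (fun x => complex.Im (f x)).
Proof.
by move=> cf x; apply: continuous_comp; [exact: cf|exact: continuous_Im].
Qed.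

Hint Extern 0 (is_true (measurable _)) => exact: measurable_itv : core.

Lemma fine_mu_itv a b : a <= b -> fine (mu `[a, b]) = b - a.
Proof.
move=> ab; have -> := @lebesgue_measure_itv R (Interval (BLeft a) (BRight b)); rewrite /= lte_fin.
case: ltP => [//|ba]; have -> : a = b by apply/eqP; rewrite eq_le ab ba.
by rewrite subrr.
Qed.

Lemma Rint_le (f : R -> R) a b (M : R) : a <= b -> continuous f ->
  (forall x, a <= x <= b -> `|f x| <= M) ->
  `|\int[mu]_(x in `[a, b]) f x| <= M * (b - a).
Proof.
move=> ab cf H; have If := @continuous_integrable_itv f a b cf.
apply: (le_trans (le_normr_Rintegral _ If)) => //.
have -> : M * (b - a) = \int[mu]_(x in `[a, b]) M.
  by rewrite Rintegral_cst// fine_mu_itv.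
apply: le_Rintegral => //.
- apply: continuous_integrable_itv => x.
  by apply: continuous_comp; [exact: cf|exact: norm_continuous].
- by apply: continuous_integrable_itv => x; exact: cvg_cst.
Qed.

Lemma Cint_le f a b (M : R) : a <= b -> continuous f ->
  (forall x, a <= x <= b -> nrm (f x) <= M) ->
  nrm (Cint a b f) <= 2 * M * (b - a).
Proof.
move=> ab cf H; rewrite (le_trans (nrm_le_ReIm _))//= -mulrA mulrDl mul1r.
apply: lerD; apply: Rint_le => //.
- exact: continuous_ReP.
- by move=> x /H; apply: le_trans; exact: ler_Re_nrm.
- exact: continuous_ImP.
- by move=> x /H; apply: le_trans; exact: ler_Im_nrm.
Qed.

Lemma CintD f g a b : continuous f -> continuous g ->
  Cint a b (fun x => f x + g x) = Cint a b f + Cint a b g.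
Proof.
move=> cf cg; rewrite /Cint.
have -> : forall u v w z : R, (u +i* v) + (w +i* z) = (u + w) +i* (v + z) by [].
rewrite -!RintegralD//; try (apply: continuous_integrable_itv).
- by congr (_ +i* _); apply: eq_Rintegral => x _; case: (f x); case: (g x).
- exact: continuous_ImP.
- exact: continuous_ImP.
- exact: continuous_ReP.
- exact: continuous_ReP.
Qed.

Lemma CintZ (k : C) f a b : continuous f ->
  Cint a b (fun x => k * f x) = k * Cint a b f.
Proof.
move=> cf; case: k => u v; rewrite /Cint.
have -> : forall w z : R, (u +i* v) * (w +i* z) =
  (u * w - v * z) +i* (u * z + v * w) by [].
have cR := continuous_ReP cf; have cI := continuous_ImP cf.
have cM (k : R) (p : R -> R) : continuous p -> continuous (fun x => k * p x).
  by move=> cp x; apply: cvgM; [exact: cvg_cst|exact: cp].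
rewrite -!RintegralZl//; try exact: continuous_integrable_itv.
rewrite -RintegralB//; try (by apply: continuous_integrable_itv; exact: cM).
rewrite -RintegralD//; try (by apply: continuous_integrable_itv; exact: cM).
by congr (_ +i* _); apply: eq_Rintegral => x _; case: (f x).
Qed.

Lemma CintB f g a b : continuous f -> continuous g ->
  Cint a b (fun x => f x - g x) = Cint a b f - Cint a b g.
Proof.
move=> cf cg.
have cNg : continuous (fun x => - 1 * g x).
  by move=> x; apply: cvgM; [exact: cvg_cst|exact: cg].
rewrite -[- Cint a b g]mulN1r -CintZ// -CintD//.
by congr Cint; apply/funext => x; rewrite mulN1r.
Qed.

Lemma Cint_cst (k : C) a b : a <= b -> Cint a b (fun=> k) = k * (b - a)%:C.
Proof.
move=> ab; rewrite /Cint !Rintegral_cst// !fine_mu_itv// -complexr0.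
case: k => u v.
by apply/eqP; rewrite eq_complex /= !mulr0 subr0 add0r !eqxx.
Qed.

Lemma Cint_near f a b (k : C) (M : R) : a <= b -> continuous f ->
  (forall x, a <= x <= b -> nrm (f x - k) <= M) ->
  nrm (Cint a b f - k * (b - a)%:C) <= 2 * M * (b - a).
Proof.
move=> ab cf H.
have ck : continuous (fun _ : R => k) by move=> x; exact: cvg_cst.
have cfk : continuous (fun x => f x - k).
  by move=> x; apply: cvgB; [exact: cf|exact: ck].
rewrite -(Cint_cst k ab) -(CintB a b cf ck).
exact: (Cint_le ab cfk H).
Qed.

Lemma Cint_split f a b c : a <= b -> b <= c -> continuous f ->
  Cint a c f = Cint a b f + Cint b c f.
Proof.
move=> ab bc cf.
have Rsplit (p : R -> R) : continuous p ->
  \int[mu]_(x in `[a, c]) p x =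
  \int[mu]_(x in `[a, b]) p x + \int[mu]_(x in `[b, c]) p x.
  move=> cp; have Ip u v := @continuous_integrable_itv p u v cp.
  have := @Rintegral_itvB _ p (BLeft a) (BRight c) b (Ip a c).
  rewrite !bnd_simp => /(_ ab bc) /eqP; rewrite subr_eq addrC => /eqP ->.
  congr (_ + _); rewrite Rintegral_itv_obnd_cbnd//.
  apply: integrableS (Ip b c) => //.
  by apply: subset_itvr; rewrite bnd_simp.
rewrite /Cint (Rsplit _ (continuous_ReP cf)) (Rsplit _ (continuous_ImP cf)).
by [].
Qed.

End ComplexIntegral.

Arguments Cint : simpl never.

(** * Goursat's theorem on rectangles *)

Section Goursat.
Context {R : realType}.
Local Notation C := (R[i]).
Implicit Types (a b c d : R) (h : C -> C).
Local Arguments Cint : simpl never.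

(** Boundary integral of [h] over the rectangle with corners [a +i* c] and
    [b +i* d]; opposite sides are paired so that constants cancel pointwise. *)
Definition rect_int h a b c d : C :=
  Cint a b (fun x => h (x +i* c) - h (x +i* d)) +
  'i * Cint c d (fun y => h (b +i* y) - h (a +i* y)).


Local Arguments rect_int : simpl never.

Lemma continuous_hline h c : continuous h -> continuous (fun x : R => h (x +i* c)).
Proof.
move=> ch x; apply: (@continuous_comp _ _ _ (fun x : R => x +i* c)); last exact: ch.
by apply: (@continuous_complex R _ id (cst c)) => y; [exact: cvg_id|exact: cvg_cst].
Qed.

Lemma continuous_vline h a : continuous h -> continuous (fun y : R => h (a +i* y)).
Proof.
move=> ch x; apply: (@continuous_comp _ _ _ (fun y : R => a +i* y)); last exact: ch.
by apply: (@continuous_complex R _ (cst a) id) => y; [exact: cvg_cst|exact: cvg_id].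
Qed.

Lemma continuous_hdiff h c d : continuous h ->
  continuous (fun x : R => h (x +i* c) - h (x +i* d)).
Proof. by move=> ch x; apply: cvgB; exact: continuous_hline. Qed.

Lemma continuous_vdiff h a b : continuous h ->
  continuous (fun y : R => h (b +i* y) - h (a +i* y)).
Proof. by move=> ch x; apply: cvgB; exact: continuous_vline. Qed.

(** The first-order part [h p + l * (w - p)] has zero integral over the boundary,
    so only the remainder contributes. *)
Lemma rect_int_local h a b c d (p l : C) (M : R) :
  a <= b -> c <= d -> continuous h ->
  (forall x y, a <= x <= b -> c <= y <= d ->
     nrm (h (x +i* y) - h p - l * (x +i* y - p)) <= M) ->
  nrm (rect_int h a b c d) <= 4 * M * ((b - a) + (d - c)).
Proof.
move=> ab cd ch H.
have diff x y x' y' : a <= x <= b -> c <= y <= d -> a <= x' <= b ->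
    c <= y' <= d ->
    nrm (h (x +i* y) - h (x' +i* y') - l * ((x +i* y) - (x' +i* y'))) <= 2 * M.
  move=> hx hy hx' hy'; have K := nrmB
   (h (x +i* y) - h p - l * (x +i* y - p))
   (h (x' +i* y') - h p - l * (x' +i* y' - p)).
  rewrite mulrDl mul1r.
  apply: le_trans (lerD (H _ _ hx hy) (H _ _ hx' hy')).
  apply: le_trans K; rewrite le_eqVlt; apply/orP; left; apply/eqP.
  by congr nrm; ring.
have aab : a <= a <= b by rewrite lexx.
have bab : a <= b <= b by rewrite lexx ab.
have ccd : c <= c <= d by rewrite lexx.
have dcd : c <= d <= d by rewrite lexx cd.
have /(Cint_near ab (continuous_hdiff ch)) H1 x : a <= x <= b ->
    nrm (h (x +i* c) - h (x +i* d) - l * ('i * (c - d)%:C)) <= 2 * M.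
  move=> hx; have <- : (x +i* c) - (x +i* d) = 'i * (c - d)%:C :> C.
    by apply/eqP; rewrite eq_complex /=; apply/andP; split; apply/eqP; ring.
  exact: diff.
have /(Cint_near cd (continuous_vdiff ch)) H2 x : c <= x <= d ->
    nrm (h (b +i* x) - h (a +i* x) - l * (b - a)%:C) <= 2 * M.
  move=> hx; have <- : (b +i* x) - (a +i* x) = (b - a)%:C :> C.
    by apply/eqP; rewrite eq_complex /=; apply/andP; split; apply/eqP; ring.
  exact: diff.
have -> : rect_int h a b c d =
   (Cint a b (fun x => h (x +i* c) - h (x +i* d)) -
     l * ('i * (c - d)%:C) * (b - a)%:C) +
   'i * (Cint c d (fun y => h (b +i* y) - h (a +i* y)) -
     l * (b - a)%:C * (d - c)%:C).
  by rewrite /rect_int !rmorphB /=; ring.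
rewrite (le_trans (nrmD _ _))// nrmM.
have -> : nrm ('i : C) = 1 by rewrite /nrm /Normc.normc /= expr0n expr1n add0r sqrtr1.
rewrite mul1r mulrDr; apply: lerD.
- by apply: le_trans H1 _; rewrite mulrA -natrM.
- by apply: le_trans H2 _; rewrite mulrA -natrM.
Qed.

Lemma rect_int_splith h a m b c d : a <= m -> m <= b -> continuous h ->
  rect_int h a b c d = rect_int h a m c d + rect_int h m b c d.
Proof.
move=> am mb ch; rewrite /rect_int (Cint_split am mb (continuous_hdiff ch)).
have E u v : Cint c d (fun y => h (v +i* y) - h (u +i* y)) =
    Cint c d (fun y => h (v +i* y)) - Cint c d (fun y => h (u +i* y)).
  by apply: CintB; exact: continuous_vline.
by rewrite !E; ring.
Qed.

Lemma rect_int_splitv h a b c m d : c <= m -> m <= d -> continuous h ->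
  rect_int h a b c d = rect_int h a b c m + rect_int h a b m d.
Proof.
move=> cm md ch; rewrite /rect_int (Cint_split cm md (continuous_vdiff ch)).
have E u v : Cint a b (fun x => h (x +i* u) - h (x +i* v)) =
    Cint a b (fun x => h (x +i* u)) - Cint a b (fun x => h (x +i* v)).
  by apply: CintB; exact: continuous_hline.
by rewrite !E; ring.
Qed.

Lemma rect_int_quarter h (L H : R) (p : R * R) : 0 <= L -> 0 <= H ->
  continuous h ->
  exists q : R * R, [/\ p.1 <= q.1 <= p.1 + L / 2, p.2 <= q.2 <= p.2 + H / 2 &
    nrm (rect_int h p.1 (p.1 + L) p.2 (p.2 + H)) <=
    4 * nrm (rect_int h q.1 (q.1 + L / 2) q.2 (q.2 + H / 2))].
Proof.
move=> L0 H0 ch; case: p => a c /=.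
have HL : L / 2 + L / 2 = L by rewrite -splitr.
have HH : H / 2 + H / 2 = H by rewrite -splitr.
have L2 : 0 <= L / 2 by rewrite divr_ge0.
have H2 : 0 <= H / 2 by rewrite divr_ge0.
have am : a <= a + L / 2 by rewrite lerDl.
have ml : a + L / 2 <= a + L by lra.
have cm : c <= c + H / 2 by rewrite lerDl.
have mh : c + H / 2 <= c + H by lra.
have -> := @rect_int_splith h _ _ _ c (c + H) am ml ch.
have -> := @rect_int_splitv h a (a + L / 2) _ _ _ cm mh ch.
have -> := @rect_int_splitv h (a + L / 2) (a + L) _ _ _ cm mh ch.
have -> : a + L = (a + L / 2) + L / 2 by lra.
have -> : c + H = (c + H / 2) + H / 2 by lra.
set A1 := rect_int h a (a + L / 2) c (c + H / 2).
set A2 := rect_int h a (a + L / 2) (c + H / 2) _.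
set A3 := rect_int h (a + L / 2) _ c (c + H / 2).
set A4 := rect_int h (a + L / 2) _ (c + H / 2) _.
set N := nrm (_ + _).
have [h1|h1] := lerP N (4 * nrm A1).
  by exists (a, c) => /=; rewrite !lexx !lerDl; split => //.
have [h2|h2] := lerP N (4 * nrm A2).
  by exists (a, c + H / 2) => /=; rewrite !lexx !lerDl; split => //; apply/andP.
have [h3|h3] := lerP N (4 * nrm A3).
  by exists (a + L / 2, c) => /=; rewrite !lexx !lerDl; split => //; apply/andP.
have [h4|h4] := lerP N (4 * nrm A4).
  by exists (a + L / 2, c + H / 2) => /=; rewrite !lexx !lerDl; split => //; apply/andP.
have := nrmD (A1 + A2) (A3 + A4); have := nrmD A1 A2; have := nrmD A3 A4.
by rewrite -/N; lra.
Qed.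

(** Repeated quartering keeps a quarter of the integral in a rectangle of half the
    size; at the common point of the rectangles the derivative makes the integral
    [o(size ^ 2)], which is a contradiction unless it vanishes. *)
Lemma goursat h a b c d : a <= b -> c <= d -> continuous h ->
  (forall x y, a <= x <= b -> c <= y <= d -> derivable h (x +i* y) 1) ->
  rect_int h a b c d = 0.
Proof.
move=> ab cd ch dh.
apply/eqP; rewrite -nrm_eq0 eq_le nrm_ge0 andbT leNgt; apply/negP => m0.
set m := nrm _ in m0.
pose L n := (b - a) / 2 ^+ n; pose H n := (d - c) / 2 ^+ n.
have L0 n : 0 <= L n by rewrite divr_ge0 ?subr_ge0// exprn_ge0.
have H0 n : 0 <= H n by rewrite divr_ge0 ?subr_ge0// exprn_ge0.
have LS n : L n.+1 = L n / 2 by rewrite /L exprSr invfM mulrA.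
have HS n : H n.+1 = H n / 2 by rewrite /H exprSr invfM mulrA.
have [F HF] : {F : nat -> R * R -> R * R | forall n p,
    [/\ p.1 <= (F n p).1 <= p.1 + L n.+1, p.2 <= (F n p).2 <= p.2 + H n.+1 &
    nrm (rect_int h p.1 (p.1 + L n) p.2 (p.2 + H n)) <=
    4 * nrm (rect_int h (F n p).1 ((F n p).1 + L n.+1)
                       (F n p).2 ((F n p).2 + H n.+1))]}.
  have K n p : {q : R * R | [/\ p.1 <= q.1 <= p.1 + L n.+1,
    p.2 <= q.2 <= p.2 + H n.+1 &
    nrm (rect_int h p.1 (p.1 + L n) p.2 (p.2 + H n)) <=
    4 * nrm (rect_int h q.1 (q.1 + L n.+1) q.2 (q.2 + H n.+1))]}.
    by apply: cid; rewrite LS HS; exact: rect_int_quarter.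
  by exists (fun n p => sval (K n p)) => n p; case: (K n p).
pose P := fix P n := if n is n'.+1 then F n' (P n') else (a, c).
have PS n : P n.+1 = F n (P n) by [].
have mP n : m <= 4 ^+ n * nrm (rect_int h (P n).1 ((P n).1 + L n)
                                          (P n).2 ((P n).2 + H n)).
  elim: n => [|n IH].
    by rewrite expr0 mul1r /P /L /H expr0 !divr1 /= !subrKC.
  apply: (le_trans IH); rewrite exprSr -mulrA ler_wpM2l ?exprn_ge0//.
  by rewrite PS; have [] := HF n (P n).
have inc1 n : (P n).1 <= (P n.+1).1 by rewrite PS; case: (HF n (P n)) => /andP[].
have inc2 n : (P n).2 <= (P n.+1).2 by rewrite PS; case: (HF n (P n)) => _ /andP[].
have dec1 n : (P n.+1).1 + L n.+1 <= (P n).1 + L n.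
  have [/andP[_ h1] _ _] := HF n (P n); rewrite -PS in h1.
  by move: h1; rewrite LS; lra.
have dec2 n : (P n.+1).2 + H n.+1 <= (P n).2 + H n.
  have [_ /andP[_ h1] _] := HF n (P n); rewrite -PS in h1.
  by move: h1; rewrite HS; lra.
have nested (u v : nat -> R) : (forall n, u n <= u n.+1) ->
    (forall n, v n.+1 <= v n) -> (forall n, u n <= v n) ->
    exists x, forall n, u n <= x <= v n.
  move=> ui vd uv; exists (sup (range u)).
  have uk n k : u n <= u (k + n)%N.
    by elim: k => // k; move/le_trans; apply; rewrite addSn.
  have vk n k : v (k + n)%N <= v n.
    by elim: k => // k; apply: le_trans; rewrite addSn.
  have ub n : ubound (range u) (v n).
    move=> _ [k _ <-]; apply: (le_trans (uk k n)).
    by apply: le_trans (vk n k); rewrite addnC.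
  have hs : has_sup (range u) by split; [exists (u 0%N), 0%N|exists (v 0%N)].
  move=> n; apply/andP; split; first by apply: sup_upper_bound => //; exists n.
  by apply: sup_le_ub => //; exists (u 0%N), 0%N.
have uv1 n : (P n).1 <= (P n).1 + L n by rewrite lerDl.
have uv2 n : (P n).2 <= (P n).2 + H n by rewrite lerDl.
have [x0 hx0] := nested _ _ inc1 dec1 uv1.
have [y0 hy0] := nested _ _ inc2 dec2 uv2.
have abx : a <= x0 <= b by have := hx0 0%N; rewrite /P /L /= expr0 divr1 subrKC.
have cdy : c <= y0 <= d by have := hy0 0%N; rewrite /P /H /= expr0 divr1 subrKC.
have /derivableP /derivable_nrmP Dh := dh _ _ abx cdy.
set D := (b - a) + (d - c).
have D0 : 0 <= D by rewrite addr_ge0// subr_ge0.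
(* Small enough for [4 * e * D ^ 2 <= m / 2]. *)
pose e := m / (8 * (D + 1) ^+ 2).
have D1 : 0 < D + 1 by rewrite ltr_wpDl.
have e0 : 0 < e by rewrite divr_gt0// mulr_gt0// exprn_gt0.
have [dl dl0 Hdl] := Dh _ e0.
have [n Hn] : exists n, D / 2 ^+ n < dl.
  have /cvgrPdist_lt/(_ _ dl0) : (D * (2^-1 ^+ n)) @[n --> \oo] --> 0.
    rewrite -(mulr0 D); apply: cvgM; first exact: cvg_cst.
    by apply: cvg_expr; rewrite ger0_norm// invf_lt1// ltr1n.
  case=> n _ /(_ n (leqnn n)) /=; rewrite sub0r normrN ger0_norm.
    by rewrite exprVn; exists n.
  by rewrite mulr_ge0// exprn_ge0// invr_ge0.
have DLH : L n + H n = D / 2 ^+ n by rewrite /L /H -mulrDl.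
have K x y : (P n).1 <= x <= (P n).1 + L n -> (P n).2 <= y <= (P n).2 + H n ->
   nrm ((x +i* y) - (x0 +i* y0)) <= D / 2 ^+ n.
  move=> hx hy; rewrite (le_trans (nrm_le_ReIm _))//= -DLH lerD//.
    by have := hx0 n; rewrite ler_norml; move: hx; lra.
  by have := hy0 n; rewrite ler_norml; move: hy; lra.
have Hm : nrm (rect_int h (P n).1 ((P n).1 + L n) (P n).2 ((P n).2 + H n)) <=
    4 * (e * (D / 2 ^+ n)) * (D / 2 ^+ n).
  rewrite -[X in _ * X]DLH.
  have -> : L n + H n = ((P n).1 + L n - (P n).1) + ((P n).2 + H n - (P n).2).
    by ring.
  apply: (@rect_int_local _ _ _ _ _ (x0 +i* y0) ('D_1 h (x0 +i* y0))) => //.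
  move=> x y hx hy; have Kxy := K _ _ hx hy.
  have := Hdl _ (le_lt_trans Kxy Hn); rewrite subrKC => /le_trans; apply.
  by rewrite ler_wpM2l// ltW.
have : m <= m / 2; last by move: m0; lra.
apply: (le_trans (mP n)).
apply: (@le_trans _ _ (4 ^+ n * (4 * (e * (D / 2 ^+ n)) * (D / 2 ^+ n)))).
  by rewrite ler_wpM2l ?exprn_ge0.
have -> : 4 ^+ n * (4 * (e * (D / 2 ^+ n)) * (D / 2 ^+ n)) = 4 * e * D ^+ 2.
  have -> : (4 : R) = 2 * 2 by ring.
  rewrite exprMn; have : (2 : R) ^+ n != 0 by rewrite expf_neq0// pnatr_eq0.
  by move: (2 ^+ n) => q q0; field.
rewrite /e.
have -> : 4 * (m / (8 * (D + 1) ^+ 2)) * D ^+ 2 =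
   (m / 2) * (D ^+ 2 / (D + 1) ^+ 2).
  by field; rewrite gt_eqF.
rewrite ler_piMr ?divr_ge0 ?(ltW m0)// ler_pdivrMr ?exprn_gt0// mul1r.
by rewrite ler_pXn2r ?nnegrE ?lerDl ?(ltW D1).
Qed.

End Goursat.

Arguments rect_int : simpl never.

(** * The complex exponential *)

Section ComplexExponential.
Context {R : realType}.
Local Notation C := (R[i]).
Implicit Types (x y : R) (z w : C).

Definition cexp z : C :=
  (expR (complex.Re z) * cos (complex.Im z)) +i*
  (expR (complex.Re z) * sin (complex.Im z)).

Lemma cexpD z w : cexp (z + w) = cexp z * cexp w.
Proof.
case: z => a b; case: w => c d; rewrite /cexp /= expRD cosD sinD.
by apply/eqP; rewrite eq_complex /=; apply/andP; split; apply/eqP; ring.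
Qed.

Lemma nrm_cexp z : nrm (cexp z) = expR (complex.Re z).
Proof.
rewrite /nrm /Normc.normc /cexp /= !exprMn -mulrDr cos2Dsin2 mulr1 sqrtr_sqr.
by rewrite ger0_norm// expR_ge0.
Qed.

Lemma cexp_neq0 z : cexp z != 0.
Proof. by rewrite -nrm_gt0 nrm_cexp expR_gt0. Qed.

Lemma real_derive_eps (f : R -> R) (x l : R) : is_derive x 1 f l ->
  forall e : R, 0 < e -> exists2 d : R, 0 < d &
    forall h, `|h| < d -> `|f (x + h) - f x - l * h| <= e * `|h|.
Proof.
move=> [df fl] e e0.
have := df; rewrite /derivable cvg_ex => -[l' /[dup] Hl'].
have -> : l' = l by rewrite -fl; apply/esym/cvg_lim => //.
move=> /cvgrPdist_le/(_ _ e0) /nbhs_ballP [d /= d0 H]; exists d => // h hd.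
have [->|h0] := eqVneq h 0.
  by rewrite addr0 subrr mulr0 subr0 normr0 mulr0.
have := H h; rewrite /ball /= sub0r normrN => /(_ hd h0).
rewrite /GRing.scale /= mulr1 (addrC h) => Hh.
have -> : f (x + h) - f x - l * h = - ((l - h^-1 * (f (x + h) - f x)) * h).
  by field.
by rewrite normrN normrM ler_wpM2r.
Qed.

(** By [cexpD] only the derivative at 0 matters, and there the first-order
    expansions of [expR], [cos] and [sin] suffice. *)
Lemma is_derive_cexp z : is_derive z 1 cexp (cexp z).
Proof.
apply/derivable_nrmP => e e0.
pose N := nrm (cexp z).
have N0 : 0 < N by rewrite nrm_gt0 cexp_neq0.
pose e1 := Num.min 1 (e / (10 * N)).
have e10 : 0 < e1 by rewrite lt_min ltr01 divr_gt0// mulr_gt0.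
have e11 : e1 <= 1 by rewrite ge_min lexx.
have e1N : 10 * e1 * N <= e.
  have : e1 <= e / (10 * N) by rewrite ge_min lexx orbT.
  rewrite ler_pdivlMr ?mulr_gt0//; lra.
clearbody e1.
have [d1 d10 H1] := real_derive_eps (is_derive_expR 0) e10.
have [d2 d20 H2] := real_derive_eps (is_derive_cos 0) e10.
have [d3 d30 H3] := real_derive_eps (is_derive_sin 0) e10.
exists (Num.min e1 (Num.min d1 (Num.min d2 d3))).
  by rewrite !lt_min e10 d10 d20.
move=> h; rewrite !lt_min => /and4P[he h1 h2 h3].
rewrite cexpD -[X in _ - X - _]mulr1 -!mulrBr nrmM.
suff : nrm (cexp h - 1 - h) <= 10 * e1 * nrm h.
  move=> H; rewrite -/N; apply: (@le_trans _ _ (N * (10 * e1 * nrm h))).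
    by rewrite ler_wpM2l// ltW.
  by rewrite mulrA ler_wpM2r ?nrm_ge0//; move: e1N; lra.
rewrite (le_trans (nrm_le_ReIm _))//.
have := ler_Re_nrm h; have := ler_Im_nrm h.
case: h he h1 h2 h3 => a b /=; set n := nrm (a +i* b) => he h1 h2 h3 hb ha.
have := H1 a (le_lt_trans ha h1); have := H2 b (le_lt_trans hb h2).
have := H3 b (le_lt_trans hb h3).
rewrite !add0r expR0 cos0 sin0 !(subr0, oppr0, mul0r, mul1r, addr0).
set A := expR a; set s := sin b; set c := cos b => Hs Hc HA.
have n0 : 0 <= n by rewrite nrm_ge0.
have HA' : `|A - 1| <= 2 * n.
  have -> : A - 1 = (A - 1 - a) + a by ring.
  rewrite (le_trans (ler_normD _ _))//.
  apply: (@le_trans _ _ (1 * `|a| + `|a|)); last by lra.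
  by rewrite lerD2r (le_trans HA)// ler_wpM2r.
have A3 : `|A| <= 3.
  have -> : A = (A - 1) + 1 by ring.
  by rewrite (le_trans (ler_normD _ _))// normr1; lra.
have P1 : `|A * c - 1 - a| <= 4 * e1 * n.
  have -> : A * c - 1 - a = A * (c - 1) + (A - 1 - a) by ring.
  rewrite (le_trans (ler_normD _ _))// normrM.
  apply: (@le_trans _ _ (3 * (e1 * n) + e1 * n)); last by lra.
  apply: lerD.
    by rewrite ler_pM// (le_trans Hc)// ler_wpM2l// ltW.
  by rewrite (le_trans HA)// ler_wpM2l// ltW.
have P2 : `|A * s - b| <= 5 * e1 * n.
  have -> : A * s - b = A * (s - b) + (A - 1) * b by ring.
  rewrite (le_trans (ler_normD _ _))// !normrM.
  apply: (@le_trans _ _ (3 * (e1 * n) + (2 * e1) * n)); last by lra.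
  apply: lerD.
    by rewrite ler_pM// (le_trans Hs)// ler_wpM2l// ltW.
  by rewrite ler_pM// (le_trans HA')// ler_pM2l// ltW.
apply: le_trans (lerD P1 P2) _.
have : 0 <= e1 * n by rewrite mulr_ge0// ltW.
by rewrite -!mulrA; lra.
Qed.

Definition unit_circle x : C := cos x +i* sin x.

Lemma nrm_unit_circle x : nrm (unit_circle x) = 1.
Proof. by rewrite /nrm /Normc.normc /= cos2Dsin2 sqrtr1. Qed.

Lemma continuous_unit_circle : continuous unit_circle.
Proof.
by apply: continuous_complex; [exact: continuous_cos|exact: continuous_sin].
Qed.

Lemma cexp_polar x y : cexp (x +i* y) = (expR x)%:C * unit_circle y.
Proof.
rewrite /cexp /unit_circle /=.
by apply/eqP; rewrite eq_complex /=; apply/andP; split; apply/eqP; ring.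
Qed.

End ComplexExponential.

(** * Means over circles *)

Section CircleMean.
Context {R : realType}.
Local Notation C := (R[i]).
Implicit Types (f g : R -> C) (r s : R).

Definition mean f : C := ((2 * pi)^-1)%:C * Cint 0 (2 * pi) f.

Let pi2_gt0 : 0 < 2 * pi :> R.
Proof. by rewrite mulr_gt0// pi_gt0. Qed.

Lemma meanD f g : continuous f -> continuous g ->
  mean (fun x => f x + g x) = mean f + mean g.
Proof. by move=> cf cg; rewrite /mean CintD// mulrDr. Qed.

Lemma meanB f g : continuous f -> continuous g ->
  mean (fun x => f x - g x) = mean f - mean g.
Proof. by move=> cf cg; rewrite /mean CintB// mulrBr. Qed.

Lemma meanZ (k : C) f : continuous f -> mean (fun x => k * f x) = k * mean f.
Proof. by move=> cf; rewrite /mean CintZ// mulrCA. Qed.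

Lemma mean_cst (k : C) : mean (fun=> k) = k.
Proof.
rewrite /mean Cint_cst ?ltW// subr0 mulrCA -rmorphM /=.
by rewrite mulVf ?gt_eqF// mulr1.
Qed.

Lemma mean_le f (M : R) : continuous f -> (forall x, nrm (f x) <= M) ->
  nrm (mean f) <= 2 * M.
Proof.
move=> cf H; rewrite /mean nrmM nrm_real ger0_norm; last first.
  by rewrite invr_ge0 ltW.
rewrite mulrC ler_pdivrMr//.
by have := Cint_le (ltW pi2_gt0) cf (fun x _ => H x); rewrite subr0.
Qed.

Lemma continuous_sum_fun (n : nat) (F : nat -> R -> C) :
  (forall k, continuous (F k)) -> continuous (fun x => \sum_(k < n) F k x).
Proof.
move=> cF x; elim: n => [|n IH].
  under eq_fun do rewrite big_ord0; exact: cvg_cst.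
under eq_fun do rewrite big_ord_recr /=.
by apply: cvgD; [exact: IH|exact: cF].
Qed.

Lemma mean_sum (n : nat) (F : nat -> R -> C) :
  (forall k, continuous (F k)) ->
  mean (fun x => \sum_(k < n) F k x) = \sum_(k < n) mean (F k).
Proof.
move=> cF; elim: n => [|n IH].
  under eq_fun do rewrite big_ord0; by rewrite mean_cst big_ord0.
under eq_fun do rewrite big_ord_recr /=.
by rewrite meanD ?IH ?big_ord_recr//; exact: continuous_sum_fun.
Qed.

Definition circle r (x : R) : C := r%:C * unit_circle x.

Lemma nrm_circle r x : nrm (circle r x) = `|r|.
Proof. by rewrite nrmM nrm_real nrm_unit_circle mulr1. Qed.

Lemma circle_neq0 r x : 0 < r -> circle r x != 0.
Proof. by move=> r0; rewrite -nrm_gt0 nrm_circle normr_gt0 gt_eqF. Qed.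

Lemma continuous_circle r : continuous (circle r).
Proof.
by move=> x; apply: cvgM; [exact: cvg_cst|exact: continuous_unit_circle].
Qed.

(** Compactness of the interval of integration makes the continuity in the
    parameter uniform. *)
Lemma mean_param_continuous (F : R * R -> C) r : continuous F ->
  forall e : R, 0 < e -> exists2 d : R, 0 < d & forall s, `|s - r| < d ->
    nrm (mean (fun x => F (s, x)) - mean (fun x => F (r, x))) <= e.
Proof.
move=> cF e e0.
have cFs s : continuous (fun x : R => F (s, x)).
  move=> x; apply: (@continuous_comp _ _ _ (fun x : R => (s, x))); last exact: cF.
  by apply: (@cvg_pair _ _ _ (nbhs x) (nbhs s) (nbhs x)); [exact: cvg_cst|exact: cvg_id].
have e4 : 0 < e / 4 by rewrite divr_gt0.
have /compact_near_coveringP K := @segment_compact R 0 (2 * pi).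
have : \forall s \near r, `[0, 2 * pi] `<=`
    [set x | nrm (F (s, x) - F (r, x)) < e / 2].
  apply: (K R (nbhs r) (fun s x => nrm (F (s, x) - F (r, x)) < e / 2) (nbhs_filter r)) => x _.
  have /(@cvg_nrmP _ _ _ (nbhs_filter _))/(_ _ e4) H := cF (r, x).
  have /(@cvg_nrmP _ _ _ (nbhs_filter _))/(_ _ e4) H' := cFs r x.
  have : \forall y \near x & s \near r,
     nrm (F (s, y) - F (r, x)) < e / 4 /\ nrm (F (r, y) - F (r, x)) < e / 4.
    case: H => -[U V] /= [Ur Vx] UV.
    exists (V `&` [set y | nrm (F (r, y) - F (r, x)) < e / 4], U) => /=.
      by split=> //; apply: filterI.
    by move=> [y s] /= [[Vy Hy] Us]; split=> //; exact: (UV (s, y)).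
  apply: filterS => -[y s] /= [H1 H2].
  have -> : F (s, y) - F (r, y) =
    (F (s, y) - F (r, x)) - (F (r, y) - F (r, x)) by ring.
  by rewrite (le_lt_trans (nrmB _ _))//; move: H1 H2; lra.
move=> /nbhs_ballP[d /= d0 H]; exists d => // s sd.
have {}H x : 0 <= x <= 2 * pi -> nrm (F (s, x) - F (r, x)) <= e / 2.
  move=> hx; apply/ltW/(H s); last by rewrite /= in_itv.
  by rewrite /ball /= distrC.
rewrite -meanB// /mean nrmM nrm_real ger0_norm ?invr_ge0 ?(ltW pi2_gt0)//.
rewrite mulrC ler_pdivrMr//.
have cD : continuous (fun x => F (s, x) - F (r, x)).
  by move=> x; apply: cvgB; exact: cFs.
apply: le_trans (Cint_le (ltW pi2_gt0) cD H) _.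
by rewrite subr0 (_ : 2 * (e / 2) = e)//; field.
Qed.

(** In the coordinate [cexp] the annulus is a rectangle of height 2 pi; by
    periodicity its horizontal sides cancel, and Goursat's theorem compares the
    vertical ones. *)
Lemma mean_circle_const (f : C -> C) r s : 0 < r -> r <= s ->
  (forall z, z != 0 -> {for z, continuous f}) ->
  (forall z, r <= nrm z <= s -> derivable f z 1) ->
  mean (fun x => f (circle r x)) = mean (fun x => f (circle s x)).
Proof.
move=> r0 rs cf df.
have s0 : 0 < s by exact: lt_le_trans rs.
pose h : C -> C := f \o cexp.
have ch : continuous h.
  move=> z; apply: continuous_comp; last by apply: cf; exact: cexp_neq0.
  apply: differentiable_continuous; apply/derivable1_diffP.
  by have [] := is_derive_cexp z.
have dh x y : ln r <= x <= ln s -> 0 <= y <= 2 * pi -> derivable h (x +i* y) 1.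
  move=> /andP[rx xs] _; apply/derivable1_diffP; apply: differentiable_comp.
    by apply/derivable1_diffP; have [] := is_derive_cexp (x +i* y).
  apply/derivable1_diffP; apply: df; rewrite nrm_cexp /=.
  rewrite -[X in X <= _ <= _](lnK r0) -[X in _ <= _ <= X](lnK s0).
  by rewrite !ler_expR rx.
have lnrs : ln r <= ln s by rewrite ler_ln ?posrE.
have := goursat lnrs (ltW pi2_gt0) ch dh.
rewrite /rect_int.
have E : (fun x : R => h (x +i* 0) - h (x +i* (2 * pi))) = fun=> 0.
  apply/funext => x; rewrite /h /= !cexp_polar /unit_circle cos0 sin0.
  by rewrite mulr_natl cos2pi sin2pi subrr.
rewrite E Cint_cst// mul0r add0r => /eqP; rewrite mulf_eq0 => /orP[/eqP[] /eqP|].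
  by rewrite oner_eq0.
rewrite CintB; [|exact: continuous_vline|exact: continuous_vline].
rewrite subr_eq0 => /eqP H; rewrite /mean; congr (_ * _).
have Eh t : 0 < t -> (fun x => f (circle t x)) = fun y => h (ln t +i* y).
  by move=> t0; apply/funext => y; rewrite /h /= cexp_polar lnK.
by rewrite (Eh r r0) (Eh s s0) H.
Qed.

End CircleMean.

Arguments mean : simpl never.
Arguments circle : simpl never.

(** * Taylor coefficients and Cauchy estimates *)

Section Cauchy.
Context {R : realType}.
Local Notation C := (R[i]).
Implicit Types (f g : C -> C) (r s : R) (z w : C).

Definition entire g : Prop := forall z, derivable g z 1.

Lemma derivable_continuous g z : derivable g z 1 -> {for z, continuous g}.
Proof. by move/derivable1_diffP; exact: differentiable_continuous. Qed.

Lemma entire_continuous g : entire g -> continuous g.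
Proof. by move=> eg z; exact: derivable_continuous. Qed.

Lemma continuous_on_circle f r : 0 < r ->
  (forall z, z != 0 -> {for z, continuous f}) ->
  continuous (fun x : R => f (circle r x)).
Proof.
move=> r0 cf x; apply: (@continuous_comp _ _ _ (circle r)).
  exact: continuous_circle.
by apply: cf; exact: circle_neq0.
Qed.

Lemma derivable_divX g n z : z != 0 -> derivable g z 1 ->
  derivable (fun w => g w * (w ^+ n)^-1) z 1.
Proof.
move=> z0 dg.
have zn : z ^+ n != 0 by rewrite expf_neq0.
have dX : derivable (fun w : C => w ^+ n) z 1 by exact: exprn_derivable.
have dV := derivableV (f := fun w : C => w ^+ n) zn dX.
exact: (derivableM dg dV).
Qed.

(** The [n]-th Taylor coefficient at 0, as a mean over the unit circle; by
    [coef_radius] any other circle gives the same value. *)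
Definition coef g n : C := mean (fun x => g (circle 1 x) * (circle 1 x ^+ n)^-1).

Lemma coef_radius g n r : entire g -> 0 < r ->
  mean (fun x => g (circle r x) * (circle r x ^+ n)^-1) = coef g n.
Proof.
move=> eg r0; rewrite /coef.
pose f w := g w * (w ^+ n)^-1.
have df z : z != 0 -> derivable f z 1 by move=> z0; exact: derivable_divX.
have cf z : z != 0 -> {for z, continuous f}.
  by move=> z0; apply: derivable_continuous; exact: df.
have nz a b z : 0 < a -> a <= nrm z <= b -> z != 0.
  by move=> a0 /andP[az _]; rewrite -nrm_gt0 (lt_le_trans a0).
case: (leP r 1) => r1.
  apply: (mean_circle_const (f := f)) => // z /nz.
  by move=> /(_ r0); exact: df.
apply/esym/(mean_circle_const (f := f)) => //; first exact: ltW.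
by move=> z /nz; move=> /(_ ltr01); exact: df.
Qed.

Lemma continuous_divX g n r : entire g -> 0 < r ->
  continuous (fun x => g (circle r x) * (circle r x ^+ n)^-1).
Proof.
move=> eg r0; apply: (continuous_on_circle (f := fun w => g w * (w ^+ n)^-1)) => //.
move=> z z0; apply: derivable_continuous; exact: derivable_divX.
Qed.

Lemma coef_le g n r (M : R) : entire g -> 0 < r ->
  (forall w, nrm w = r -> nrm (g w) <= M) -> nrm (coef g n) * r ^+ n <= 2 * M.
Proof.
move=> eg r0 H; rewrite -(coef_radius n eg r0).
rewrite -ler_pdivlMr ?exprn_gt0// -mulrA.
apply: mean_le; first exact: continuous_divX.
move=> x; rewrite nrmM nrmV nrmX nrm_circle gtr0_norm// ler_wpM2r//.
  by rewrite invr_ge0 exprn_ge0// ltW.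
by apply: H; rewrite nrm_circle gtr0_norm.
Qed.

Lemma entire_cst (k : C) : entire (fun=> k).
Proof. by move=> z; exact: derivable_cst. Qed.

(** Both radii 1 and 2 compute this coefficient, but with values that differ by
    the factor [2 ^ n]. *)
Lemma coef_cst (k : C) n : (0 < n)%N -> coef (fun=> k) n = 0.
Proof.
move=> n0; have ek := @entire_cst k.
have E r : 0 < r -> coef (fun=> k) n = (r ^- n)%:C * coef (fun=> k) n.
  move=> r0; rewrite -[LHS](coef_radius n ek r0) /coef -meanZ; last first.
    by apply: (continuous_divX (g := fun=> k)).
  congr mean; apply/funext => x; rewrite mulrCA; congr (_ * _).
  rewrite /circle !mul1r exprMn invfM; congr (_ * _).
  by rewrite -rmorphXn -fmorphV.
have := E 2 (ltr0Sn _ 1) => /eqP; rewrite -subr_eq0 -{1}[coef _ n]mul1r -mulrBl mulf_eq0.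
case/orP => [|/eqP //]; rewrite subr_eq0 => /eqP /complexI /eqP.
by rewrite eq_sym invr_eq1 pexpr_eq1// (gt_eqF (ltr1n _ 2)).
Qed.

Lemma coef_cst0 (k : C) : coef (fun=> k) 0 = k.
Proof.
by rewrite /coef; under eq_fun do rewrite expr0 invr1 mulr1; exact: mean_cst.
Qed.

(* The value on the diagonal makes the quotient continuous. *)
Let quot g z w : C := if w == z then 'D_1 g z else (g w - g z) / (w - z).

Lemma quot_derivable g z w : entire g -> w != z -> derivable (quot g z) w 1.
Proof.
move=> eg wz.
have d1 : derivable (fun u => g u - g z) w 1.
  exact: (derivableB (f := g) (g := cst (g z)) (eg w) (derivable_cst _ _ _)).
have d2 : derivable (fun u : C => u - z) w 1.
  have di : derivable (@id C) w 1 by exact: derivable_id.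
  exact: (derivableB (f := @id C) (g := cst z) di (derivable_cst _ _ _)).
have wz0 : w - z != 0 by rewrite subr_eq0.
have d3 := derivableV (f := fun u : C => u - z) wz0 d2.
have d4 := derivableM d1 d3.
apply: near_eq_derivable d4.
apply/nbhs_nrmP; exists (nrm (w - z)); first by rewrite nrm_gt0.
move=> h hz; rewrite /quot; case: eqP => // wh; exfalso; move: hz.
have -> : h = - (w - z) by rewrite -wh; ring.
by rewrite nrmN ltxx.
Qed.

Lemma quot_continuous g z : entire g -> continuous (quot g z).
Proof.
move=> eg w; have [->{w}|wz] := eqVneq w z; last first.
  by apply: derivable_continuous; exact: quot_derivable.
apply/continuous_nrmP => e e0; have e20 : 0 < e / 2 by rewrite divr_gt0.
have /derivableP /derivable_nrmP /(_ _ e20) [d d0 H] := eg z.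
exists d => // h hd; rewrite /quot eqxx.
case: eqP => [_|/eqP hz]; first by rewrite subrr nrm0.
have h0 : h != 0 by apply: contra hz => /eqP ->; rewrite addr0.
have -> : (g (z + h) - g z) / (z + h - z) - 'D_1 g z =
    (g (z + h) - g z - 'D_1 g z * h) / h.
  by rewrite [z + h]addrC addrK; field.
rewrite nrmM nrmV ltr_pdivrMr ?nrm_gt0//.
rewrite (le_lt_trans (H _ hd))// ltr_pM2r ?nrm_gt0//.
by rewrite ltr_pdivrMr// ltr_pMr// ltr1n.
Qed.

(** As a function of the radius the mean is constant on either side of [nrm z],
    where [quot g z] is derivable, and continuous everywhere; at radius 0 it
    vanishes. *)
Lemma mean_quot0 g z r : entire g -> nrm z < r ->
  mean (fun x => quot g z (circle r x) * circle r x) = 0.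
Proof.
move=> eg zr; set r0 := nrm z in zr.
have r00 : 0 <= r0 by exact: nrm_ge0.
have rr0 : 0 < r by exact: le_lt_trans zr.
pose f w := quot g z w * w.
pose J s := mean (fun x => f (circle s x)).
have cf : continuous f.
  move=> w; apply: (continuousM (s := quot g z) (t := id)).
    exact: (@quot_continuous g z eg w).
  exact: cvg_id.
have df w : w != z -> derivable f w 1.
  move=> wz; apply: (derivableM (f := quot g z) (g := id)).
    exact: quot_derivable.
  exact: derivable_id.
have cJ s (e : R) : 0 < e -> exists2 d : R, 0 < d &
    forall t, `|t - s| < d -> nrm (J t - J s) <= e.
  apply: (mean_param_continuous (F := fun p => f (circle p.1 p.2))).
  move=> p; apply: (@continuous_comp _ _ _ (fun p => circle p.1 p.2)); last exact: cf.
  apply: cvgM.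
    apply: (@continuous_complex R _ fst (cst 0)) => q; last exact: cvg_cst.
    exact: cvg_fst.
  apply: (@continuous_comp _ _ _ snd); first exact: cvg_snd.
  exact: continuous_unit_circle.
have J0 : J 0 = 0.
  rewrite /J (_ : (fun x => f (circle 0 x)) = fun=> 0) ?mean_cst//.
  by apply/funext => x; rewrite /f /circle mul0r mulr0.
have Jin s t : 0 < s -> s <= t -> t < r0 -> J s = J t.
  move=> s0 st tr; apply: mean_circle_const => // [w _|w /andP[_ wt]].
    exact: cf.
  apply: df; apply/eqP => wz; move: wt; rewrite wz -/r0; lra.
have Jout s t : r0 < s -> s <= t -> J s = J t.
  move=> s0 st; apply: mean_circle_const => // [|w _|w /andP[sw _]].
  - by lra.
  - exact: cf.
  apply: df; apply/eqP => wz; move: sw; rewrite wz -/r0; lra.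
have Jr0 : J r0 = 0.
  have [r0e|r0n] := eqVneq r0 0; first by rewrite r0e.
  have r0p : 0 < r0 by rewrite lt0r r0n.
  apply/eqP; rewrite -nrm_eq0 eq_le nrm_ge0 andbT; apply/ler_addgt0Pr => e e0.
  rewrite add0r; have e2 : 0 < e / 2 by rewrite divr_gt0.
  have [d1 d10 H1] := cJ 0 _ e2; have [d2 d20 H2] := cJ r0 _ e2.
  pose m := Num.min (d2 / 2) (r0 / 2).
  have m0 : 0 < m by rewrite lt_min !divr_gt0.
  have md : m <= d2 / 2 by rewrite ge_min lexx.
  have mr : m <= r0 / 2 by rewrite ge_min lexx orbT.
  clearbody m; pose t := r0 - m.
  have t0 : 0 < t by rewrite /t; lra.
  have tr : t < r0 by rewrite /t; lra.
  have td : `|t - r0| < d2 by rewrite /t ltr_norml; apply/andP; split; lra.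
  clearbody t; pose s := Num.min t (d1 / 2).
  have s0 : 0 < s by rewrite lt_min t0 divr_gt0.
  have st : s <= t by rewrite ge_min lexx.
  have sd' : s <= d1 / 2 by rewrite ge_min lexx orbT.
  have sd : `|s - 0| < d1 by rewrite subr0 gtr0_norm//; lra.
  have := H1 _ sd; have := H2 _ td; rewrite (Jin s t)// J0 subr0 => K1 K2.
  have -> : J r0 = J t - (J t - J r0) by ring.
  by rewrite (le_trans (nrmB _ _))// [e in _ <= e]splitr lerD.
apply/eqP; rewrite -nrm_eq0 eq_le nrm_ge0 andbT; apply/ler_addgt0Pr => e e0.
rewrite add0r; have [d d0 H] := cJ r0 _ e0.
pose s := Num.min r (r0 + d / 2).
have s0 : r0 < s by rewrite lt_min zr ltrDl divr_gt0.
have st : s <= r by rewrite ge_min lexx.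
have sd' : s <= r0 + d / 2 by rewrite ge_min lexx orbT.
have sd : `|s - r0| < d by rewrite gtr0_norm ?subr_gt0//; lra.
by have := H _ sd; rewrite Jr0 subr0 (Jout s r).
Qed.

Lemma coef_sub f g n : entire f -> entire g ->
  coef (fun z => f z - g z) n = coef f n - coef g n.
Proof.
move=> ef eg; rewrite /coef -meanB; last 2 first.
- exact: continuous_divX.
- exact: continuous_divX.
by congr mean; apply/funext => x; rewrite mulrBl.
Qed.

Lemma geom_kernel z w n : w != 0 -> w != z ->
  w / (w - z) = \sum_(k < n) z ^+ k / w ^+ k + (z / w) ^+ n * (w / (w - z)).
Proof.
move=> w0 wz; have wz0 : w - z != 0 by rewrite subr_eq0.
elim: n => [|n IH]; first by rewrite big_ord0 add0r expr0 mul1r.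
rewrite {1}IH big_ord_recr /= -addrA; congr (_ + _).
rewrite exprS -expr_div_n; move: (_ ^+ n) => u; field.
by rewrite w0 wz0.
Qed.

(** Expand the Cauchy kernel in [mean_quot0] as a geometric series: the first terms
    produce the coefficients, and the last one the remainder. The factor 4 comes
    from bounding [g w - g z] and from the componentwise integral. *)
Theorem taylor_remainder g z r (M : R) n : entire g -> nrm z < r ->
  (forall w, nrm w <= r -> nrm (g w) <= M) ->
  nrm (g z - \sum_(k < n.+1) coef g k * z ^+ k) <=
  4 * M * (nrm z / r) ^+ n.+1 * (r / (r - nrm z)).
Proof.
move=> eg zr HM.
have r0 : 0 < r by apply: le_lt_trans zr; exact: nrm_ge0.
have rz : 0 < r - nrm z by rewrite subr_gt0.
pose h w := g w - g z.
have ek := @entire_cst (g z).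
have eh : entire h by move=> w; apply: derivableB; [exact: eg|exact: ek].
have cz x : circle r x != z.
  apply/eqP => cz; move: zr; rewrite -cz nrm_circle gtr0_norm// ltxx //.
pose rem (x : R) := h (circle r x) * ((z / circle r x) ^+ n.+1 *
   (circle r x / (circle r x - z))).
pose t k (x : R) := z ^+ k * (h (circle r x) * (circle r x ^+ k)^-1).
have ct k : continuous (t k).
  move=> x; apply: cvgM; first exact: cvg_cst.
  exact: continuous_divX.
have E x : quot g z (circle r x) * circle r x = \sum_(k < n.+1) t k x + rem x.
  rewrite /quot (negbTE (cz x)) mulrAC -mulrA.
  rewrite (geom_kernel n.+1 (circle_neq0 x r0) (cz x)) mulrDr mulr_sumr.
  congr (_ + _); by apply: eq_bigr => k _; rewrite /t mulrCA.
have cS : continuous (fun x => \sum_(k < n.+1) t k x) by exact: continuous_sum_fun.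
have crem : continuous rem.
  have -> : rem = fun x => quot g z (circle r x) * circle r x -
      \sum_(k < n.+1) t k x.
    by apply/funext => x; rewrite E addrC addKr.
  have cq : continuous (fun x => quot g z (circle r x) * circle r x).
    move=> x; apply: cvgM; last exact: continuous_circle.
    apply: (@continuous_comp _ _ _ (circle r)); first exact: continuous_circle.
    exact: quot_continuous.
  by move=> x; exact: (cvgB (cq x) (cS x)).
have := mean_quot0 eg zr; under eq_fun do rewrite E.
rewrite (meanD cS crem) (mean_sum n.+1 ct) => /eqP; rewrite addr_eq0 => /eqP Hs.
have -> : g z - \sum_(k < n.+1) coef g k * z ^+ k = mean rem.
  rewrite -[RHS]opprK -Hs -[LHS]opprK; congr (- _); rewrite opprB.
  rewrite big_ord_recl /= [RHS]big_ord_recl /= /t.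
  have Em k : mean (fun x => z ^+ k * (h (circle r x) * (circle r x ^+ k)^-1))
      = z ^+ k * (coef g k - coef (fun=> g z) k).
    rewrite (meanZ _ (continuous_divX (n := k) eh r0)) (coef_radius k eh r0).
    by rewrite (coef_sub _ eg ek).
  rewrite Em coef_cst0 expr0 mul1r mulr1 addrAC; congr (_ + _).
  apply: eq_bigr => k _; rewrite Em coef_cst ?subr0 ?lift0//.
  by rewrite mulrC.
have M0 : 0 <= M by apply: le_trans (HM 0 _); rewrite ?nrm_ge0// nrm0 ltW.
have -> : 4 * M * (nrm z / r) ^+ n.+1 * (r / (r - nrm z)) =
  2 * (2 * M * ((nrm z / r) ^+ n.+1 * (r / (r - nrm z)))) by ring.
apply: mean_le => // x; rewrite /rem.
have : nrm (circle r x) = r by rewrite nrm_circle gtr0_norm.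
move: (circle r x) (cz x) => c cz' nc.
rewrite !nrmM nrmX !nrmM !nrmV nc.
apply: ler_pM; rewrite ?nrm_ge0//.
- by rewrite !(mulr_ge0, exprn_ge0, invr_ge0, nrm_ge0, ltW r0).
- rewrite (le_trans (nrmB _ _))// mulrDl mul1r lerD//; apply: HM.
    by rewrite nc.
  exact: ltW.
- apply: ler_wpM2l; first by rewrite !(mulr_ge0, exprn_ge0, invr_ge0, nrm_ge0, ltW r0).
  apply: ler_wpM2l; first exact: ltW.
  rewrite lef_pV2 ?posrE//.
    by have := nrmD (c - z) z; rewrite subrK nc; lra.
  by rewrite nrm_gt0 subr_eq0.
Qed.

End Cauchy.

Arguments coef : simpl never.

(** * Entire functions depending on a parameter *)

Section ParametricDerivative.
Context {R : realType}.
Local Notation C := (R[i]).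
Implicit Types (f g : C -> C) (r s : R) (z w : C).

Lemma continuous_subf (p q : R -> C) : continuous p -> continuous q ->
  continuous (fun x => p x - q x).
Proof. by move=> cp cq x; apply: cvgB; [exact: cp|exact: cq]. Qed.

Lemma continuous_bounded_bidisc (F : C * C -> C) r : continuous F ->
  exists M : R, forall z w, nrm z <= r -> nrm w <= r -> nrm (F (z, w)) <= M.
Proof.
move=> cF; have [r0|r0] := ltP r 0.
  by exists 0 => z w zr; have := le_lt_trans zr r0; rewrite ltNge nrm_ge0.
pose A : set ((R * R) * (R * R)) :=
  (`[-r, r] `*` `[-r, r]) `*` (`[-r, r] `*` `[-r, r]).
have cA : compact A by do 2 ?apply: compact_setX; exact: segment_compact.
pose e (p : (R * R) * (R * R)) : C * C := (p.1.1 +i* p.1.2, p.2.1 +i* p.2.2).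
have ce : continuous e.
  move=> p; apply: (@cvg_pair _ _ _ (nbhs p) (nbhs (p.1.1 +i* p.1.2))
      (nbhs (p.2.1 +i* p.2.2))).
    apply: (@continuous_complex R _ (fun q : (R * R) * (R * R) => q.1.1)
      (fun q => q.1.2)) => q.
      by apply: (@continuous_comp _ _ _ fst fst); exact: cvg_fst.
    by apply: (@continuous_comp _ _ _ fst snd); [exact: cvg_fst|exact: cvg_snd].
  apply: (@continuous_complex R _ (fun q : (R * R) * (R * R) => q.2.1)
      (fun q => q.2.2)) => q.
    by apply: (@continuous_comp _ _ _ snd fst); [exact: cvg_snd|exact: cvg_fst].
  by apply: (@continuous_comp _ _ _ snd snd); exact: cvg_snd.
have cn : continuous (fun p => nrm (F (e p))).
  move=> p; apply: (@continuous_comp _ _ _ (F \o e)); last exact: continuous_nrm.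
  by apply: continuous_comp; [exact: ce|exact: cF].
have A0 : A !=set0.
  by exists ((0, 0), (0, 0)); rewrite /A /=; repeat split => //=;
     rewrite in_itv /= oppr_le0 r0.
have [c _ Hc] := compact_EVT_max A0 cA (continuous_subspaceT cn).
exists (nrm (F (e c))) => z w zr wr.
have H := Hc ((complex.Re z, complex.Im z), (complex.Re w, complex.Im w)).
rewrite [F (z, w)](_ : _ = F (e ((complex.Re z, complex.Im z), (complex.Re w, complex.Im w)))).
  apply: H; rewrite inE /A /=; repeat split => //=; rewrite in_itv /= -ler_norml.
  - exact: le_trans (ler_Re_nrm _) _.
  - exact: le_trans (ler_Im_nrm _) _.
  - exact: le_trans (ler_Re_nrm _) _.
  - exact: le_trans (ler_Im_nrm _) _.
by congr F; rewrite /e /=; case: z {zr H} => a b; case: w {wr} => c' d.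
Qed.

Lemma entire_bounded g r : entire g ->
  exists M : R, forall w, nrm w <= r -> nrm (g w) <= M.
Proof.
move=> eg; have cF : continuous (fun p : C * C => g p.1).
  move=> p; apply: (@continuous_comp _ _ _ fst); first exact: cvg_fst.
  exact: entire_continuous.
have [M HM] := continuous_bounded_bidisc r cF; exists M => w wr.
exact: (HM w w).
Qed.

Lemma entire_affine g z w : entire g -> entire (fun h => g (z + w * h)).
Proof.
move=> eg h; apply/derivable1_diffP.
apply: (@differentiable_comp _ _ _ _ (fun h => z + w * h) g).
  apply/derivable1_diffP.
  suff : is_derive h 1 (fun h => z + w * h) w by case.
  apply: (@is_derive_quadratic _ _ _ _ 0 1) => // k _.
  by rewrite mul0r (_ : _ - _ = 0) ?nrm0//; ring.
by apply/derivable1_diffP; exact: eg.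
Qed.

Lemma entire_shift g z : entire g -> entire (fun h => g (z + h)).
Proof.
move=> eg; have := @entire_affine g z 1 eg.
by congr entire; apply/funext => h; rewrite mul1r.
Qed.

Lemma coef_at0 g : entire g -> coef g 0 = g 0.
Proof.
move=> eg; have [M HM] := entire_bounded 1 eg.
have := @taylor_remainder R g 0 1 M 0 eg; rewrite nrm0 => /(_ ltr01 HM).
rewrite big_ord_recl big_ord0 mul0r !expr1 expr0 mulr1 addr0 mulr0 mul0r => H.
by apply/esym/eqP; rewrite -subr_eq0 -nrm_eq0 eq_le nrm_ge0 andbT.
Qed.

(** A second-order estimate with an explicit constant, hence uniform in any
    parameter in which [g] is bounded. *)
Lemma taylor_order2 g z (M : R) h : entire g ->
  (forall w, nrm w <= 2 -> nrm (g (z + w)) <= M) -> nrm h <= 1 ->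
  nrm (g (z + h) - g z - coef (fun w => g (z + w)) 1 * h) <= 2 * M * nrm h ^+ 2.
Proof.
move=> eg HM h1; have es := @entire_shift g z eg.
have h2 : nrm h < 2 by lra.
have := @taylor_remainder R _ h 2 M 1 es h2 HM.
rewrite !big_ord_recl big_ord0 /= coef_at0// addr0 !expr0 expr1 mulr1 addr0 opprD addrA.
move=> /le_trans; apply.
have M0 : 0 <= M by apply: le_trans (HM 0 _); rewrite ?nrm_ge0// nrm0.
have -> : 4 * M * (nrm h / 2) ^+ 2 * (2 / (2 - nrm h)) =
  2 * M * nrm h ^+ 2 * (2 - nrm h)^-1 by field; lra.
rewrite ler_piMr//.
  by rewrite !mulr_ge0// ?exprn_ge0 ?nrm_ge0.
by rewrite invf_le1; lra.
Qed.

Lemma derive_coef g z : entire g -> 'D_1 g z = coef (fun w => g (z + w)) 1.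
Proof.
move=> eg; have [M HM] := entire_bounded 2 (@entire_shift g z eg).
apply: derive_val; apply: (@is_derive_quadratic _ _ _ _ (2 * M) 1) => // h h1.
by apply: taylor_order2 => //; exact: ltW.
Qed.

(** [G u w] with [u] the parameter: these hypotheses make
    [w |-> coef (G ^~ w) k] entire, and they pass to the derivative in [w]. *)
Definition entire_param (G : C -> C -> C) : Prop :=
  [/\ forall u, entire (G u), forall w, continuous (G ^~ w) &
    forall r, exists M : R, forall u w, nrm u <= r -> nrm w <= r ->
      nrm (G u w) <= M].

Lemma entire_param_taylor (G : C -> C -> C) r : entire_param G ->
  exists2 M : R, 0 <= M & forall u w h, nrm u <= r -> nrm w <= r -> nrm h <= 1 ->
    nrm (G u (w + h) - G u w - 'D_1 (G u) w * h) <= M * nrm h ^+ 2.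
Proof.
move=> [eG _ bG]; have [M HM] := bG (`|r| + 2).
exists (2 * `|M|); first by rewrite mulr_ge0.
move=> u w h ur wr h1; rewrite (derive_coef _ (eG u)).
apply: taylor_order2 => // v v2; apply: le_trans (ler_norm M); apply: HM.
  by rewrite (le_trans ur)// (le_trans (ler_norm _))// lerDl.
rewrite (le_trans (nrmD _ _))// lerD// (le_trans wr)// ler_norm//.
Qed.

(** The derivative is a limit of difference quotients, uniformly in the parameter
    by [entire_param_taylor]. *)
Lemma derive_param_continuous (G : C -> C -> C) w : entire_param G ->
  continuous (fun u => 'D_1 (G u) w).
Proof.
have aux (m x y : R) : 0 < x * y -> m <= x / 4 * y ->
    (x * y / 8 + x * y / 8) + (m + m) <= x * y.
  have -> : x / 4 * y = x * y / 4 by field.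
  by lra.
move=> pG u; have [_ cG _] := pG.
have [M M0 HM] := entire_param_taylor (nrm u + 1 + nrm w) pG.
apply/continuous_nrmP => e e0.
pose h : R := Num.min 1 (e / (4 * (M + 1))).
have M1 : 0 < M + 1 by rewrite ltr_wpDl.
have h0 : 0 < h by rewrite lt_min ltr01 divr_gt0// mulr_gt0.
have h1 : h <= 1 by rewrite ge_min lexx.
have hM : M * h <= e / 4.
  have : h <= e / (4 * (M + 1)) by rewrite ge_min lexx orbT.
  rewrite ler_pdivlMr ?mulr_gt0// => H.
  have -> : M * h = h * (4 * (M + 1)) / 4 - h by field.
  by move: H h0; lra.
clearbody h.
have eh : 0 < e * h / 8 by rewrite divr_gt0// mulr_gt0.
have /continuous_nrmP/(_ _ eh) [d1 d10 H1] := cG (w + h%:C) u.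
have /continuous_nrmP/(_ _ eh) [d2 d20 H2] := cG w u.
exists (Num.min 1 (Num.min d1 d2)); first by rewrite !lt_min ltr01 d10.
move=> v; rewrite !lt_min => /and3P[v1 vd1 vd2].
have nh : nrm (h%:C : C) = h by rewrite nrm_real gtr0_norm.
have K1 : nrm (u + v) <= nrm u + 1 + nrm w.
  by have := nrmD u v; have := nrm_ge0 w; lra.
have K2 : nrm u <= nrm u + 1 + nrm w by have := nrm_ge0 w; lra.
have K3 : nrm w <= nrm u + 1 + nrm w by have := nrm_ge0 u; lra.
have A := HM (u + v) w h%:C K1 K3; have B := HM u w h%:C K2 K3.
rewrite nh in A B; have {}A := A h1; have {}B := B h1.
have C1 := H1 _ vd1; have C2 := H2 _ vd2.
set Dv := 'D_1 (G (u + v)) w in A *; set Du := 'D_1 (G u) w in B *.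
rewrite -(ltr_pM2r h0) -{1}nh -nrmM.
have -> : (Dv - Du) * h%:C =
  ((G (u + v) (w + h%:C) - G u (w + h%:C)) - (G (u + v) w - G u w)) -
  ((G (u + v) (w + h%:C) - G (u + v) w - Dv * h%:C) -
   (G u (w + h%:C) - G u w - Du * h%:C)) by ring.
apply: (le_lt_trans (nrmB _ _)).
apply: (le_lt_trans (lerD (nrmB _ _) (nrmB _ _))).
apply: lt_le_trans (aux (M * h ^+ 2) e h (mulr_gt0 e0 h0) _); last first.
  by rewrite expr2 mulrA ler_pM2r.
exact: (ltr_leD (ltrD C1 C2) (lerD A B)).
Qed.

(** Differentiation under the integral sign; the second-order Taylor estimate is
    uniform on the circle. *)
Theorem coef_param_derive (G : C -> C -> C) k w : entire_param G ->
  is_derive w 1 (fun w => coef (G ^~ w) k) (coef (fun u => 'D_1 (G u) w) k).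
Proof.
move=> pG; have [_ cG _] := pG.
have [M M0 HM] := entire_param_taylor (1 + nrm w) pG.
apply: (@is_derive_quadratic _ _ _ _ (2 * M) 1) => // h /ltW h1.
have cV : continuous (fun x => (circle (1 : R) x ^+ k)^-1).
  have := continuous_divX (g := fun=> 1) (n := k) (@entire_cst R 1) ltr01.
  have -> // : (fun x : R => 1 * (circle 1 x ^+ k)^-1) =
    (fun x => (circle (1 : R) x ^+ k)^-1).
  by apply/funext => x; rewrite mul1r.
have cc (f : C -> C) : continuous f ->
    continuous (fun x => f (circle (1 : R) x) * (circle (1 : R) x ^+ k)^-1).
  move=> cf x; apply: cvgM; last exact: cV.
  by apply: (@continuous_comp _ _ _ (circle 1)); [exact: continuous_circle|exact: cf].
have cD := derive_param_continuous (w := w) pG.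
have c1 := cc _ (cG (w + h)); have c2 := cc _ (cG w); have c3 := cc _ cD.
have c12 := continuous_subf c1 c2.
have c4 : continuous (fun x => h *
    ('D_1 (G (circle (1 : R) x)) w * (circle (1 : R) x ^+ k)^-1)).
  by move=> x; apply: cvgM; [exact: cvg_cst|exact: c3].
have c124 := continuous_subf c12 c4.
rewrite /coef [_ * h]mulrC -(meanZ h c3) -(meanB c1 c2) -(meanB c12 c4).
rewrite -mulrA; apply: (mean_le c124).
move=> x; rewrite mulrA -mulrBl -mulrBl nrmM nrmV nrmX nrm_circle.
rewrite normr1 expr1n invr1 mulr1 [h * _]mulrC; apply: HM => //.
  by rewrite nrm_circle normr1 lerDl nrm_ge0.
by rewrite lerDr.
Qed.

Lemma entire_param_shift g : entire g -> entire_param (fun u w => g (w + u)).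
Proof.
move=> eg; split.
- move=> u; under eq_fun do rewrite addrC; exact: entire_shift.
- by move=> w; apply: entire_continuous; exact: entire_shift.
- move=> r; have [M HM] := entire_bounded (r + r) eg; exists M => u w ur wr.
  by apply: HM; rewrite (le_trans (nrmD _ _))// lerD.
Qed.

(** The derivative is itself a coefficient, of the translates of [g]. *)
Lemma entire_derive g : entire g -> entire ('D_1 g).
Proof.
move=> eg z; have := @coef_param_derive _ 1 z (entire_param_shift eg).
have -> : (fun w => coef (fun u => g (w + u)) 1) = 'D_1 g.
  by apply/funext => w; rewrite derive_coef.
by case.
Qed.

Lemma entire_param_derive (G : C -> C -> C) : entire_param G ->
  entire_param (fun u w => 'D_1 (G u) w).
Proof.
move=> pG; have [eG cG bG] := pG; split.
- by move=> u; exact: entire_derive.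
- by move=> w; exact: derive_param_continuous.
- move=> r; have [M HM] := bG (`|r| + 1); exists (2 * M) => u w ur wr.
  rewrite (derive_coef _ (eG u)).
  have := @coef_le R (fun h => G u (w + h)) 1 1 M (@entire_shift (G u) w (eG u)) ltr01.
  rewrite expr1 mulr1; apply => h h1; apply: HM.
    by rewrite (le_trans ur)// (le_trans (ler_norm _))// lerDl.
  by rewrite (le_trans (nrmD _ _))// lerD ?h1// (le_trans wr) ?ler_norm.
Qed.

(** A complex derivative can be computed along the reals. *)
Lemma derive_real_zero f z l : is_derive z 1 f l ->
  (forall h : R, 0 < h -> h < 1 -> f (z + h%:C) = f z) -> l = 0.
Proof.
move=> /derivable_nrmP H Hf; apply/eqP; rewrite -nrm_eq0 eq_le nrm_ge0 andbT.
apply/ler_addgt0Pr => e e0; rewrite add0r.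
have [d d0 Hd] := H _ e0.
pose h := Num.min (d / 2) (1 / 2).
have h0 : 0 < h by rewrite lt_min !divr_gt0.
have hd : h <= d / 2 by rewrite ge_min lexx.
have h1 : h <= 1 / 2 by rewrite ge_min lexx orbT.
clearbody h; have nh : nrm (h%:C : C) = h by rewrite nrm_real gtr0_norm.
have := Hd h%:C; rewrite nh Hf//; last by lra.
rewrite subrr sub0r nrmN nrmM nh ler_pM2r//; apply; lra.
Qed.

(** Differentiate at [w = 0] the coefficient of order [k + 1] of
    [u |-> g ((1 + w) u)]: under the integral sign this gives a coefficient of the
    derivative, while for real [w] that coefficient is [(1 + w) ^ (k + 1)] times
    the one of [g], by invariance under change of radius. *)
Lemma coef_derive g k : entire g -> coef ('D_1 g) k = k.+1%:R * coef g k.+1.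
Proof.
move=> eg; pose G u w := g (u + u * w).
have pG : entire_param G.
  split.
  - by move=> u; exact: entire_affine.
  - move=> w; have := entire_continuous (@entire_affine g 0 (1 + w) eg).
    have -> // : (fun u => g (0 + (1 + w) * u)) = G ^~ w.
    by apply/funext => u; rewrite /G add0r mulrDl mul1r [w * u]mulrC.
  - move=> r; have [M HM] := entire_bounded (`|r| + `|r| * `|r|) eg; exists M => u w ur wr.
    have u1 : nrm u <= `|r| by rewrite (le_trans ur) ?ler_norm.
    have w1 : nrm w <= `|r| by rewrite (le_trans wr) ?ler_norm.
    by apply: HM; rewrite (le_trans (nrmD _ _))// nrmM lerD// ler_pM ?nrm_ge0.
have HB := @coef_param_derive G k.+1 0 pG.
have -> : coef ('D_1 g) k = coef (fun u => 'D_1 (G u) 0) k.+1.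
  rewrite /coef; congr mean; apply/funext => x.
  have cx : circle (1 : R) x != 0 by exact: circle_neq0.
  have dg : is_derive (0 : C) 1 (fun w => circle 1 x + circle 1 x * w) (circle 1 x).
    apply: (@is_derive_quadratic _ _ _ _ 0 1) => // h _.
    by rewrite mul0r (_ : _ - _ = 0) ?nrm0//; ring.
  have dG : is_derive (0 : C) 1 (G (circle 1 x)) (circle 1 x * 'D_1 g (circle 1 x)).
    have /derivable_nrmP := derivableP (eg (circle 1 x)).
    move=> H; apply/derivable_nrmP => e e0; have [d d0 Hd] := H _ e0.
    exists d => // h hd; rewrite /G mulr0 addr0 add0r.
    have nx : nrm (circle 1 x * h) = nrm h.
      by rewrite nrmM nrm_circle normr1 mul1r.
    have := Hd (circle 1 x * h); rewrite nx => /(_ hd).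
    by rewrite mulrCA mulrA.
  rewrite (derive_val (is_derive := dG)) exprS.
  by field; rewrite expf_neq0.
pose P w := (1 + w) ^+ k.+1 * coef g k.+1.
have HP : is_derive (0 : C) 1 P (k.+1%:R * coef g k.+1).
  have H1 : is_derive (0 : C) 1 (fun w : C => 1 + w) 1.
    apply: (@is_derive_quadratic _ _ _ _ 0 1) => // h _.
    by rewrite mul0r (_ : _ - _ = 0) ?nrm0//; ring.
  have [d1 e1] := is_deriveX k.+1 H1.
  have PE : P = coef g k.+1 *: ((fun w : C => 1 + w) ^+ k.+1).
    by apply/funext => w; rewrite /P !fctE mulrC.
  rewrite PE; split; first exact: derivableZ.
  rewrite deriveZ// e1 addr0 expr1n /GRing.scale /= !mulr1.
  by rewrite mulrC.
apply/eqP; rewrite -subr_eq0; apply/eqP.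
apply: (derive_real_zero (z := 0) (is_deriveB HB HP)) => h h0 h1 /=.
have h1' : 0 < 1 + h by rewrite addr_gt0.
have E : coef (G ^~ h%:C) k.+1 = (1 + h%:C) ^+ k.+1 * coef g k.+1.
  rewrite -(coef_radius k.+1 eg h1') /coef -meanZ; last exact: continuous_divX.
  congr mean; apply/funext => x.
  have -> : circle (1 + h) x = (1 + h%:C) * circle 1 x :> C.
    by rewrite /circle mul1r rmorphD.
  have nz : 1 + h%:C != 0 :> C.
    by rewrite -(rmorph1 (real_complex R)) -rmorphD fmorph_eq0 gt_eqF.
  have cx : circle (1 : R) x != 0 by exact: circle_neq0.
  rewrite /G; move: (circle 1 x) cx => c c0.
  have e2 : (1 + h%:C) * c = c + c * h%:C :> C by ring.
  rewrite exprMn e2; move: (g _) => y.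
  have := expf_neq0 k.+1 nz; have := expf_neq0 k.+1 c0.
  by move: (_ ^+ _) (_ ^+ _) => a b a0 b0; field; rewrite a0 b0.
change (coef (G^~ (0 + h%:C)) k.+1 - P (0 + h%:C) = coef (G^~ 0) k.+1 - P 0).
have -> : G^~ 0 = g by apply/funext => u; rewrite /G mulr0 addr0.
by rewrite /P !add0r E subrr addr0 expr1n mul1r subrr.
Qed.

Lemma coef_shift_derive g n z : entire g ->
  is_derive z 1 (fun w => coef (fun u => g (w + u)) n)
    (n.+1%:R * coef (fun u => g (z + u)) n.+1).
Proof.
move=> eg; have := @coef_param_derive _ n z (entire_param_shift eg).
have -> : (fun u => 'D_1 (fun w => g (w + u)) z) = 'D_1 (fun u => g (z + u)).
  apply/funext => u.
  rewrite (derive_coef u (@entire_shift g z eg)).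
  have e2 : entire (fun w => g (w + u)).
    by under eq_fun do rewrite addrC; exact: entire_shift.
  rewrite (derive_coef z e2).
  have -> // : (fun w => g (z + w + u)) = (fun w => g (z + (u + w))).
  by apply/funext => w; rewrite addrAC -addrA.
by have -> := coef_derive n (@entire_shift g z eg).
Qed.

End ParametricDerivative.

#[global] Opaque nrm coef mean circle.

(** * Coefficients of caloric functions *)

Section HeatCoefficients.
Context {R : realType}.
Local Notation C := (R[i]).
Variable F : C * C -> C.
Hypotheses (eF : entire2 F) (hF : heat_equation F).
Implicit Types (t z w : C).

Lemma entire2_continuous : continuous F.
Proof. by move=> p; apply: differentiable_continuous; exact: eF. Qed.

Lemma entire_slice_t z : entire (slice_t F z).
Proof.
move=> t; apply/derivable1_diffP.
apply: (@differentiable_comp _ _ _ _ (fun t : C => (t, z)) F); last exact: eF.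
apply: (@differentiable_pair _ _ _ _ id (cst z)).
  by apply/derivable1_diffP; exact: derivable_id.
exact: differentiable_cst.
Qed.

Lemma entire_slice_z t : entire (slice_z F t).
Proof.
move=> z; apply/derivable1_diffP.
apply: (@differentiable_comp _ _ _ _ (fun z : C => (t, z)) F); last exact: eF.
apply: (@differentiable_pair _ _ _ _ (cst t) id).
  exact: differentiable_cst.
by apply/derivable1_diffP; exact: derivable_id.
Qed.

Lemma dzE t z : dz F t z = 'D_1 (slice_z F t) z.
Proof. by rewrite /dz derive1E. Qed.

Lemma heat_derive t z :
  'D_1 (slice_t F z) t = 'D_1 ('D_1 (slice_z F t)) z.
Proof.
have := hF t z; rewrite derive1E derive1nS derive1n1 derive1E => ->.
have -> // : (slice_z F t)^`() = 'D_1 (slice_z F t).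
by apply/funext => w; rewrite derive1E.
Qed.

Lemma entire_param_z : entire_param (slice_z F).
Proof.
split; first exact: entire_slice_z.
  by move=> z; exact: (entire_continuous (entire_slice_t (z := z))).
move=> r; have [M HM] := continuous_bounded_bidisc r entire2_continuous.
by exists M => u w ur wr; exact: HM.
Qed.

Lemma entire_param_t z : entire_param (fun u t => F (t, z + u)).
Proof.
split.
- by move=> u; exact: (entire_slice_t (z := z + u)).
- move=> t; apply: entire_continuous.
  exact: (@entire_shift R (slice_z F t) z (entire_slice_z (t := t))).
- move=> r; have [M HM] := continuous_bounded_bidisc (nrm z + r) entire2_continuous.
  exists M => u w ur wr; apply: HM.
    by rewrite (le_trans wr)// lerDr nrm_ge0.
  by rewrite (le_trans (nrmD _ _))// lerD.
Qed.

Lemma entire_dz z : entire (fun t => dz F t z).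
Proof.
move=> t; have := @coef_param_derive R _ 1 t (entire_param_t z).
have -> : (fun w => coef (fun u => F (w, z + u)) 1) = (fun t => dz F t z).
  apply/funext => w; rewrite dzE.
  by rewrite (derive_coef z (entire_slice_z (t := w))).
by case.
Qed.

(** Taylor coefficients at [t = 0] of [F] and of its [z]-derivative, and Taylor
    coefficients at [z] of the initial value [F (0, _)]. *)
Definition tcoef k z : C := coef (slice_t F z) k.
Definition tcoef1 k z : C := coef (fun t => dz F t z) k.
Definition zcoef n z : C := coef (fun w => F (0, z + w)) n.

Lemma tcoef_derive k z : is_derive z 1 (tcoef k) (tcoef1 k z).
Proof.
have := @coef_param_derive R _ k z entire_param_z.
by have -> : (fun t => 'D_1 (slice_z F t) z) = (fun t => dz F t z)
  by apply/funext => t; rewrite dzE.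
Qed.

Lemma tcoef1_derive k z : is_derive z 1 (tcoef1 k) (k.+1%:R * tcoef k.+1 z).
Proof.
have E1 : tcoef1 k = (fun w => coef (fun t => 'D_1 (slice_z F t) w) k).
  apply/funext => w.
  exact: (congr1 (fun p => coef p k) (funext (fun t => dzE t w))).
have E2 : (fun t => 'D_1 ('D_1 (slice_z F t)) z) = 'D_1 (slice_t F z).
  by apply/funext => t; rewrite heat_derive.
have E3 := coef_derive k (entire_slice_t (z := z)).
have E4 : k.+1%:R * tcoef k.+1 z = coef (fun t => 'D_1 ('D_1 (slice_z F t)) z) k.
  exact: (etrans (esym E3) (congr1 (fun p => coef p k) (esym E2))).
rewrite E1 E4.
exact: (@coef_param_derive R (fun t w => 'D_1 (slice_z F t) w) k z
  (entire_param_derive entire_param_z)).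
Qed.

Lemma entire_tcoef k : entire (tcoef k).
Proof. by move=> z; have [] := tcoef_derive k z. Qed.

Lemma entire_tcoef1 k : entire (tcoef1 k).
Proof. by move=> z; have [] := tcoef1_derive k z. Qed.

Lemma zcoef_derive n z : is_derive z 1 (zcoef n) (n.+1%:R * zcoef n.+1 z).
Proof. exact: (coef_shift_derive n z (entire_slice_z (t := 0))). Qed.

Lemma scaled_derive_eq (f g : C -> C) (a b : C) z l m :
  is_derive z 1 f l -> is_derive z 1 g m ->
  (forall w, a * f w = b * g w) -> a * l = b * m.
Proof.
move=> [df <-] [dg <-] E.
have E' : a *: f = b *: g by apply/funext => w; exact: E.
have := congr1 (fun p => 'D_1 p z) E'.
by rewrite (deriveZ _ df) (deriveZ _ dg).
Qed.

(** The heat equation turns two [z]-derivatives of a coefficient into the next one,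
    so that [k! * tcoef k] and [k! * tcoef1 k] are the derivatives of orders [2 k]
    and [2 k + 1] of the initial value. *)
Lemma tcoef_zcoef k :
  (forall z, k`!%:R * tcoef k z = (k.*2)`!%:R * zcoef k.*2 z) /\
  (forall z, k`!%:R * tcoef1 k z = (k.*2.+1)`!%:R * zcoef k.*2.+1 z).
Proof.
have step n : (forall z, n`!%:R * tcoef n z = (n.*2)`!%:R * zcoef n.*2 z) ->
    forall z, n`!%:R * tcoef1 n z = (n.*2.+1)`!%:R * zcoef n.*2.+1 z.
  move=> H z.
  rewrite (scaled_derive_eq (tcoef_derive n z) (zcoef_derive n.*2 z) H).
  by rewrite mulrA -natrM mulnC -factS.
elim: k => [|k [IH0 IH1]].
  have H0 z : 0`!%:R * tcoef 0 z = (0.*2)`!%:R * zcoef 0 z.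
    rewrite /tcoef /zcoef coef_at0; last exact: entire_slice_t.
    rewrite coef_at0 /slice_t ?addr0//.
    exact: (@entire_shift R (slice_z F 0) z (entire_slice_z (t := 0))).
  by split=> //; exact: step.
have H z : k.+1`!%:R * tcoef k.+1 z = (k.+1.*2)`!%:R * zcoef k.+1.*2 z.
  have := scaled_derive_eq (tcoef1_derive k z) (zcoef_derive k.*2.+1 z) IH1.
  by rewrite !mulrA -!natrM mulnC -factS [(_ * k.*2.+2)%N]mulnC -factS.
by split=> //; exact: step.
Qed.

End HeatCoefficients.

(** * Real inequalities *)

Section RealInequalities.
Context {R : realType}.
Implicit Types (x y r s e l T : R).

Lemma exists_ln x : 0 < x -> exists y, x = expR y.
Proof. by move=> x0; exists (ln x); rewrite lnK. Qed.

Lemma exists_dilation s T T' : 0 < s -> 0 < T -> T < T' ->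
  exists2 l, 1 < l & T * l `^ s = T'.
Proof.
move=> s0 T0 TT'; have T'0 : 0 < T' by exact: lt_trans TT'.
exists ((T' / T) `^ s^-1); last first.
  rewrite -powRrM mulVf ?gt_eqF// powRr1 ?divr_ge0 ?ltW//.
  by rewrite mulrC divfK ?gt_eqF.
have -> : 1 = (1 : R) `^ s^-1 by rewrite powR1.
rewrite gt0_ltr_powR ?invr_gt0 ?nnegrE ?divr_ge0 ?ltW//.
by rewrite ltr_pdivlMr ?mul1r.
Qed.

Lemma powR_mono s x y : 0 <= s -> 0 <= x -> x <= y -> x `^ s <= y `^ s.
Proof.
by move=> s0 x0 xy; rewrite ge0_ler_powR ?nnegrE// (le_trans x0).
Qed.

(** A translation of the variable costs an arbitrarily small increase of the
    type. *)
Lemma exp_shift s T T' (d : R) : 0 < s -> 0 < T -> T < T' -> 0 <= d ->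
  exists2 A, 0 < A & forall r, 0 <= r ->
    expR (T * (r + d) `^ s) <= A * expR (T' * r `^ s).
Proof.
move=> s0 T0 TT' d0; have [l l1 lT] := exists_dilation s0 T0 TT'.
have l10 : 0 < l - 1 by rewrite subr_gt0.
exists (expR (T * (d / (l - 1) + d) `^ s)); first exact: expR_gt0.
move=> r r0; rewrite -expRD ler_expR.
have T'0 : 0 <= T' by apply: ltW; exact: lt_trans TT'.
have [h|h] := leP (d / (l - 1)) r.
  apply: (@le_trans _ _ (T' * r `^ s)); last first.
    by rewrite lerDr mulr_ge0 ?powR_ge0// ltW.
  rewrite -lT -mulrA -powRM//; last by lra.
  rewrite ler_wpM2l ?(ltW T0)// powR_mono ?(ltW s0)//; first by lra.
  by move: h; rewrite ler_pdivrMr//; lra.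
apply: (@le_trans _ _ (T * (d / (l - 1) + d) `^ s)); last first.
  by rewrite lerDl mulr_ge0 ?powR_ge0.
by rewrite ler_wpM2l ?(ltW T0)// powR_mono ?(ltW s0)//; lra.
Qed.

Lemma exp_dilation s T T' l r : 0 <= r -> 0 <= l -> T * l `^ s = T' ->
  expR (T * (l * r) `^ s) = expR (T' * r `^ s).
Proof. by move=> r0 l0 <-; rewrite powRM// mulrA. Qed.

(** Bernoulli: a linear factor is absorbed by any geometric one. *)
Lemma linear_le_geometric (l : R) : 1 < l ->
  exists2 A, 0 < A & forall k : nat, k.+1%:R <= A * l ^+ k.
Proof.
move=> l1; pose m := Num.min 1 (l - 1).
have m0 : 0 < m by rewrite lt_min ltr01 subr_gt0.
have m1 : m <= 1 by rewrite ge_min lexx.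
have ml : m <= l - 1 by rewrite ge_min lexx orbT.
exists m^-1; first by rewrite invr_gt0.
move=> k; rewrite ler_pdivlMl//; clearbody m.
elim: k => [|k IH]; first by rewrite expr0 mulr1.
apply: (@le_trans _ _ (l ^+ k + (l - 1))); last first.
  have lk : 1 <= l ^+ k by rewrite exprn_ege1// ltW.
  rewrite exprS -subr_ge0.
  have -> : l * l ^+ k - (l ^+ k + (l - 1)) = (l - 1) * (l ^+ k - 1) by ring.
  by rewrite mulr_ge0// subr_ge0// ltW.
by rewrite -[k.+2]addn1 natrD mulrDr mulr1 lerD.
Qed.

Lemma exp_ge_powfact x n : 0 <= x -> x ^+ n / n`!%:R <= expR x.
Proof.
move=> x0; case: n => [|n].
  by rewrite expr0 divr1 -expR0 ler_expR.
by apply: le_trans (expR_ge1Dxn n x0); rewrite lerDr.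
Qed.

Lemma linear_le_exp s e : 0 < s -> 0 < e ->
  exists2 A, 0 < A & forall r, 0 <= r -> r <= A * expR (e * r `^ s).
Proof.
move=> s0 e0; pose n := Num.bound (s^-1).
have n1 : 1 <= s * n%:R.
  have si : 0 <= s^-1 by rewrite invr_ge0 ltW.
  by rewrite -ler_pdivrMl// mulr1 ltW// archi_boundP.
exists (1 + n`!%:R / e ^+ n); first by rewrite ltr_pwDl// divr_ge0// exprn_ge0// ltW.
move=> r r0; have E1 : 1 <= expR (e * r `^ s).
  by rewrite -expR0 ler_expR mulr_ge0 ?powR_ge0 ?ltW.
rewrite mulrDl mul1r; have [r1|r1] := leP r 1.
  apply: (le_trans r1); apply: (le_trans E1).
  by rewrite lerDl !mulr_ge0 ?expR_ge0 ?invr_ge0 ?exprn_ge0 ?ltW.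
apply: (@le_trans _ _ (n`!%:R / e ^+ n * expR (e * r `^ s))); last first.
  by rewrite lerDr expR_ge0.
have en : 0 < e ^+ n by rewrite exprn_gt0.
apply: (@le_trans _ _ (r `^ s ^+ n)).
  rewrite -powR_mulrn ?powR_ge0// -powRrM.
  by rewrite -{1}(powRr1 r0) ler_powR// ltW.
have := @exp_ge_powfact (e * r `^ s) n (mulr_ge0 (ltW e0) (powR_ge0 _ _)).
rewrite exprMn ler_pdivrMr ?ltr0n ?fact_gt0// => H.
by rewrite mulrAC ler_pdivlMr// mulrC (le_trans H)// mulrC.
Qed.

(** The upper half of Stirling's formula, up to a linear factor; the induction step
    is [1 - 1 / (n + 1) <= exp (- 1 / (n + 1))]. *)
Lemma fact_upper k : (0 < k)%N ->
  k`!%:R <= expR 1 * k%:R * (k%:R * expR (-1)) ^+ k :> R.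
Proof.
case: k => // k _; elim: k => [|k IH].
  by rewrite expr1 mul1r mulr1 -expRD subrr expR0.
rewrite factS natrM mulrC; set n := k.+1%:R in IH *.
have n0 : 0 < n by rewrite ltr0n.
have nS : k.+2%:R = n + 1 by rewrite /n -natr1.
rewrite nS; clearbody n; have n10 : 0 < n + 1 by rewrite addr_gt0.
apply: (@le_trans _ _ (expR 1 * n * (n * expR (-1)) ^+ k.+1 * (n + 1))).
  by rewrite ler_pM2r.
suff H : n * (n * expR (-1)) ^+ k.+1 <= ((n + 1) * expR (-1)) ^+ k.+2.
  have -> : expR 1 * n * (n * expR (-1)) ^+ k.+1 * (n + 1) =
    expR 1 * (n + 1) * (n * (n * expR (-1)) ^+ k.+1) by ring.
  by rewrite ler_wpM2l// mulr_ge0 ?expR_ge0// ltW.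
rewrite [leRHS]exprSr !exprMn -!mulrA (mulrCA n) [leRHS]mulrCA.
have -> : n ^+ k.+1 * (n * expR (-1) ^+ k.+1) =
   expR (-1) ^+ k.+1 * n ^+ k.+2 by rewrite [n ^+ k.+2]exprS; ring.
have -> : expR (-1) ^+ k.+1 * ((n + 1) ^+ k.+1 * ((n + 1) * expR (-1))) =
   expR (-1) ^+ k.+1 * ((n + 1) ^+ k.+2 * expR (-1)) by rewrite [(n + 1) ^+ k.+2]exprS; ring.
rewrite ler_wpM2l ?exprn_ge0 ?expR_ge0//.
rewrite expRN -ler_pdivrMl ?exprn_gt0//.
have -> : ((n + 1) ^+ k.+2)^-1 * n ^+ k.+2 = (1 + - (n + 1)^-1) ^+ k.+2.
  rewrite -exprVn -exprMn; congr (_ ^+ _); field; exact: lt0r_neq0.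
have h1 : 0 <= 1 - (n + 1)^-1 by rewrite subr_ge0 invf_le1// lerDr ltW.
have h2 := expR_ge1Dx (- (n + 1)^-1).
have -> : (expR 1)^-1 = expR (- (n + 1)^-1) ^+ k.+2.
  rewrite -expRN -expRM_natl nS; congr expR; field; exact: lt0r_neq0.
by rewrite ler_pXn2r ?nnegrE// expR_ge0.
Qed.

(** Up to a linear factor, (2k)! / k! is 4 ^ k * k!. *)
Lemma central_factorial k :
  ((k.*2)`! <= 4 ^ k * (k`! * k`!))%N /\
  (4 ^ k * (k`! * k`!) <= k.*2.+1 * (k.*2)`!)%N.
Proof.
elim: k => // k [IH1 IH2].
have E : (k.+1.*2)`! = (k.*2.+2 * k.*2.+1 * (k.*2)`!)%N.
  by rewrite doubleS !factS mulnA.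
have E' : (4 ^ k.+1 * (k.+1`! * k.+1`!) =
   4 * (k.+1 * k.+1) * (4 ^ k * (k`! * k`!)))%N.
  by rewrite expnS factS; ring.
rewrite E E'; split.
  apply: leq_mul => //; rewrite -muln2.
  by nia.
apply: (@leq_trans (4 * (k.+1 * k.+1) * (k.*2.+1 * (k.*2)`!))).
  by rewrite leq_mul.
rewrite mulnA [leqRHS]mulnA leq_mul2r; apply/orP; right.
rewrite [leqRHS]mulnA leq_mul2r; apply/orP; right.
by rewrite doubleS -muln2; nia.
Qed.

(** The type of the [t]-slices of a caloric function in terms of the order [rho]
    and the type [T] of its [z]-slices. *)
Definition caloric_type (rho T : R) : R :=
  (1 - rho / 2) * (2 * rho) `^ (rho / (2 - rho)) * T `^ (2 / (2 - rho)).

(** Convexity of the exponential, through its tangent at the barycentre. *)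
Lemma expR_am_gm (th x y : R) : 0 <= th -> th <= 1 ->
  expR ((1 - th) * x + th * y) <= (1 - th) * expR x + th * expR y.
Proof.
move=> t0 t1; set m := (X in expR X).
have tangent z : expR m * (1 + (z - m)) <= expR z.
  have -> : expR z = expR m * expR (z - m) by rewrite -expRD addrC subrK.
  by rewrite ler_wpM2l ?expR_ge0// expR_ge1Dx.
have H1 : (1 - th) * (expR m * (1 + (x - m))) <= (1 - th) * expR x.
  by rewrite ler_wpM2l// subr_ge0.
have H2 : th * (expR m * (1 + (y - m))) <= th * expR y by rewrite ler_wpM2l.
apply: le_trans (lerD H1 H2).
rewrite le_eqVlt; apply/orP; left; apply/eqP.
by rewrite /m; ring.
Qed.

Section Young.
Variable rho : R.
Hypothesis rho02 : 0 < rho < 2.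
Let sigma := rho / (2 - rho).
Let rho0 : 0 < rho. Proof. by case/andP: rho02. Qed.
Let rho2 : 0 < 2 - rho. Proof. by case/andP: rho02 => _; rewrite subr_gt0. Qed.

Lemma caloric_type_gt0 T : 0 < T -> 0 < caloric_type rho T.
Proof.
move=> T0; rewrite !mulr_gt0 ?powR_gt0 ?mulr_gt0//.
by rewrite subr_gt0 ltr_pdivrMr// mul1r -subr_gt0.
Qed.

(** Weighted arithmetic-geometric inequality with weights [1 - rho / 2] and
    [rho / 2]; [caloric_type rho T] is the constant that makes it sharp. *)
Lemma caloric_young T (u r : R) : 0 < T -> 0 < u -> 0 < r ->
  T * (u * r) `^ (rho / 2) <= caloric_type rho T * r `^ sigma + u / 4.
Proof.
move=> T0 u0 r0; have b0 : 0 < 2 * rho by rewrite mulr_gt0.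
have [a aE] := exists_ln T0; have [b bE] := exists_ln b0.
have [v vE] := exists_ln u0; have [q qE] := exists_ln r0.
have := @expR_am_gm (rho / 2) (b * sigma + 2 * a / (2 - rho) + q * sigma) (v - b).
have -> : (1 - rho / 2) * (b * sigma + 2 * a / (2 - rho) + q * sigma) +
    rho / 2 * (v - b) = a + (v + q) * (rho / 2).
  by rewrite /sigma; field; apply: lt0r_neq0.
rewrite /caloric_type -/sigma bE aE vE qE -!expRD -!expRM -!expRD expRB.
have -> : rho / 2 * (expR v / expR b) = expR v / 4.
  rewrite -bE; field; exact: lt0r_neq0.
move=> H; have {}H := H (ltW (divr_gt0 rho0 (ltr0Sn _ 1))).
have {}H : expR (a + (v + q) * (rho / 2)) <=
   (1 - rho / 2) * expR (b * sigma + 2 * a / (2 - rho) + q * sigma) + expR v / 4.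
  by apply: H; rewrite ler_pdivrMr// mul1r ltW// -subr_gt0.
apply: (le_trans H); rewrite lerD2r -!mulrA -!expRD.
rewrite le_eqVlt; apply/orP; left; apply/eqP; congr (_ * expR _).
by field; apply: lt0r_neq0.
Qed.

Lemma caloric_young_eq T (r : R) : 0 < T -> 0 < r ->
  let u := 2 * rho * T * r `^ rho in
  caloric_type rho T * (r ^+ 2 / u) `^ sigma + u / 4 = T * r `^ rho.
Proof.
move=> T0 r0; have b0 : 0 < 2 * rho by rewrite mulr_gt0.
have [a aE] := exists_ln T0; have [b bE] := exists_ln b0.
have [c cE] := exists_ln r0.
move=> u; have uE : u = expR (b + a + c * rho).
  by rewrite /u bE aE cE -expRM -!expRD.
have E1 : (r ^+ 2 / u) `^ sigma = expR ((2 * c - (b + a + c * rho)) * sigma).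
  by rewrite expRM expRB uE expRM_natl -cE.
have E2 : u / 4 = rho / 2 * expR (a + c * rho).
  by rewrite uE -addrA [expR (b + _)]expRD -bE; field.
have E3 : T * r `^ rho = expR (a + c * rho) by rewrite expRD expRM -aE -cE.
rewrite /caloric_type -/sigma E1 E2 E3 bE aE -!expRM -!mulrA -!expRD.
have -> : b * sigma + (a * (2 / (2 - rho)) + (2 * c - (b + a + c * rho)) * sigma)
   = a + c * rho.
  by rewrite /sigma; field; apply: lt0r_neq0.
by field.
Qed.

Lemma caloric_type_lt T T' : 0 <= T -> T < T' ->
  caloric_type rho T < caloric_type rho T'.
Proof.
move=> T0 TT'; rewrite /caloric_type ltr_pM2l; last first.
  rewrite mulr_gt0 ?powR_gt0 ?mulr_gt0//.
  by rewrite subr_gt0 ltr_pdivrMr// mul1r -subr_gt0.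
by rewrite gt0_ltr_powR ?nnegrE ?divr_gt0// ltW// (le_lt_trans T0).
Qed.

Lemma caloric_type_surj y : 0 < y -> exists2 T, 0 < T & caloric_type rho T = y.
Proof.
move=> y0; pose c := (1 - rho / 2) * (2 * rho) `^ sigma.
have c0 : 0 < c.
  rewrite mulr_gt0 ?powR_gt0 ?mulr_gt0//.
  by rewrite subr_gt0 ltr_pdivrMr// mul1r -subr_gt0.
exists ((y / c) `^ ((2 - rho) / 2)); first by rewrite powR_gt0// divr_gt0.
rewrite /caloric_type -/sigma -/c -powRrM.
rewrite (_ : (2 - rho) / 2 * (2 / (2 - rho)) = 1); last first.
  by field; apply: lt0r_neq0.
by rewrite powRr1 ?divr_ge0 ?ltW// mulrC divfK// gt_eqF.
Qed.

End Young.

End RealInequalities.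

(** * Growth of an entire function and of its coefficients *)

Section GrowthCoefficients.
Context {R : realType}.
Local Notation C := (R[i]).
Implicit Types (g : C -> C) (A B d r s T : R) (k n : nat) (w z : C).

Definition growth_le g B s T : Prop :=
  forall w, nrm (g w) <= B * expR (T * nrm w `^ s).

Definition coef_le_growth (c : nat -> C) B s T : Prop :=
  forall k r, 0 < r -> nrm (c k) * r ^+ k <= B * expR (T * r `^ s).

Lemma growth_le_coef g B s T : entire g -> growth_le g B s T ->
  coef_le_growth (coef g) (2 * B) s T.
Proof.
move=> eg H k r r0; rewrite -mulrA; apply: (coef_le k eg r0) => w wr.
by apply: le_trans (H w) _; rewrite wr.
Qed.

Lemma sum_geometric_le (q : R) n : 0 <= q -> q < 1 ->
  \sum_(k < n) q ^+ k <= (1 - q)^-1.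
Proof.
move=> q0 q1; have q10 : 0 < 1 - q by rewrite subr_gt0.
rewrite -[leRHS]mul1r ler_pdivlMr// mulrC.
have := subrX1 q n; rewrite -opprB -[q - 1]opprB mulNr => /oppr_inj <-.
by rewrite lerBlDr lerDl exprn_ge0.
Qed.

Lemma growth_le_ge0 g B s T : growth_le g B s T -> 0 <= B.
Proof.
move=> /(_ 0) /(le_trans (nrm_ge0 _)).
by rewrite pmulr_lge0 ?expR_gt0.
Qed.

Lemma coef_le_growth_ge0 c B s T : coef_le_growth c B s T -> 0 <= B.
Proof.
move=> /(_ 0%N 1 ltr01); rewrite expr0 mulr1 => /(le_trans (nrm_ge0 _)).
by rewrite pmulr_lge0 ?expR_gt0.
Qed.

(** The converse of the Cauchy estimate, at the price of an arbitrarily small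
    increase of the type: after a dilation of the radius the bounds on the terms
    are summable. *)
Lemma coef_growth_le s T T' : 0 < s -> 0 < T -> T < T' ->
  exists2 A, 0 < A & forall g B, entire g ->
    coef_le_growth (coef g) B s T -> growth_le g (A * B) s T'.
Proof.
move=> s0 T0 TT'; have [l l1 lT] := exists_dilation s0 T0 TT'.
have l0 : 0 < l by exact: lt_trans l1.
have q1 : l^-1 < 1 by rewrite invf_lt1.
have q0 : 0 <= l^-1 by rewrite invr_ge0 ltW.
have Q0 : 0 < (1 - l^-1)^-1 by rewrite invr_gt0 subr_gt0.
exists (expR T + (1 - l^-1)^-1); first by rewrite addr_gt0 ?expR_gt0.
move=> g B eg H w; have B0 := coef_le_growth_ge0 H.
have T'0 : 0 < T' by exact: lt_trans TT'.
have E1 : 1 <= expR (T' * nrm w `^ s).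
  by rewrite -expR0 ler_expR mulr_ge0 ?powR_ge0 ?ltW.
have [->|w0] := eqVneq w 0.
  have := H 0%N 1 ltr01; rewrite expr0 mulr1 (coef_at0 eg) powR1 mulr1 => /le_trans.
  apply; rewrite nrm0 powR0 ?gt_eqF// mulr0 expR0 mulr1 mulrC.
  by rewrite ler_wpM2r// lerDl ltW.
have x0 : 0 < nrm w by rewrite nrm_gt0.
set x := nrm w in x0 E1 *.
apply: (@le_trans _ _ ((1 - l^-1)^-1 * B * expR (T' * x `^ s))); last first.
  by rewrite ler_wpM2r ?expR_ge0// ler_wpM2r// lerDr expR_ge0.
have [M HM] := entire_bounded (2 * x) eg.
have M0 : 0 <= M by apply: le_trans (nrm_ge0 (g 0)) (HM 0 _); rewrite nrm0 mulr_ge0 ?ltW.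
have x2 : x < 2 * x by rewrite ltr_pMl// ltr1n.
have bound n : nrm (g w) <= (1 - l^-1)^-1 * B * expR (T' * x `^ s) +
    8 * M * 2^-1 ^+ n.+1.
  have H2 := taylor_remainder n eg x2 HM.
  rewrite -[X in nrm X](subrK (\sum_(k < n.+1) coef g k * w ^+ k)).
  apply: le_trans (nrmD _ _) _; rewrite addrC; apply: lerD; last first.
    apply: le_trans H2 _; rewrite -/x.
    have -> : x / (2 * x) = 2^-1 by field; rewrite gt_eqF.
    have -> : 2 * x / (2 * x - x) = 2.
      have -> : 2 * x - x = x by ring.
      by rewrite mulfK// gt_eqF.
    by rewrite le_eqVlt; apply/orP; left; apply/eqP; ring.
  apply: le_trans (nrm_sum _ _ _) _.
  have term k : nrm (coef g k * w ^+ k) <= B * expR (T' * x `^ s) * l^-1 ^+ k.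
    rewrite nrmM nrmX -/x; have := H k (l * x) (mulr_gt0 l0 x0).
    rewrite (exp_dilation (ltW x0) (ltW l0) lT) exprMn => Hk.
    by rewrite exprVn ler_pdivlMr ?exprn_gt0// -mulrA (mulrC (x ^+ k)).
  apply: (@le_trans _ _ (\sum_(k < n.+1) B * expR (T' * x `^ s) * l^-1 ^+ k)).
    by apply: ler_sum => k _; exact: term.
  have -> : (1 - l^-1)^-1 * B * expR (T' * x `^ s) =
    B * expR (T' * x `^ s) * (1 - l^-1)^-1 by ring.
  rewrite -mulr_sumr; apply: ler_wpM2l; last exact: sum_geometric_le.
  by rewrite mulr_ge0// expR_ge0.
apply/ler_addgt0Pr => e e0.
have /cvgrPdist_lt/(_ _ e0) : (8 * M * (2^-1 ^+ n)) @[n --> \oo] --> 0.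
  rewrite -(mulr0 (8 * M)); apply: cvgM; first exact: cvg_cst.
  by apply: cvg_expr; rewrite ger0_norm// invf_lt1// ltr1n.
case=> n _ /(_ n.+1 (leqnSn n)) /= ; rewrite sub0r normrN ger0_norm.
  by move=> h; apply: le_trans (bound n) _; rewrite lerD2l ltW.
by rewrite !mulr_ge0// exprn_ge0// invr_ge0.
Qed.

(** The order and the type do not depend on the centre. *)
Lemma growth_le_shift s T T' d : 0 < s -> 0 < T -> T < T' -> 0 <= d ->
  exists2 A, 0 < A & forall g B z, nrm z <= d -> growth_le g B s T ->
    growth_le (fun w => g (z + w)) (A * B) s T'.
Proof.
move=> s0 T0 TT' d0; have [A A0 HA] := exp_shift s0 T0 TT' d0.
exists A => // g B z zd H w; have B0 := growth_le_ge0 H.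
apply: le_trans (H _) _; rewrite -mulrA mulrCA; apply: ler_wpM2l => //.
apply: le_trans (HA _ (nrm_ge0 w)).
rewrite ler_expR ler_wpM2l ?(ltW T0)// powR_mono ?(ltW s0) ?nrm_ge0//.
by apply: le_trans (nrmD _ _) _; rewrite addrC lerD2l.
Qed.

Lemma fact_ratio_gt0 k : 0 < (k.*2)`!%:R / k`!%:R :> R.
Proof. by rewrite divr_gt0// ltr0n fact_gt0. Qed.

(** Stirling turns the factor (2k)!/k! into (4k/e)^k = max_u u^k exp(- u / 4);
    Young's inequality then evaluates the resulting exponent. *)
Lemma even_coef_to_t (rho T a B : R) k : 0 < rho < 2 -> 0 < T -> 0 <= a ->
  (forall r, 0 < r -> a * r ^+ k.*2 <= B * expR (T * r `^ rho)) ->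
  forall r, 0 < r -> (k.*2)`!%:R / k`!%:R * a * r ^+ k <=
    expR 1 * B * k.+1%:R * expR (caloric_type rho T * r `^ (rho / (2 - rho))).
Proof.
move=> rho02 T0 a0 H r r0; have /andP[rho0 rho2] := rho02.
have K0 := caloric_type_gt0 rho02 T0.
have B0 : 0 <= B.
  have := H 1 ltr01; rewrite expr1n mulr1 => /(le_trans a0).
  by rewrite pmulr_lge0 ?expR_gt0.
have E1 : 1 <= expR (caloric_type rho T * r `^ (rho / (2 - rho))).
  by rewrite -expR0 ler_expR mulr_ge0 ?powR_ge0 ?ltW.
case: k H => [|k] H.
  (* This radius makes the exponent equal to 1. *)
  have TE : T * (T `^ (- rho^-1)) `^ rho = 1.
    rewrite -powRrM mulNr mulVf; last by rewrite gt_eqF.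
    by rewrite powR_inv1 ?(ltW T0)// divff// gt_eqF.
  have Hk := H _ (powR_gt0 (- rho^-1) T0).
  rewrite TE double0 expr0 mulr1 in Hk.
  rewrite double0 expr0 mulr1 divff; last by rewrite pnatr_eq0.
  rewrite mul1r mulr1; apply: (le_trans Hk); rewrite [B * _]mulrC.
  by rewrite ler_peMr// mulr_ge0 ?expR_ge0.
(* [u ^ n * expR (- (u / 4))] is maximal at [u = 4 n]. *)
set n := k.+1 in H *; pose u : R := 4 * n%:R.
have n0 : 0 < n%:R :> R by rewrite ltr0n.
have u0 : 0 < u by rewrite mulr_gt0.
have st : (n.*2)`!%:R / n`!%:R <= expR 1 * n%:R * (u ^+ n * expR (- (u / 4))) :> R.
  apply: (@le_trans _ _ (4 ^+ n * n`!%:R)).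
    rewrite ler_pdivrMr ?ltr0n ?fact_gt0// -mulrA -natrM.
    by rewrite -natrX -natrM ler_nat; have [] := central_factorial n.
  apply: (@le_trans _ _ (4 ^+ n * (expR 1 * n%:R * (n%:R * expR (-1)) ^+ n))).
    by rewrite ler_wpM2l ?exprn_ge0// fact_upper.
  have -> : expR (- (u / 4)) = expR (-1) ^+ n.
    by rewrite -expRM_natl /u; congr expR; field.
  by rewrite le_eqVlt; apply/orP; left; apply/eqP; rewrite /u !exprMn; ring.
have y := caloric_young rho02 T0 u0 r0.
have ur0 : 0 < u * r by rewrite mulr_gt0.
pose q := (u * r) `^ 2^-1.
have q0 : 0 < q by rewrite powR_gt0.
have qq : q ^+ n.*2 = u ^+ n * r ^+ n.
  rewrite -muln2 mulnC exprM -[q ^+ 2]powR_mulrn ?(ltW q0)// -powRrM.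
  by rewrite mulVf ?pnatr_eq0// powRr1 ?(ltW ur0)// exprMn.
have := H q q0; rewrite qq /q -powRrM [2^-1 * rho]mulrC => Hq.
apply: (@le_trans _ _ (expR 1 * n%:R * (u ^+ n * expR (- (u / 4))) * a * r ^+ n)).
  by rewrite ler_wpM2r ?exprn_ge0 ?(ltW r0)// ler_wpM2r.
have -> : expR 1 * n%:R * (u ^+ n * expR (- (u / 4))) * a * r ^+ n =
  expR 1 * n%:R * (expR (- (u / 4)) * (a * (u ^+ n * r ^+ n))) by ring.
have -> : expR 1 * B * n.+1%:R * expR (caloric_type rho T * r `^ (rho / (2 - rho))) =
  expR 1 * n.+1%:R * (B * expR (caloric_type rho T * r `^ (rho / (2 - rho)))) by ring.
apply: ler_pM.
- by rewrite mulr_ge0 ?expR_ge0.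
- have u0' := ltW u0; have r0' := ltW r0.
  by rewrite !(mulr_ge0, expR_ge0, exprn_ge0).
- by rewrite ler_wpM2l ?expR_ge0// ler_nat.
apply: (@le_trans _ _ (expR (- (u / 4)) * (B * expR (T * (u * r) `^ (rho / 2))))).
  by rewrite ler_wpM2l ?expR_ge0.
rewrite mulrCA ler_wpM2l// -expRD ler_expR.
by rewrite addrC lerBlDr.
Qed.

(** The reverse estimate uses k! >= v^k exp(- v), with the [u] for which Young's
    inequality is an equality. *)
Lemma even_coef_to_z (rho T a B : R) k : 0 < rho < 2 -> 0 < T -> 0 <= a ->
  (forall r, 0 < r -> (k.*2)`!%:R / k`!%:R * a * r ^+ k <=
     B * expR (caloric_type rho T * r `^ (rho / (2 - rho)))) ->
  forall r, 0 < r -> a * r ^+ k.*2 <=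
    2 * B * k.+1%:R * expR (T * r `^ rho).
Proof.
move=> rho02 T0 a0 H r r0; have /andP[rho0 rho2] := rho02.
have eq := caloric_young_eq rho02 T0 r0; rewrite /= in eq.
set u := 2 * rho * T * r `^ rho in eq.
have u0 : 0 < u by rewrite !mulr_gt0 ?powR_gt0.
have x0 : 0 < r ^+ 2 / u by rewrite divr_gt0// exprn_gt0.
have := H _ x0; set E := expR _ => Hx.
have c1 : 4 ^+ k * k`!%:R <= k.*2.+1%:R * ((k.*2)`!%:R / k`!%:R) :> R.
  rewrite mulrA ler_pdivlMr ?ltr0n ?fact_gt0// -mulrA -!natrM -natrX -natrM.
  by rewrite ler_nat; have [] := central_factorial k.
have c2 : u ^+ k * expR (- (u / 4)) <= 4 ^+ k * k`!%:R.
  have := @exp_ge_powfact R (u / 4) k (divr_ge0 (ltW u0) (ler0n _ 4)).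
  rewrite ler_pdivrMr ?ltr0n ?fact_gt0// expr_div_n ler_pdivrMr ?exprn_gt0// => h.
  rewrite expRN ler_pdivrMr ?expR_gt0//; apply: le_trans h _.
  by rewrite le_eqVlt; apply/orP; left; apply/eqP; ring.
have c3 : u ^+ k * expR (- (u / 4)) <= 2 * k.+1%:R * ((k.*2)`!%:R / k`!%:R).
  apply: (le_trans c2); apply: (le_trans c1).
  rewrite ler_wpM2r ?(ltW (fact_ratio_gt0 k))// -natrM ler_nat.
  by rewrite -muln2; lia.
have uk0 : 0 < u ^+ k by rewrite exprn_gt0.
have rk : r ^+ k.*2 = (r ^+ 2 / u) ^+ k * u ^+ k.
  by rewrite -muln2 mulnC exprM -exprMn divfK// gt_eqF.
have y0 : 0 <= a * (r ^+ 2 / u) ^+ k by rewrite mulr_ge0// exprn_ge0// ltW.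
have -> : a * r ^+ k.*2 =
   expR (u / 4) * (u ^+ k * expR (- (u / 4)) * (a * (r ^+ 2 / u) ^+ k)).
  rewrite rk expRN; field.
  by rewrite !gt_eqF// expR_gt0.
have -> : 2 * B * k.+1%:R * expR (T * r `^ rho) =
   expR (u / 4) * (2 * k.+1%:R * (B * E)).
  by rewrite -eq expRD -/E; ring.
rewrite ler_wpM2l ?expR_ge0//.
apply: (@le_trans _ _ (2 * k.+1%:R * ((k.*2)`!%:R / k`!%:R) * (a * (r ^+ 2 / u) ^+ k))).
  by rewrite ler_wpM2r.
rewrite -mulrA ler_wpM2l ?mulr_ge0//.
by rewrite mulrA.
Qed.

End GrowthCoefficients.

(** * Growth in z against growth in t *)

Section HeatGrowth.
Context {R : realType}.
Local Notation C := (R[i]).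
Implicit Types (g : C -> C) (A B d r s T rho : R) (k n : nat) (w z : C).

(** Linear factors in the index only cost an arbitrarily small increase of the
    type. *)
Lemma absorb_linear s T T' : 0 < s -> 0 < T -> T < T' ->
  exists2 A, 0 < A & forall (x B : R) n, 0 <= x ->
    (forall r, 0 < r -> x * r ^+ n <= B * n.+1%:R * expR (T * r `^ s)) ->
    forall r, 0 < r -> x * r ^+ n <= A * B * expR (T' * r `^ s).
Proof.
move=> s0 T0 TT'; have [l l1 lT] := exists_dilation s0 T0 TT'.
have l0 : 0 < l by exact: lt_trans l1.
have [A A0 HA] := linear_le_geometric l1; exists A => // x B n x0 H r r0.
have B0 : 0 <= B.
  have := H 1 ltr01; rewrite expr1n mulr1 => /(le_trans x0).
  by rewrite pmulr_lge0 ?expR_gt0// pmulr_lge0.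
have ln : 0 < l ^+ n by rewrite exprn_gt0.
have := H (l * r) (mulr_gt0 l0 r0).
rewrite (exp_dilation (ltW r0) (ltW l0) lT) exprMn => Hr.
rewrite -(ler_pM2r ln).
have -> : x * r ^+ n * l ^+ n = x * (l ^+ n * r ^+ n) by ring.
apply: (le_trans Hr).
have -> : A * B * expR (T' * r `^ s) * l ^+ n =
   B * expR (T' * r `^ s) * (A * l ^+ n) by ring.
rewrite mulrAC; apply: ler_wpM2l => //.
by rewrite mulr_ge0// expR_ge0.
Qed.

Lemma derive_le g z (M : R) : entire g ->
  (forall h, nrm h = 1 -> nrm (g (z + h)) <= M) -> nrm ('D_1 g z) <= 2 * M.
Proof.
move=> eg H; rewrite (derive_coef z eg).
have := coef_le (g := fun h => g (z + h)) 1 (@entire_shift R g z eg) ltr01 H.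
by rewrite expr1 mulr1.
Qed.

Lemma expR_powR_le s T T' r : 0 <= r -> T <= T' ->
  expR (T * r `^ s) <= expR (T' * r `^ s).
Proof. by move=> r0 TT'; rewrite ler_expR ler_wpM2r ?powR_ge0. Qed.

Variable F : C * C -> C.
Hypotheses (eF : entire2 F) (hF : heat_equation F).
Local Notation f := (slice_z F 0).
Local Notation b := (tcoef F).
Local Notation b1 := (tcoef1 F).

Lemma tcoef1E k z : b1 k z = 'D_1 (b k) z.
Proof. by have [_ ->] := tcoef_derive eF k z. Qed.

Lemma derive_tcoef1 k z : 'D_1 (b1 k) z = k.+1%:R * b k.+1 z.
Proof. by have [_ ->] := tcoef1_derive eF hF k z. Qed.

Lemma nrm_tcoef k z :
  nrm (b k z) = (k.*2)`!%:R / k`!%:R * nrm (zcoef F k.*2 z).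
Proof.
have [/(_ z) E _] := tcoef_zcoef eF hF k.
have k0 : k`!%:R != 0 :> R by rewrite pnatr_eq0 -lt0n fact_gt0.
apply: (mulfI k0); rewrite mulrA mulrCA divff// mulr1.
by rewrite -!(nrm_nat (R := R)) -!nrmM E.
Qed.

Lemma nrm_tcoef1 k z :
  nrm (b1 k z) = (k.*2.+1)`!%:R / k`!%:R * nrm (zcoef F k.*2.+1 z).
Proof.
have [_ /(_ z) E] := tcoef_zcoef eF hF k.
have k0 : k`!%:R != 0 :> R by rewrite pnatr_eq0 -lt0n fact_gt0.
apply: (mulfI k0); rewrite mulrA mulrCA divff// mulr1.
by rewrite -!(nrm_nat (R := R)) -!nrmM E.
Qed.

Lemma tcoef1_le B d s T :
  (forall z, nrm z <= d + 1 -> coef_le_growth (b ^~ z) B s T) ->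
  forall z, nrm z <= d -> coef_le_growth (b1 ^~ z) (2 * B) s T.
Proof.
move=> H z zd k r r0; rewrite tcoef1E -ler_pdivlMr ?exprn_gt0// -!mulrA.
apply: derive_le; first exact: entire_tcoef.
move=> h h1; rewrite mulrA ler_pdivlMr ?exprn_gt0//; apply: H => //.
by rewrite (le_trans (nrmD _ _))// lerD// h1.
Qed.

(** Translate to the centre [z], pass to coefficients, convert the even ones by
    [even_coef_to_t]; the [z]-derivative follows from Cauchy's estimate. The
    bounds are uniform for [z] in a disc. *)
Theorem heat_growth_up rho T T' B d : 0 < rho < 2 -> 0 < T -> T < T' -> 0 <= d ->
  growth_le f B rho T ->
  exists B', forall z, nrm z <= d ->
    coef_le_growth (b ^~ z) B' (rho / (2 - rho)) (caloric_type rho T') /\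
    coef_le_growth (b1 ^~ z) B' (rho / (2 - rho)) (caloric_type rho T').
Proof.
move=> rho02 T0 TT' d0 Hf; have /andP[rho0 rho2] := rho02.
set s := rho / (2 - rho); have s0 : 0 < s by rewrite divr_gt0// subr_gt0.
pose T1 := (T + T') / 2.
have TT1 : T < T1 by rewrite /T1; lra.
have T1T' : T1 < T' by rewrite /T1; lra.
have T10 : 0 < T1 by exact: lt_trans TT1.
have d1 : 0 <= d + 1 by rewrite addr_ge0.
have [A A0 HA] := growth_le_shift rho0 T0 TT1 d1.
have [A2 A20 HA2] := absorb_linear s0 (caloric_type_gt0 rho02 T10)
   (caloric_type_lt rho02 (ltW T10) T1T').
have Hb z : nrm z <= d + 1 ->
    coef_le_growth (b ^~ z) (A2 * (expR 1 * (2 * (A * B)))) s (caloric_type rho T').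
  move=> zd k r r0; have Hz := HA _ _ _ zd Hf.
  have Ez : entire (fun w => f (z + w)).
    exact: (@entire_shift R f z (entire_slice_z eF (t := 0))).
  have Hc := growth_le_coef Ez Hz.
  apply: HA2 => //; first exact: nrm_ge0.
  move=> {}r {}r0; rewrite nrm_tcoef.
  apply: (even_coef_to_t rho02 T10 (nrm_ge0 _)) => //.
  by move=> q q0; exact: Hc.
have B'0 : 0 <= A2 * (expR 1 * (2 * (A * B))).
  by apply: (coef_le_growth_ge0 (Hb 0 _)); rewrite nrm0.
have Hb1 := tcoef1_le Hb.
exists (2 * (A2 * (expR 1 * (2 * (A * B))))) => z zd; split; last exact: Hb1.
move=> k r r0; apply: le_trans (Hb z _ k r r0) _; first by rewrite (le_trans zd)// lerDl.
by rewrite ler_wpM2r ?expR_ge0// ler_peMl// ler1n.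
Qed.

(** Both families are needed: the coefficients of [F] at [z] control the even
    derivatives of the initial value only, those of the [z]-derivative the odd
    ones. *)
Theorem heat_growth_down rho T T' B z : 0 < rho < 2 -> 0 < T -> T < T' ->
  coef_le_growth (b ^~ z) B (rho / (2 - rho)) (caloric_type rho T) ->
  coef_le_growth (b1 ^~ z) B (rho / (2 - rho)) (caloric_type rho T) ->
  exists B', growth_le f B' rho T'.
Proof.
move=> rho02 T0 TT' Hb Hb1; have /andP[rho0 rho2] := rho02.
(* The type increases in four steps. *)
pose e := (T' - T) / 4.
have e0 : 0 < e by rewrite divr_gt0// subr_gt0.
pose T1 := T + e; pose T2 := T1 + e; pose T3 := T2 + e.
have TT1 : T < T1 by rewrite /T1; lra.
have T12 : T1 < T2 by rewrite /T2; lra.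
have T23 : T2 < T3 by rewrite /T3; lra.
have T3T : T3 < T' by rewrite /T3 /T2 /T1 /e; lra.
have eT2 : T1 + e = T2 by [].
have T10 : 0 < T1 by exact: lt_trans TT1.
have T20 : 0 < T2 by exact: lt_trans T12.
have T30 : 0 < T3 by exact: lt_trans T23.
clearbody T3 T2 T1.
have B0 : 0 <= B := coef_le_growth_ge0 Hb.
have [A A0 HA] := absorb_linear rho0 T0 TT1.
have [L L0 HL] := linear_le_exp rho0 e0.
have low (a : R) k : 0 <= a ->
   (forall r, 0 < r -> (k.*2)`!%:R / k`!%:R * a * r ^+ k <=
     B * expR (caloric_type rho T * r `^ (rho / (2 - rho)))) ->
   forall r, 0 < r -> a * r ^+ k.*2 <= A * (2 * B) * expR (T1 * r `^ rho).
  move=> a0 H; apply: HA => // r r0.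
  apply: le_trans (even_coef_to_z rho02 T0 a0 H r0) _.
  rewrite ler_wpM2r ?expR_ge0// ler_wpM2l ?mulr_ge0// ler_nat ltnS.
  by rewrite -addnn leq_addr.
have Heven k r : 0 < r -> nrm (zcoef F k.*2 z) * r ^+ k.*2 <=
    A * (2 * B) * expR (T1 * r `^ rho).
  apply: low; first exact: nrm_ge0.
  by move=> q q0; rewrite -nrm_tcoef; exact: Hb.
have Hodd k r : 0 < r -> nrm (zcoef F k.*2.+1 z) * r ^+ k.*2 <=
    A * (2 * B) * expR (T1 * r `^ rho).
  apply: low; first exact: nrm_ge0.
  move=> q q0; apply: le_trans (Hb1 k q q0); rewrite nrm_tcoef1.
  rewrite ler_wpM2r ?exprn_ge0 ?(ltW q0)// ler_wpM2r ?nrm_ge0//.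
  rewrite ler_wpM2r ?invr_ge0// ler_nat factS.
  by rewrite leq_pmull.
have AB0 : 0 <= A * (2 * B) by rewrite mulr_ge0 ?(ltW A0)// mulr_ge0.
have Hall : coef_le_growth (zcoef F ^~ z) (A * (2 * B) * (1 + L)) rho T2.
  move=> n r r0; rewrite -(odd_double_half n); case: (odd n) => /=.
    rewrite add1n exprSr mulrA.
    apply: (@le_trans _ _ (A * (2 * B) * expR (T1 * r `^ rho) *
        (L * expR (e * r `^ rho)))).
      apply: ler_pM => //.
      - by rewrite mulr_ge0 ?nrm_ge0// exprn_ge0// ltW.
      - exact: ltW.
      - exact: Hodd.
      - by apply: HL; exact: ltW.
    have -> : A * (2 * B) * expR (T1 * r `^ rho) * (L * expR (e * r `^ rho)) =
      A * (2 * B) * L * expR (T2 * r `^ rho).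
      have -> : expR (T2 * r `^ rho) = expR (T1 * r `^ rho) * expR (e * r `^ rho).
        by rewrite -expRD -mulrDl eT2.
      by ring.
    by rewrite ler_wpM2r ?expR_ge0// ler_wpM2l// lerDr.
  rewrite add0n; apply: le_trans (Heven _ _ r0) _.
  apply: ler_pM; [exact: AB0|exact: expR_ge0| |].
    by rewrite ler_peMr// lerDl ltW.
  by apply: expR_powR_le; exact: ltW.
have Ez : entire (fun w => f (z + w)).
  exact: (@entire_shift R f z (entire_slice_z eF (t := 0))).
have [A' _ HA'] := coef_growth_le rho0 T20 T23.
have Hz := HA' _ _ Ez Hall.
have [A'' _ HA''] := growth_le_shift rho0 T30 T3T (nrm_ge0 z).
exists (A'' * (A' * (A * (2 * B) * (1 + L)))).
have nz : nrm (- z) <= nrm z by rewrite nrmN lexx.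
move=> w; have := HA'' _ _ _ nz Hz w.
by rewrite addNKr.
Qed.

Lemma tcoef_growth_le B d s T T' : 0 < s -> 0 < T -> T < T' ->
  (forall z, nrm z <= d -> coef_le_growth (b ^~ z) B s T) ->
  exists B', forall z, nrm z <= d -> growth_le (slice_t F z) B' s T'.
Proof.
move=> s0 T0 TT' H; have [A A0 HA] := coef_growth_le s0 T0 TT'.
by exists (A * B) => z zd; apply: HA; [exact: entire_slice_t|exact: H].
Qed.

Lemma tcoef1_growth_le B d s T T' : 0 < s -> 0 < T -> T < T' ->
  (forall z, nrm z <= d -> coef_le_growth (b1 ^~ z) B s T) ->
  exists B', forall z, nrm z <= d -> growth_le (fun t => dz F t z) B' s T'.
Proof.
move=> s0 T0 TT' H; have [A A0 HA] := coef_growth_le s0 T0 TT'.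
by exists (A * B) => z zd; apply: HA; [exact: entire_dz|exact: H].
Qed.

End HeatGrowth.

(** * A Remez inequality on a line *)

Section Nodes.
Context {R : realType}.
Local Notation C := (R[i]).
Local Notation mu := (@lebesgue_measure R).

(** A set of measure larger than [2 n d] contains [n + 1] points with gaps [d]:
    take them greedily from left to right. *)
Lemma separated_points (d : R) n (S : set R) : 0 < d -> measurable S ->
  has_lbound S -> ((n%:R * (2 * d))%:E < mu S)%E ->
  exists y : nat -> R, (forall i, (i <= n)%N -> S (y i)) /\
    (forall i, y i + d <= y i.+1).
Proof.
move=> d0; elim: n S => [|n IH] S mS bS muS.
  have [y Sy] : S !=set0.
    apply/set0P/negP => /eqP S0; move: muS.
    by rewrite S0 measure0 mul0r ltxx.
  exists (fun i => y + i%:R * d); split.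
    by move=> i; rewrite leqn0 => /eqP ->; rewrite mul0r addr0.
  by move=> i; rewrite -natr1 mulrDl mul1r addrA.
have S0 : S !=set0.
  apply/set0P/negP => /eqP S0; move: muS; rewrite S0 measure0 lte_fin ltNge.
  by rewrite !mulr_ge0// ltW.
have hi : has_inf S by [].
have [y0 Sy0 y0a] := inf_adherent d0 hi.
set a := inf S in y0a.
pose S' := S `&` `[y0 + d, +oo[.
have mS' : measurable S' by apply: measurableI => //; exact: measurable_itv.
pose I : set R := `[a, a + 2 * d]%classic.
have SS : S `<=` S' `|` I.
  move=> y Sy; have ay : a <= y by apply: inf_lbound => //; case: hi.
  have [h|h] := leP (y0 + d) y.
    by left; split => //=; rewrite in_itv /= h.
  by right; rewrite /I /= in_itv /= ay /=; lra.
have mI : measurable I by exact: measurable_itv.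
have lt' : ((n%:R * (2 * d))%:E < mu S')%E.
  rewrite ltNge; apply/negP => le'; move: muS; rewrite ltNge => /negP; apply.
  have H1 : (mu S <= mu (S' `|` I))%E.
    by apply: le_measure => //; rewrite inE//; exact: measurableU.
  apply: (le_trans H1); have H2 := measureU2 (@lebesgue_measure R) mS' mI; apply: (le_trans H2).
  have -> : (n.+1%:R * (2 * d))%:E = ((n%:R * (2 * d))%:E + (2 * d)%:E)%E.
    by rewrite -EFinD -natr1; congr EFin; ring.
  apply: leeD => //.
  have H3 : (mu I <= (2 * d)%:E)%E.
    have -> := @lebesgue_measure_itv R (Interval (BLeft a) (BRight (a + 2 * d)%R)).
    rewrite /= lte_fin; case: ifP => _; last by rewrite lee_fin mulr_ge0// ltW.
    by rewrite -EFinB lee_fin; lra.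
  exact: H3.
have bS' : has_lbound S' by exists (y0 + d) => y [_]; rewrite /= in_itv /= andbT.
have [y [Hy1 Hy2]] := IH S' mS' bS' lt'.
exists (fun i => if i is j.+1 then y j else y0); split.
  by case=> // i; rewrite ltnS => /Hy1[].
case=> [|i]; last exact: Hy2.
by have [_] := Hy1 0%N (leq0n _); rewrite /= in_itv /= andbT.
Qed.

Lemma separated_dist (d : R) (y : nat -> R) i k : 0 < d ->
  (forall i, y i + d <= y i.+1) -> k%:R * d <= `|y (k + i)%N - y i|.
Proof.
move=> d0 H; suff : y i + k%:R * d <= y (k + i)%N.
  by move=> h; apply: le_trans (ler_norm _); rewrite lerBrDl.
elim: k => [|k IH]; first by rewrite mul0r addr0.
apply: le_trans (H _); rewrite -natr1 mulrDl mul1r addrA; exact: lerD.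
Qed.

Lemma node_prod_last (d : R) (y : nat -> R) n : 0 < d ->
  (forall i, y i + d <= y i.+1) ->
  d ^+ n * n`!%:R <= \prod_(j < n) `|y n - y j|.
Proof.
move=> d0; elim: n y => [|n IH] y H; first by rewrite big_ord0 mul1r.
rewrite big_ord_recl exprS factS natrM.
have -> : d * d ^+ n * (n.+1%:R * n`!%:R) = (n.+1%:R * d) * (d ^+ n * n`!%:R) by ring.
apply: ler_pM.
- by rewrite mulr_ge0// ltW.
- by rewrite mulr_ge0// exprn_ge0// ltW.
- by have := separated_dist 0 n.+1 d0 H; rewrite addn0.
- exact: (IH (fun i => y i.+1)).
Qed.

(** The factor of index [j] is at least [d * |i - j|], and these distances have
    product [i! (n - i)!]. *)
Lemma node_prod (d : R) (y : nat -> R) n i : 0 < d ->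
  (forall i, y i + d <= y i.+1) -> (i <= n)%N ->
  d ^+ n * (i`! * (n - i)`!)%:R <=
  \prod_(j < n.+1 | j != i :> nat) `|y i - y j|.
Proof.
move=> d0 H; elim: n => [|n IH].
  rewrite leqn0 => /eqP ->; rewrite big_mkcond big_ord_recl big_ord0 /=.
  by rewrite !mul1r.
rewrite leq_eqVlt => /orP[/eqP ->|].
  rewrite big_mkcond big_ord_recr /= eqxx /= mulr1 subnn muln1.
  apply: le_trans (node_prod_last n.+1 d0 H) _.
  apply: ler_prod => j _; rewrite normr_ge0 /=.
  by rewrite (ltn_eqF (ltn_ord j)).
rewrite ltnS => ni; rewrite big_mkcond big_ord_recr /= -big_mkcond /=.
rewrite eq_sym (ltn_eqF (leq_ltn_trans ni (ltnSn n))) /=.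
rewrite subSn// factS exprSr.
have -> : d ^+ n * d * (i`! * ((n - i).+1 * (n - i)`!))%:R =
  (d ^+ n * (i`! * (n - i)`!)%:R) * ((n - i).+1%:R * d).
  by rewrite !natrM; ring.
apply: ler_pM.
- by rewrite mulr_ge0// exprn_ge0// ltW.
- by rewrite mulr_ge0// ltW.
- exact: IH.
- rewrite distrC; have := separated_dist i (n - i).+1 d0 H.
  by rewrite addSn subnK.
Qed.

Lemma lagrange_bound (p : {poly C}) n (x : nat -> C) (m D : R) z :
  (size p <= n.+1)%N -> (forall i j, (i <= n)%N -> (j <= n)%N -> x i = x j -> i = j) ->
  (forall i, (i <= n)%N -> nrm p.[x i] <= m) ->
  (forall i, (i <= n)%N -> nrm (z - x i) <= D) ->
  nrm p.[z] <= \sum_(i < n.+1) m * (D ^+ n /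
    \prod_(j < n.+1 | j != i :> nat) nrm (x i - x j)).
Proof.
move=> sp xinj pm zD.
pose Lp (i : 'I_n.+1) : {poly C} :=
  \prod_(j < n.+1 | j != i) ((x i - x j)^-1 *: ('X - (x j)%:P)).
have LpE i w : (Lp i).[w] = \prod_(j < n.+1 | j != i) ((x i - x j)^-1 * (w - x j)).
  by rewrite horner_prod; apply: eq_bigr => j _; rewrite hornerZ hornerXsubC.
have xx (i j : 'I_n.+1) : j != i -> x i - x j != 0.
  move=> ji; rewrite subr_eq0; apply: contra ji => /eqP /xinj E.
  by apply/eqP/val_inj/esym/E; rewrite -ltnS.
have Ldiag i : (Lp i).[x i] = 1.
  by rewrite LpE big1// => j ji; rewrite mulVf// xx.
have Loff (i j : 'I_n.+1) : i != j -> (Lp i).[x j] = 0.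
  by move=> ij; rewrite LpE (bigD1 j) 1?eq_sym//= subrr mulr0 mul0r.
have sL i : (size (Lp i) <= n.+1)%N.
  apply: leq_trans (size_poly_prod_leq _ _) _ => /=.
  rewrite (eq_bigr (fun=> 2%N)); last first.
    move=> j ji; rewrite size_scale ?size_XsubC// invr_neq0// xx//.
  by rewrite sum_nat_const cardC1 card_ord; lia.
pose q := p - \sum_(i < n.+1) p.[x i] *: Lp i.
have sq : (size q <= n.+1)%N.
  apply: leq_trans (size_polyD _ _) _; rewrite geq_max sp /= size_polyN.
  apply: leq_trans (size_sum _ _ _) _; apply/bigmax_leqP => i _.
  exact: leq_trans (size_scale_leq _ _) (sL i).
have q0 : q = 0.
  apply: (@roots_geq_poly_eq0 _ q [seq x i | i <- iota 0 n.+1]).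
  - apply/allP => w /mapP [k]; rewrite mem_iota /= add0n => klt ->.
    rewrite /root /q hornerD hornerN horner_sum (bigD1 (Ordinal klt))//=.
    rewrite hornerZ (Ldiag (Ordinal klt)) mulr1 big1; last first.
      by move=> j ji; rewrite hornerZ (Loff j (Ordinal klt))// mulr0.
    by rewrite addr0 subrr.
  - rewrite map_inj_in_uniq ?iota_uniq// => i j.
    by rewrite !mem_iota /= !add0n !ltnS; exact: xinj.
  - by rewrite size_map size_iota.
have -> : p.[z] = \sum_(i < n.+1) p.[x i] * (Lp i).[z].
  have := congr1 (horner^~ z) q0; rewrite /q hornerD hornerN horner_sum horner0.
  move/eqP; rewrite subr_eq0 => /eqP ->.
  by apply: eq_bigr => i _; rewrite hornerZ.
apply: le_trans (nrm_sum _ _ _) _; apply: ler_sum => i _.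
have il : (i <= n)%N by rewrite -ltnS.
rewrite nrmM; apply: ler_pM; rewrite ?nrm_ge0//; first exact: pm.
have -> : nrm (Lp i).[z] = \prod_(j < n.+1 | j != i) (nrm (z - x j) / nrm (x i - x j)).
  rewrite LpE (big_morph (@nrm R) (@nrmM R) (@nrm1 R)).
  by apply: eq_bigr => j _; rewrite nrmM nrmV mulrC.
rewrite big_split /= prodfV; apply: ler_wpM2r.
  by rewrite invr_ge0 prodr_ge0// => j _; exact: nrm_ge0.
have -> : D ^+ n = \prod_(j < n.+1 | j != i) D.
  by rewrite prodr_const cardC1 card_ord.
apply: ler_prod => j _; rewrite nrm_ge0 /=; apply: zD.
by rewrite -ltnS.
Qed.

Lemma nrm_vline (a : R) (u v : R) : nrm ((a +i* u) - (a +i* v)) = `|u - v|.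
Proof.
have -> : (a +i* u) - (a +i* v) = 'i * (u - v)%:C :> C.
  by apply/eqP; rewrite eq_complex /=; apply/andP; split; apply/eqP; ring.
rewrite nrmM nrm_real.
have -> : nrm ('i : C) = 1.
  by rewrite nrmE /Normc.normc /= expr0n expr1n add0r sqrtr1.
by rewrite mul1r.
Qed.

Lemma leq_bin_exp n i : ('C(n, i) <= 2 ^ n)%N.
Proof.
have := Pascal 1 1 n; rewrite addn1 => ->.
case: (leqP i n) => [il|ni]; last by rewrite bin_small.
rewrite (bigD1 (Ordinal (il : (i < n.+1)%N)))//= !exp1n !muln1.
exact: leq_addr.
Qed.

(** Interpolate at [n + 1] points of the set with gaps of order [eta / n]: the
    factorials of [node_prod] compensate the powers of [n], and only a geometric
    factor is left. *)
Theorem remez_line (S : set R) (a eta D : R) : measurable S -> has_lbound S ->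
  0 < eta -> (eta%:E < mu S)%E -> 1 <= D ->
  exists2 Q, 2 <= Q & forall n (p : {poly C}) (m : R) z, (size p <= n.+1)%N ->
    (forall y, S y -> nrm p.[a +i* y] <= m) ->
    (forall y, S y -> nrm (z - (a +i* y)) <= D) ->
    nrm p.[z] <= expR 1 * m * Q ^+ n.
Proof.
move=> mS bS eta0 etaS D1.
have D0 : 0 < D by exact: lt_le_trans D1.
pose q := 8 * D * expR 1 / eta.
exists (Num.max 2 q); first by rewrite le_max lexx.
move=> n p m z sp pm zD.
have q0 : 0 < q by rewrite divr_gt0// !mulr_gt0// expR_gt0.
(* Then [n] gaps [2 * d] have total length less than [eta]. *)
pose d := eta / (2 * n.+1%:R).
have d0 : 0 < d by rewrite divr_gt0// mulr_gt0.
have dn : ((n%:R * (2 * d))%:E < mu S)%E.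
  apply: le_lt_trans etaS; rewrite lee_fin.
  have -> : n%:R * (2 * d) = eta * (n%:R / n.+1%:R) by rewrite /d; field.
  by rewrite ler_piMr ?(ltW eta0)// ler_pdivrMr// mul1r ler_nat.
have [y [yS yd]] := separated_points d0 mS bS dn.
pose x i : C := a +i* y i.
have ymono i j : (i < j)%N -> y i < y j.
  move=> ij; rewrite -subr_gt0 -(subnK ij).
  have : y i + d <= y (j - i.+1 + i.+1)%N.
    elim: (j - i.+1)%N => [|k IH]; first exact: yd.
    apply: (le_trans IH); apply: le_trans (yd _); rewrite lerDl ltW//.
  by move: d0; lra.
have m0 : 0 <= m by apply: le_trans (pm _ (yS 0%N (leq0n _))); exact: nrm_ge0.
have xinj i j : (i <= n)%N -> (j <= n)%N -> x i = x j -> i = j.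
  move=> _ _ [yij]; case: (ltngtP i j) => // /ymono.
    by rewrite yij ltxx.
  by rewrite yij ltxx.
have := lagrange_bound sp xinj (fun i il => pm _ (yS i il))
  (fun i il => zD _ (yS i il)).
move=> /le_trans; apply.
have term (i : 'I_n.+1) : m * (D ^+ n / \prod_(j < n.+1 | j != i :> nat) nrm (x i - x j))
    <= m * (D ^+ n * (2 ^+ n / (d ^+ n * n`!%:R))).
  rewrite ler_wpM2l// ler_wpM2l ?exprn_ge0 ?(ltW D0)//.
  have il : (i <= n)%N by rewrite -ltnS.
  have P := node_prod d0 yd il.
  have -> : \prod_(j < n.+1 | j != i :> nat) nrm (x i - x j) =
     \prod_(j < n.+1 | j != i :> nat) `|y i - y j|.
    by apply: eq_bigr => j _; exact: nrm_vline.
  have ff : 0 < (i`! * (n - i)`!)%:R :> R by rewrite ltr0n muln_gt0 !fact_gt0.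
  have dn0 : 0 < d ^+ n by rewrite exprn_gt0.
  have nf0 : 0 < n`!%:R :> R by rewrite ltr0n fact_gt0.
  have P0 : 0 < d ^+ n * (i`! * (n - i)`!)%:R by rewrite mulr_gt0.
  have P1 := lt_le_trans P0 P.
  apply: (@le_trans _ _ (d ^+ n * (i`! * (n - i)`!)%:R)^-1).
    by rewrite lef_pV2 ?posrE.
  rewrite ler_pdivlMr ?mulr_gt0// ler_pdivrMl//.
  have -> : d ^+ n * (i`! * (n - i)`!)%:R * 2 ^+ n =
    d ^+ n * (2 ^+ n * (i`! * (n - i)`!)%:R) by ring.
  rewrite ler_wpM2l ?(ltW dn0)// -natrX -natrM ler_nat.
  by rewrite -(bin_fact il) leq_mul2r leq_bin_exp orbT.
apply: (@le_trans _ _ (\sum_(i < n.+1) m * (D ^+ n * (2 ^+ n / (d ^+ n * n`!%:R))))).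
  by apply: ler_sum => i _; exact: term.
rewrite sumr_const card_ord -[_ *+ n.+1]mulr_natl.
have n1 : 0 < n.+1%:R :> R by rewrite ltr0n.
have nf : 0 < n`!%:R :> R by rewrite ltr0n fact_gt0.
have E : n.+1%:R ^+ n / n`!%:R <= expR 1 ^+ n.+1 :> R.
  have := @exp_ge_powfact R n.+1%:R n.+1 (ler0n _ _).
  rewrite factS natrM exprS -mulf_div divff ?gt_eqF// mul1r.
  by move=> /le_trans; apply; rewrite -expRM_natl mulr1.
have N2 : n.+1%:R <= 2 ^+ n :> R by rewrite -natrX ler_nat ltn_expl.
apply: (@le_trans _ _ (expR 1 * m * q ^+ n)); last first.
  have qQ : q <= Num.max 2 q by rewrite le_max lexx orbT.
  apply: ler_wpM2l; first by rewrite mulr_ge0 ?expR_ge0.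
  by apply: lerXn2r => //; rewrite nnegrE ?(ltW q0)// (le_trans (ltW q0)).
have -> : n.+1%:R * (m * (D ^+ n * (2 ^+ n / (d ^+ n * n`!%:R)))) =
   m * (D ^+ n * 2 ^+ n * 2 ^+ n / eta ^+ n) * (n.+1%:R * (n.+1%:R ^+ n / n`!%:R)).
  rewrite /d expr_div_n exprMn; field.
  by rewrite !expf_neq0 ?gt_eqF.
have -> : expR 1 * m * q ^+ n =
   m * (D ^+ n * 2 ^+ n * 2 ^+ n / eta ^+ n) * (2 ^+ n * expR 1 ^+ n.+1).
  rewrite /q expr_div_n !exprMn exprS.
  have -> : (8 : R) ^+ n = 2 ^+ n * 2 ^+ n * 2 ^+ n.
    by rewrite -!exprMn; congr (_ ^+ _); ring.
  by ring.
apply: ler_wpM2l.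
  rewrite mulr_ge0// mulr_ge0 ?invr_ge0 ?exprn_ge0 ?(ltW eta0)//.
  by rewrite !mulr_ge0 ?exprn_ge0 ?(ltW D0).
by apply: ler_pM => //; rewrite mulr_ge0 ?invr_ge0 ?exprn_ge0.
Qed.

End Nodes.

(** * Two constants *)

Section TwoConstants.
Context {R : realType}.
Local Notation C := (R[i]).
Local Notation mu := (@lebesgue_measure R).

(** Two constants: the Taylor polynomial of degree [n] is controlled by [m]
    through Remez, and the remainder by [W]; [n] balances the two errors. *)
Theorem two_constants (S : set R) (a L d : R) : measurable S ->
  (forall y, S y -> `|y| <= L) -> (0 < mu S)%E -> 0 <= d ->
  exists r A : R, 0 < A /\ forall (g : C -> C) (m W : R) z, entire g ->
    0 < m -> 0 < W -> (forall y, S y -> nrm (g (a +i* y)) <= m) ->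
    (forall w, nrm w <= r -> nrm (g w) <= W) -> nrm z <= d ->
    nrm (g z) ^+ 2 <= A * (m * W).
Proof.
move=> mS SL muS d0.
have [eta eta0 etaS] : exists2 eta : R, 0 < eta & (eta%:E < mu S)%E.
  move: muS; case: (mu S) => [x| |] // => [|_].
    rewrite lte_fin => x0; exists (x / 2); first by rewrite divr_gt0.
    by rewrite lte_fin ltr_pdivrMr// ltr_pMr// ltr1n.
  by exists 1 => //; rewrite ltry.
have bS : has_lbound S.
  by exists (- L) => y /SL; rewrite ler_norml => /andP[].
pose q := `|a| + `|L| + d + 1.
have q1 : 1 <= q by rewrite lerDr !addr_ge0.
have q0 : 0 < q by exact: lt_le_trans q1.
have Sq y : S y -> nrm (a +i* y) <= q.
  move=> /SL yL; rewrite (le_trans (nrm_le_ReIm _))//= /q.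
  by have := ler_norm L; lra.
have dq : d <= q by rewrite /q; have := normr_ge0 a; have := normr_ge0 L; lra.
have D1 : 1 <= 2 * q by lra.
have [Q Q2 HQ] := @remez_line R S a eta (2 * q) mS bS eta0 etaS D1.
have Q0 : 0 < Q by exact: lt_le_trans Q2.
(* Then the Remez factor [Q ^ n] is the square root of [l ^ n]. *)
pose l := Q ^+ 2.
have l4 : 4 <= l.
  have -> : 4 = 2 ^+ 2 :> R by ring.
  by apply: lerXn2r; rewrite ?nnegrE ?(ltW Q0).
have l0 : 0 < l by exact: lt_le_trans l4.
have l1 : 1 < l by apply: lt_le_trans l4; rewrite ltr1n.
pose E : R := 9 * expR 1 + 8.
have E1 : 1 <= E by rewrite /E; have := expR_ge0 (1 : R); lra.
have E0 : 0 < E by exact: lt_le_trans E1.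
have lE1 : 1 <= E ^+ 2 * l.
  by apply: mulr_ege1; [exact: exprn_ege1|exact: ltW].
exists (l * q), (E ^+ 2 * l); split; first by rewrite mulr_gt0// exprn_gt0.
move=> g m W z eg m0 W0 Hm HW zd.
have qlq : q < l * q by rewrite ltr_pMl.
have zq : nrm z <= q by exact: le_trans dq.
have [Wm|mW] := leP W m.
  have gW : nrm (g z) <= W by apply: HW; apply: (le_trans zq); exact: ltW.
  apply: (@le_trans _ _ (m * W)).
    by rewrite expr2; apply: ler_pM; rewrite ?nrm_ge0// (le_trans gW).
  by rewrite ler_peMl// mulr_ge0// ltW.
have exn : exists n, W * l^-1 ^+ n <= m.
  have /cvgrPdist_lt/(_ _ m0) : (W * (l^-1 ^+ n)) @[n --> \oo] --> 0.
    rewrite -(mulr0 W); apply: cvgM; first exact: cvg_cst.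
    by apply: cvg_expr; rewrite ger0_norm ?invr_ge0 ?(ltW l0)// invf_lt1.
  case=> n _ /(_ n (leqnn n)) /=; rewrite sub0r normrN ger0_norm.
    by exists n; exact: ltW.
  by rewrite mulr_ge0 ?(ltW W0)// exprn_ge0// invr_ge0 ltW.
pose n := ex_minn exn.
have [Hn minn] : W * l^-1 ^+ n <= m /\ forall k, W * l^-1 ^+ k <= m -> (n <= k)%N.
  by rewrite /n; case: ex_minnP.
clearbody n.
case: n Hn minn => [|n] Hn minn.
  by move: Hn; rewrite expr0 mulr1 leNgt mW.
have Hn' : m < W * l^-1 ^+ n.
  by rewrite ltNge; apply/negP => /minn; rewrite ltnn.
pose p := \poly_(k < n.+2) coef g k.
have pE w : p.[w] = \sum_(k < n.+2) coef g k * w ^+ k by rewrite horner_poly.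
have rem w : nrm w <= q -> nrm (g w - p.[w]) <= 8 * m.
  move=> wq; have wr : nrm w < l * q by exact: le_lt_trans qlq.
  rewrite pE; apply: le_trans (taylor_remainder n.+1 eg wr HW) _.
  have wl : nrm w / (l * q) <= l^-1.
    rewrite ler_pdivrMr ?mulr_gt0// mulrA mulVf ?gt_eqF// mul1r//.
  have wl0 : 0 <= nrm w / (l * q) by rewrite divr_ge0 ?nrm_ge0// mulr_ge0 ?ltW.
  have f2 : l * q / (l * q - nrm w) <= 2.
    rewrite ler_pdivrMr ?subr_gt0//.
    have : 2 * q <= l * q by rewrite ler_pM2r//; lra.
    by lra.
  have f0 : 0 <= l * q / (l * q - nrm w).
    apply: divr_ge0; last by rewrite subr_ge0 ltW.
    by apply: mulr_ge0; exact: ltW.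
  have P : (nrm w / (l * q)) ^+ n.+2 <= l^-1 ^+ n.+1.
    apply: (@le_trans _ _ (l^-1 ^+ n.+2)).
      by apply: lerXn2r => //; rewrite nnegrE// invr_ge0 ltW.
    rewrite [leLHS]exprS ler_piMl ?exprn_ge0 ?invr_ge0 ?(ltW l0)//.
    by rewrite invf_le1// ltW.
  apply: (@le_trans _ _ (4 * W * l^-1 ^+ n.+1 * 2)).
    apply: ler_pM => //.
      by rewrite mulr_ge0 ?exprn_ge0// mulr_ge0// ltW.
    by apply: ler_wpM2l => //; rewrite mulr_ge0// ltW.
  have -> : 4 * W * l^-1 ^+ n.+1 * 2 = 8 * (W * l^-1 ^+ n.+1) by ring.
  by apply: ler_wpM2l.
have pS y : S y -> nrm p.[a +i* y] <= 9 * m.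
  move=> Sy; have -> : p.[a +i* y] = g (a +i* y) - (g (a +i* y) - p.[a +i* y]).
    by rewrite opprB addrC subrK.
  apply: le_trans (nrmB _ _) _.
  have -> : 9 * m = m + 8 * m by ring.
  by apply: lerD; [exact: Hm|apply: rem; exact: Sq].
have zS y : S y -> nrm (z - (a +i* y)) <= 2 * q.
  move=> Sy; apply: le_trans (nrmB _ _) _.
  by rewrite mulrDl mul1r; apply: lerD => //; exact: Sq.
have := HQ n.+1 p (9 * m) z (size_poly _ _) pS zS => pz.
have gz : nrm (g z) <= E * m * Q ^+ n.+1.
  have -> : g z = p.[z] + (g z - p.[z]) by rewrite addrC subrK.
  apply: le_trans (nrmD _ _) _.
  have -> : E * m * Q ^+ n.+1 = expR 1 * (9 * m) * Q ^+ n.+1 + 8 * m * Q ^+ n.+1.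
    by rewrite /E; ring.
  apply: lerD => //; apply: le_trans (rem z zq) _.
  rewrite ler_peMr ?mulr_ge0 ?(ltW m0)// exprn_ege1//.
  by apply: le_trans Q2; rewrite ler1n.
apply: (@le_trans _ _ ((E * m * Q ^+ n.+1) ^+ 2)).
  apply: lerXn2r => //; rewrite nnegrE ?nrm_ge0//.
  exact: (le_trans (nrm_ge0 _) gz).
have QE : (Q ^+ n.+1) ^+ 2 = l * l ^+ n by rewrite -exprM mulnC exprM -exprS.
rewrite !exprMn QE.
have -> : E ^+ 2 * m ^+ 2 * (l * l ^+ n) = E ^+ 2 * l * (m * (m * l ^+ n)) by ring.
apply: ler_wpM2l; first by rewrite mulr_ge0 ?exprn_ge0// ltW.
rewrite ler_pM2l//; apply: ltW.
by move: Hn'; rewrite exprVn ltr_pdivlMr// exprn_gt0.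
Qed.

(** For equal orders the two types combine to their geometric mean. *)
Lemma mix_same_order (s T1 T2 T r : R) : 0 < s -> 0 < T1 -> 0 < T ->
  T ^+ 2 = T1 * T2 -> 0 < r ->
  exists r1 r2 : R, [/\ 0 < r1, 0 < r2, r1 * r2 = r ^+ 2 &
    T1 * r1 `^ s + T2 * r2 `^ s = 2 * T * r `^ s].
Proof.
move=> s0 T10 T0 TE r0.
have u0 : 0 < T / T1 by rewrite divr_gt0.
pose l := (T / T1) `^ s^-1.
have l0 : 0 < l by rewrite powR_gt0.
have ls : l `^ s = T / T1.
  by rewrite -powRrM mulVf ?gt_eqF// powRr1 ?ltW.
exists (r * l), (r / l); split; rewrite ?mulr_gt0 ?invr_gt0//.
  by field; rewrite gt_eqF.
rewrite (powRM _ (ltW r0) (ltW l0)) ls.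
have -> : (r / l) `^ s = r `^ s / (T / T1).
  apply: (mulIf (lt0r_neq0 u0)); rewrite divfK ?gt_eqF// -ls.
  by rewrite -powRM ?divfK ?gt_eqF ?divr_ge0 ?ltW.
have T2E : T2 = T ^+ 2 / T1 by rewrite TE mulrC mulKf ?gt_eqF.
rewrite T2E; field.
by rewrite !gt_eqF.
Qed.

(** For different orders the radii are chosen so that both terms have the same
    power of [r], whose exponent is the harmonic mean of the orders. *)
Lemma mix_orders (s1 s2 T1 T2 r : R) : 0 < s1 -> 0 < s2 -> 0 < r ->
  exists r1 r2 : R, [/\ 0 < r1, 0 < r2, r1 * r2 = r ^+ 2 &
    T1 * r1 `^ s1 + T2 * r2 `^ s2 =
      2 * ((T1 + T2) / 2) * r `^ (2 * s1 * s2 / (s1 + s2))].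
Proof.
move=> s10 s20 r0; have s120 : s1 + s2 != 0 by rewrite gt_eqF// addr_gt0.
exists (r `^ (2 * s2 / (s1 + s2))), (r `^ (2 * s1 / (s1 + s2))).
split; rewrite ?powR_gt0//.
  rewrite -powRD; last by rewrite (gt_eqF r0) implybT.
  by rewrite -powR_mulrn ?(ltW r0)//; congr powR; field.
rewrite -!powRrM.
have -> : 2 * s2 / (s1 + s2) * s1 = 2 * s1 * s2 / (s1 + s2) by field.
have -> : 2 * s1 / (s1 + s2) * s2 = 2 * s1 * s2 / (s1 + s2) by field.
by field.
Qed.

(** [two_constants] is applied to each coefficient, with one radius for the
    bounds on the line and another one for the global bounds; the product of the
    radii is prescribed. *)
Theorem line_improvement (c : nat -> C -> C) (S : set R) (a L d : R)
    (B1 s1 T1 s2 T2 s T : R) :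
  (forall k, entire (c k)) -> measurable S ->
  (forall y, S y -> `|y| <= L) -> (0 < mu S)%E -> 0 <= d ->
  (forall y, S y -> coef_le_growth (c ^~ (a +i* y)) B1 s1 T1) ->
  (forall r, exists B, forall z, nrm z <= r -> coef_le_growth (c ^~ z) B s2 T2) ->
  (forall r, 0 < r -> exists r1 r2, [/\ 0 < r1, 0 < r2, r1 * r2 = r ^+ 2 &
    T1 * r1 `^ s1 + T2 * r2 `^ s2 = 2 * T * r `^ s]) ->
  exists B, forall z, nrm z <= d -> coef_le_growth (c ^~ z) B s T.
Proof.
move=> ec mS SL muS d0 HS Hup Hmix.
have [q [A [A0 HA]]] := two_constants a mS SL muS d0.
have [B2 HB2] := Hup q.
pose b1 := `|B1| + 1; pose b2 := `|B2| + 1.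
have b10 : 0 < b1 by rewrite ltr_wpDl.
have b20 : 0 < b2 by rewrite ltr_wpDl.
have b1B : B1 <= b1 by rewrite (le_trans (ler_norm _))// lerDl.
have b2B : B2 <= b2 by rewrite (le_trans (ler_norm _))// lerDl.
exists (Num.sqrt (A * (b1 * b2))) => z zd k r r0.
have [r1 [r2 [r10 r20 rr rE]]] := Hmix r r0.
have k1 : 0 < r1 ^+ k by rewrite exprn_gt0.
have k2 : 0 < r2 ^+ k by rewrite exprn_gt0.
pose m := b1 * expR (T1 * r1 `^ s1) / r1 ^+ k.
pose W := b2 * expR (T2 * r2 `^ s2) / r2 ^+ k.
have m0 : 0 < m by rewrite divr_gt0// mulr_gt0// expR_gt0.
have W0 : 0 < W by rewrite divr_gt0// mulr_gt0// expR_gt0.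
have Hm y : S y -> nrm (c k (a +i* y)) <= m.
  move=> Sy; rewrite ler_pdivlMr//; apply: le_trans (HS y Sy k r1 r10) _.
  by rewrite ler_wpM2r ?expR_ge0.
have HW w : nrm w <= q -> nrm (c k w) <= W.
  move=> wq; rewrite ler_pdivlMr//; apply: le_trans (HB2 w wq k r2 r20) _.
  by rewrite ler_wpM2r ?expR_ge0.
have H := HA (c k) m W z (ec k) m0 W0 Hm HW zd.
have x0 : 0 <= nrm (c k z) * r ^+ k.
  by rewrite mulr_ge0 ?nrm_ge0// exprn_ge0// ltW.
have y0 : 0 <= A * (b1 * b2) by rewrite !mulr_ge0 ?ltW.
have x0' : nrm (c k z) * r ^+ k \is Num.nneg by rewrite nnegrE.
have y0' : Num.sqrt (A * (b1 * b2)) * expR (T * r `^ s) \is Num.nneg.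
  by rewrite nnegrE mulr_ge0 ?sqrtr_ge0// expR_ge0.
rewrite -(ler_pXn2r (ltn0Sn 1) x0' y0').
rewrite !exprMn sqr_sqrtr// -expRM_natl mulrA -rE expRD.
have -> : (r ^+ k) ^+ 2 = r1 ^+ k * r2 ^+ k.
  by rewrite -exprM mulnC exprM -rr exprMn.
apply: (@le_trans _ _ (A * (m * W) * (r1 ^+ k * r2 ^+ k))).
  by apply: ler_wpM2r => //; rewrite mulr_ge0// ltW.
rewrite le_eqVlt; apply/orP; left; apply/eqP; rewrite /m /W.
by field; rewrite !gt_eqF.
Qed.

End TwoConstants.

(** * Order and type as growth bounds *)

Section OrderType.
Context {R : realType}.
Local Notation C := (R[i]).
Implicit Types (g : C -> C) (A B r s T : R).

Lemma limf_esup_pinfty_lt (h : R -> \bar R) (y : \bar R) :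
  (limf_esup h +oo%R < y)%E -> exists A, forall r, A < r -> (h r < y)%E.
Proof.
rewrite limf_esupE => /ereal_inf_lt[_ [V [A [_ HA]] <-] Hy].
exists A => r Ar; apply: le_lt_trans Hy.
by apply: ereal_sup_ubound; exists r => //; exact: HA.
Qed.

Lemma limf_esup_pinfty_le (h : R -> \bar R) (y : \bar R) A :
  (forall r, A < r -> (h r <= y)%E) -> (limf_esup h +oo%R <= y)%E.
Proof.
move=> H; rewrite limf_esupE.
apply: (@le_trans _ _ (ereal_sup (h @` [set r | A < r]))).
  apply: ereal_inf_lbound; exists [set r | A < r] => //=.
  by exists A; split; [exact: num_real|].
by apply: ge_ereal_sup => _ [r Ar <-]; exact: H.
Qed.

Lemma max_modulus_le g r (M : R) : 0 <= r ->
  (forall w, nrm w = r -> nrm (g w) <= M) -> max_modulus g r <= M.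
Proof.
move=> r0 H; apply: sup_le_ub.
  exists (nrm (g r%:C)), r%:C; last by rewrite nrmE.
  by have := nrm_real r; rewrite nrmE ger0_norm.
by move=> _ [w wr <-]; rewrite -nrmE; apply: H; rewrite nrmE.
Qed.

Lemma max_modulus_ge g w : entire g -> nrm (g w) <= max_modulus g (nrm w).
Proof.
move=> eg; have [M HM] := entire_bounded (nrm w) eg.
apply: sup_upper_bound; last by exists w => /=; rewrite !nrmE.
split; first by exists (nrm (g w)), w => /=; rewrite !nrmE.
exists M => _ [v vw <-]; rewrite -nrmE; apply: HM.
by move: vw; rewrite /= -!nrmE => ->.
Qed.

Lemma growth_le_eventually g s T A : entire g -> 0 <= s ->
  (forall r, A < r -> max_modulus g r <= expR (T * r `^ s)) ->
  exists B, growth_le g B s T.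
Proof.
move=> eg s0 H; pose A' := `|A|.
have [M HM] := entire_bounded A' eg.
have M0 : 0 <= M by apply: le_trans (nrm_ge0 _) (HM 0 _); rewrite nrm0 normr_ge0.
exists (1 + M * expR (`|T| * A' `^ s)) => w.
have e0 := expR_ge0 (T * nrm w `^ s).
rewrite mulrDl mul1r; have [wA|wA] := leP (nrm w) A'; last first.
  apply: (@le_trans _ _ (expR (T * nrm w `^ s))).
    apply: le_trans (max_modulus_ge w eg) (H _ _).
    exact: le_lt_trans (ler_norm A) wA.
  by rewrite lerDl !mulr_ge0 ?expR_ge0.
apply: (le_trans (HM w wA)); apply: (@le_trans _ _ (M * expR (`|T| * A' `^ s) *
  expR (T * nrm w `^ s))); last by rewrite lerDr.
rewrite -mulrA -expRD ler_peMr// -expR0 ler_expR.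
have : nrm w `^ s <= A' `^ s by apply: powR_mono => //; exact: nrm_ge0.
have := powR_ge0 (nrm w) s; move: (nrm w `^ s) (A' `^ s) => x y x0 xy.
have : `|T| * x <= `|T| * y by rewrite ler_wpM2l.
have : - (`|T| * x) <= T * x.
  by rewrite -mulNr ler_wpM2r// lerNl -normrN ler_norm.
lra.
Qed.

Lemma growth_of_order g s : entire g -> 0 < s -> (growth_order g < s%:E)%E ->
  exists B, growth_le g B s 1.
Proof.
move=> eg s0 /limf_esup_pinfty_lt[A HA].
apply: (growth_le_eventually (A := Num.max A 2) eg (ltW s0)) => r.
rewrite gt_max => /andP[Ar r2]; have := HA r Ar; rewrite lte_fin mul1r.
have r0 : 0 < r by exact: lt_trans r2.
have lr : 0 < ln r by rewrite ln_gt0// (lt_trans _ r2)// ltr1n.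
rewrite ltr_pdivrMr// -ln_powR => h.
have [M0|M0] := leP (max_modulus g r) 0.
  by apply: (le_trans M0); exact: expR_ge0.
rewrite -[leLHS]lnK// ler_expR.
have [L0|L0] := leP (ln (max_modulus g r)) 0.
  by apply: (le_trans L0); exact: powR_ge0.
by apply: ltW; move: h; rewrite ltr_ln ?posrE// powR_gt0.
Qed.

Lemma ln_max_modulus_le g B s T r : 0 <= T -> growth_le g B s T -> 0 <= r ->
  ln (max_modulus g r) <= ln (1 + B) + T * r `^ s.
Proof.
move=> T0 H r0; have B0 := growth_le_ge0 H.
have b1 : 1 <= 1 + B by rewrite lerDl.
have b0 : 0 < 1 + B by exact: lt_le_trans b1.
have le0 : 0 <= ln (1 + B) + T * r `^ s.
  by rewrite addr_ge0 ?ln_ge0// mulr_ge0// powR_ge0.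
have [M0|M0] := leP (max_modulus g r) 0.
  by apply: le_trans le0; rewrite ln_le0// (le_trans M0).
rewrite -ler_expR (lnK M0) expRD (lnK b0); apply: max_modulus_le => // w wr.
apply: le_trans (H w) _; rewrite wr ler_wpM2r ?expR_ge0// lerDr//.
Qed.

Lemma order_of_growth g B s T : 0 < s -> 0 <= T -> growth_le g B s T ->
  (growth_order g <= s%:E)%E.
Proof.
move=> s0 T0 H; apply/lee_addgt0Pr => e e0; rewrite -EFinD.
pose c := ln (1 + B) + T.
pose A := Num.max 2 (`|c| `^ e^-1).
apply: (limf_esup_pinfty_le (A := A)) => r.
rewrite gt_max => /andP[r2 rc]; rewrite lee_fin.
have r1 : 1 < r by apply: lt_trans r2; rewrite ltr1n.
have r0 : 0 < r by exact: lt_trans r1.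
have lr : 0 < ln r by rewrite ln_gt0.
rewrite ler_pdivrMr// -ln_powR.
have rs : 1 <= r `^ (s + e).
  by rewrite -(powRr0 r) ler_powR ?(ltW r1)// ltW// addr_gt0.
have [L0|L0] := leP (ln (max_modulus g r)) 0.
  by rewrite (le_trans (ln_le0 _)) ?ln_ge0// (le_trans L0).
rewrite ler_ln ?posrE//; last exact: lt_le_trans rs.
apply: (le_trans (ln_max_modulus_le T0 H (ltW r0))).
have B0 := growth_le_ge0 H.
have l0 : 0 <= ln (1 + B) by rewrite ln_ge0// lerDl.
have rs1 : 1 <= r `^ s by rewrite -(powRr0 r) ler_powR ?(ltW r1)// ltW.
apply: (@le_trans _ _ (c * r `^ s)).
  by rewrite /c mulrDl lerD2r ler_peMr.
rewrite powRD; last by rewrite (gt_eqF r0) implybT.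
rewrite mulrC ler_wpM2l ?powR_ge0//.
apply: (le_trans (ler_norm c)).
have -> : `|c| = (`|c| `^ e^-1) `^ e.
  by rewrite -powRrM mulVf ?gt_eqF// powRr1.
by apply: powR_mono; [exact: ltW|exact: powR_ge0|exact: ltW].
Qed.

Lemma growth_of_type g s T : entire g -> 0 < s -> growth_order g = s%:E ->
  (growth_type g < T%:E)%E -> exists B, growth_le g B s T.
Proof.
move=> eg s0 os; rewrite /growth_type os /= => /limf_esup_pinfty_lt[A HA].
apply: (growth_le_eventually (A := Num.max A 1) eg (ltW s0)) => r.
rewrite gt_max => /andP[Ar r1]; have := HA r Ar; rewrite lte_fin.
have r0 : 0 < r by exact: lt_trans r1.
rewrite ltr_pdivrMr ?powR_gt0// => h.
have [M0|M0] := leP (max_modulus g r) 0.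
  by apply: (le_trans M0); exact: expR_ge0.
by rewrite -[leLHS]lnK// ler_expR ltW.
Qed.

Lemma type_of_growth g B s T : 0 < s -> 0 <= T -> growth_order g = s%:E ->
  growth_le g B s T -> (growth_type g <= T%:E)%E.
Proof.
move=> s0 T0 os H; rewrite /growth_type os /=.
apply/lee_addgt0Pr => e e0; rewrite -EFinD.
have B0 := growth_le_ge0 H.
have l0 : 0 <= ln (1 + B) by rewrite ln_ge0// lerDl.
apply: (limf_esup_pinfty_le (A := (ln (1 + B) / e) `^ s^-1)) => r rA.
have r0 : 0 < r by apply: le_lt_trans rA; exact: powR_ge0.
rewrite lee_fin ler_pdivrMr ?powR_gt0//.
apply: (le_trans (ln_max_modulus_le T0 H (ltW r0))).
rewrite mulrDl addrC lerD2l mulrC -ler_pdivrMr//.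
have -> : ln (1 + B) / e = ((ln (1 + B) / e) `^ s^-1) `^ s.
  by rewrite -powRrM mulVf ?gt_eqF// powRr1// divr_ge0// ltW.
by apply: powR_mono; [exact: ltW|exact: powR_ge0|exact: ltW].
Qed.

(** A negative type would make [g] bounded, hence of smaller order. *)
Lemma growth_type_ge0 g s : entire g -> 0 < s -> growth_order g = s%:E ->
  (0 <= growth_type g)%E.
Proof.
move=> eg s0 os; rewrite leNgt; apply/negP => t0.
have [B HB] := growth_of_type eg s0 os t0.
have B0 := growth_le_ge0 HB.
have H : growth_le g B (s / 2) 1.
  move=> w; apply: le_trans (HB w) _; rewrite mul0r expR0 ler_wpM2l//.
  by rewrite mul1r -expR0 ler_expR powR_ge0.
have := order_of_growth (divr_gt0 s0 (ltr0Sn _ 1)) ler01 H.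
by rewrite os lee_fin; lra.
Qed.

End OrderType.

(** * Exceptional sets in the plane *)

Section Measurability.
Context {R : realType}.
Local Notation C := (R[i]).
Local Notation mu := (@lebesgue_measure R).

Definition cplx (p : R * R) : C := p.1 +i* p.2.

Definition measurable_cfun (h : R * R -> C) : Prop :=
  measurable_fun setT (fun p => complex.Re (h p)) /\
  measurable_fun setT (fun p => complex.Im (h p)).

Lemma measurable_cfun_cst (k : C) : measurable_cfun (fun=> k).
Proof. by split; exact: measurable_cst. Qed.

Lemma measurable_cplx : measurable_cfun cplx.
Proof. by split; [exact: measurable_fst|exact: measurable_snd]. Qed.

Lemma measurable_cfunD (h k : R * R -> C) :
  measurable_cfun h -> measurable_cfun k -> measurable_cfun (fun p => h p + k p).
Proof.
move=> [h1 h2] [k1 k2]; split.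
  rewrite (_ : (fun p => complex.Re (h p + k p)) =
    (fun p => complex.Re (h p) + complex.Re (k p))).
    exact: measurable_funD.
  by apply/funext => p; rewrite raddfD.
rewrite (_ : (fun p => complex.Im (h p + k p)) =
  (fun p => complex.Im (h p) + complex.Im (k p))).
  exact: measurable_funD.
by apply/funext => p; rewrite raddfD.
Qed.

Lemma measurable_cfunM (h k : R * R -> C) :
  measurable_cfun h -> measurable_cfun k -> measurable_cfun (fun p => h p * k p).
Proof.
move=> [h1 h2] [k1 k2]; split.
  rewrite (_ : (fun p => complex.Re (h p * k p)) =
    (fun p => complex.Re (h p) * complex.Re (k p) -
              complex.Im (h p) * complex.Im (k p))).
    by apply: measurable_funB; exact: measurable_funM.
  by apply/funext => p; case: (h p); case: (k p).
rewrite (_ : (fun p => complex.Im (h p * k p)) =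
  (fun p => complex.Re (h p) * complex.Im (k p) +
            complex.Im (h p) * complex.Re (k p))).
  by apply: measurable_funD; exact: measurable_funM.
by apply/funext => p; case: (h p); case: (k p).
Qed.

Lemma measurable_partial_sum (a : nat -> C) n :
  measurable_cfun (fun p => \sum_(k < n) a k * cplx p ^+ k).
Proof.
have mX k : measurable_cfun (fun p => cplx p ^+ k).
  elim: k => [|k IH].
    rewrite (_ : (fun p => cplx p ^+ 0) = fun=> 1); first exact: measurable_cfun_cst.
    by apply/funext => p; rewrite expr0.
  rewrite (_ : (fun p => cplx p ^+ k.+1) = (fun p => cplx p * cplx p ^+ k)).
    by apply: measurable_cfunM => //; exact: measurable_cplx.
  by apply/funext => p; rewrite exprS.
elim: n => [|n IH].
  rewrite (_ : (fun p => \sum_(k < 0) a k * cplx p ^+ k) = fun=> 0); first exact: measurable_cfun_cst.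
  by apply/funext => p; rewrite big_ord0.
rewrite (_ : (fun p => \sum_(k < n.+1) a k * cplx p ^+ k) =
  (fun p => \sum_(k < n) a k * cplx p ^+ k + a n * cplx p ^+ n)).
  exact: (measurable_cfunD IH (measurable_cfunM (measurable_cfun_cst (a n)) (mX n))).
by apply/funext => p; rewrite big_ord_recr.
Qed.

Lemma taylor_cvg (g : C -> C) w : entire g ->
  (fun n => nrm (\sum_(k < n.+1) coef g k * w ^+ k)) @ \oo --> nrm (g w).
Proof.
move=> eg; set x := nrm w; have x0 : 0 <= x by exact: nrm_ge0.
pose r := 2 * x + 1.
have xr : x < r by rewrite /r; lra.
have r0 : 0 < r by rewrite /r; lra.
have [M HM] := entire_bounded r eg.
have M0 : 0 <= M by apply: le_trans (nrm_ge0 _) (HM 0 _); rewrite nrm0 ltW.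
have q1 : x / r < 1 by rewrite ltr_pdivrMr// mul1r.
have q0 : 0 <= x / r by rewrite divr_ge0// ltW.
apply/cvgrPdist_le => e e0.
have : (4 * M * (r / (r - x)) * (x / r) ^+ n) @[n --> \oo] --> 0.
  rewrite -(mulr0 (4 * M * (r / (r - x)))); apply: cvgM; first exact: cvg_cst.
  by apply: cvg_expr; rewrite ger0_norm.
move=> /cvgrPdist_lt/(_ _ e0)[N _ HN].
exists N => // n Nn.
have := HN n.+1 (leqW Nn); rewrite /= sub0r normrN => H.
have T := taylor_remainder n eg xr HM.
set P := \sum_(k < _) _ in T *.
apply: (@le_trans _ _ (nrm (g w - P))).
  rewrite ler_norml; have := nrmD (g w - P) P; rewrite subrK.
  have := nrmB (g w) (g w - P); rewrite opprB addrC subrK.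
  by lra.
apply: (le_trans T); apply/ltW; apply: le_lt_trans H.
apply: le_trans (ler_norm _).
by rewrite le_eqVlt; apply/orP; left; apply/eqP; rewrite -/x; ring.
Qed.

(** Pointwise limit of polynomials in the two coordinates. *)
Lemma measurable_entire_nrm (g : C -> C) : entire g ->
  measurable_fun setT (fun p : R * R => nrm (g (cplx p)) ^+ 2).
Proof.
move=> eg; pose P n (p : R * R) := \sum_(k < n.+1) coef g k * cplx p ^+ k.
have nE z : nrm z ^+ 2 = complex.Re z ^+ 2 + complex.Im z ^+ 2 :> R.
  case: z => u v; rewrite nrmE /Normc.normc sqr_sqrtr//.
  by rewrite addr_ge0// sqr_ge0.
apply: (@measurable_fun_cvg _ _ _ _ (fun n p => nrm (P n p) ^+ 2)).
  move=> n; have [m1 m2] := measurable_partial_sum (coef g) n.+1.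
  rewrite (_ : (fun p => nrm (P n p) ^+ 2) = (fun p =>
    complex.Re (P n p) ^+ 2 + complex.Im (P n p) ^+ 2)).
    by apply: measurable_funD; exact: measurable_funX.
  by apply/funext => p; rewrite nE.
move=> p _; have H := @taylor_cvg g (cplx p) eg.
exact: (cvgM H H).
Qed.

Lemma measurable_nrm_le (g : C -> C) (w : R) : entire g ->
  measurable [set p : R * R | nrm (g (cplx p)) <= w].
Proof.
move=> eg; have [w0|w0] := ltP w 0.
  rewrite (_ : [set p | _] = set0)//.
  apply/seteqP; split => // p /= h.
  by have := le_lt_trans h w0; rewrite ltNge nrm_ge0.
have mI : measurable (`]-oo, w ^+ 2]%classic : set R) by exact: measurable_itv.
have := measurable_entire_nrm eg measurableT mI; rewrite setTI.
rewrite (_ : _ @^-1` _ = [set p : R * R | nrm (g (cplx p)) <= w])//.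
apply/seteqP; split => p /=; rewrite in_itv /= => h.
  by move: h; rewrite ler_pXn2r// nnegrE ?nrm_ge0.
by apply: lerXn2r; rewrite ?nnegrE ?nrm_ge0.
Qed.

(** One inequality for each index, instead of one for each radius, exhibits the
    set of points that satisfy a bound as a countable intersection. *)
Lemma coef_le_growth_inf (c : nat -> C) (B s T : R) : 0 <= B ->
  coef_le_growth c B s T <->
  forall k, nrm (c k) <=
    inf [set B * expR (T * r `^ s) / r ^+ k | r in [set r | 0 < r]].
Proof.
move=> B0; split=> [H k|H k r r0].
  apply: lb_le_inf; first by exists (B * expR (T * 1 `^ s) / 1 ^+ k), 1 => //=; rewrite ltr01.
  by move=> _ [r /= r0 <-]; rewrite ler_pdivlMr ?exprn_gt0//; exact: H.
rewrite -ler_pdivlMr ?exprn_gt0//; apply: (le_trans (H k)).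
apply: inf_lbound; last by exists r.
exists 0 => _ [q /= q0 <-]; have q0' := ltW q0.
by rewrite !(divr_ge0, mulr_ge0, expR_ge0, exprn_ge0).
Qed.

Lemma growth_set_measurable (c : nat -> C -> C) (B s T : R) : 0 <= B ->
  (forall k, entire (c k)) ->
  measurable [set p : R * R | coef_le_growth (c ^~ (cplx p)) B s T].
Proof.
move=> B0 ec; rewrite (_ : [set p | _] = \bigcap_k [set p : R * R |
  nrm (c k (cplx p)) <= inf [set B * expR (T * r `^ s) / r ^+ k | r in [set r | 0 < r]]]).
  by apply: bigcapT_measurable => k; exact: measurable_nrm_le.
apply/seteqP; split => p /=.
  by move/(coef_le_growth_inf _ _ _ B0) => H k _; exact: H.
by move=> H; apply/(coef_le_growth_inf _ _ _ B0) => k; exact: H.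
Qed.

Lemma coef_le_growth_weaken (c : nat -> C) (B B' s T T' : R) :
  B <= B' -> T <= T' ->
  coef_le_growth c B s T -> coef_le_growth c B' s T'.
Proof.
move=> BB TT H k r r0; have B0 := coef_le_growth_ge0 H.
apply: le_trans (H k r r0) _; apply: ler_pM; [exact: B0|exact: expR_ge0|exact: BB|].
by apply: expR_powR_le => //; exact: ltW.
Qed.

Lemma lebesgue_positive_bounded (S : set R) : measurable S ->
  (forall L : R, mu (S `&` `[- L, L]) = 0%E) -> mu S = 0%E.
Proof.
move=> mS H; apply/negligibleP => //.
rewrite (_ : S = \bigcup_(n : nat) (S `&` `[- n%:R, n%:R])).
  apply: negligible_bigcup => n; apply/negligibleP.
    by apply: measurableI => //; exact: measurable_itv.
  exact: H.
apply/seteqP; split => [y Sy|y [n _ []]//].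
exists (Num.bound y) => //; split => //=; rewrite in_itv /= -ler_norml.
by rewrite ltW// ltr_norm_bound.
Qed.

(** By Fubini it suffices that every section by a vertical line is a null set. *)
Lemma growth_set_negligible (c : nat -> C -> C) (s T : R) :
  (forall k, entire (c k)) ->
  (forall (B a L : R) (S : set R), measurable S -> (forall y, S y -> `|y| <= L) ->
     (forall y, S y -> coef_le_growth (c ^~ (a +i* y)) B s T) -> ~ (0 < mu S)%E) ->
  (mu \x mu)%E.-negligible
    [set p : R * R | exists B, coef_le_growth (c ^~ (cplx p)) B s T].
Proof.
move=> ec H; rewrite (_ : [set p | _] = \bigcup_(n : nat)
  [set p : R * R | coef_le_growth (c ^~ (cplx p)) n%:R s T]); last first.
  apply/seteqP; split => [p|p [n _ Hn]]; last by exists n%:R.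
  case=> B Bp; exists (Num.bound B) => //.
  have B0 := coef_le_growth_ge0 Bp.
  by apply: coef_le_growth_weaken Bp => //; rewrite ltW// archi_boundP.
apply: negligible_bigcup => n.
have mA := @growth_set_measurable c n%:R s T (ler0n _ n) ec.
set A := [set p | _] in mA *.
have E x : mu (xsection A x) = 0%E.
  apply: lebesgue_positive_bounded; first exact: measurable_xsection.
  move=> L; apply/eqP; rewrite eq_le measure_ge0 andbT leNgt; apply/negP.
  apply: (H n%:R x L).
  - by apply: measurableI; [exact: measurable_xsection|exact: measurable_itv].
  - by move=> y [_]; rewrite /= in_itv /= -ler_norml.
  - by move=> y [/xsectionP].
apply/negligibleP => //.
have := @integral0_eq _ _ R mu setT (fun x => mu (xsection A x)) (fun x _ => E x).
by [].
Qed.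

End Measurability.

(** * Growth of the slices of a caloric function *)

#[local] Opaque growth_order growth_type.

Section ExtendedReals.
Context {R : realType}.
Implicit Types (m k : \bar R) (x y : R).

Lemma lee_add_pos m x : (forall e : R, 0 < e -> (m <= (x + e)%:E)%E) ->
  (m <= x%:E)%E.
Proof. by move=> H; apply/lee_addgt0Pr => e e0; rewrite -EFinD; exact: H. Qed.

Lemma ge_maxe m k l : (m <= l)%E -> (k <= l)%E -> (maxe m k <= l)%E.
Proof. by move=> ml kl; rewrite ge_max ml kl. Qed.

Lemma gt_maxe m k l : (maxe m k < l)%E -> (m < l)%E /\ (k < l)%E.
Proof. by rewrite gt_max => /andP[]. Qed.

Lemma le_maxe m k l : (l <= m)%E -> (l <= maxe m k)%E.
Proof. by move=> lm; rewrite le_max lm. Qed.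

Lemma ereal_between m x : (m < x%:E)%E -> 0 < x ->
  exists2 y, 0 < y < x & (m < y%:E)%E.
Proof.
case: m => [m| |]// mx x0; last first.
  by exists (x / 2); [lra|rewrite ltNyr].
rewrite lte_fin in mx; exists (Num.max (x / 2) ((m + x) / 2)).
  rewrite lt_max gt_max; apply/andP; split; last by apply/andP; split; lra.
  by apply/orP; left; lra.
by rewrite lte_fin lt_max; apply/orP; right; lra.
Qed.

Lemma exists_fraction m x : (m < x%:E)%E -> 0 < x ->
  exists j : nat, (m < (x * (1 - j.+2%:R^-1))%:E)%E.
Proof.
case: m => [m| |]// mx x0; last by exists 0%N; rewrite ltNyr.
rewrite lte_fin in mx; have xm : 0 < x - m by rewrite subr_gt0.
have h := archi_boundP (ltW (divr_gt0 x0 xm)).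
exists (Num.bound (x / (x - m))); rewrite lte_fin.
set n := Num.bound _ in h *.
have n0 : 0 < n.+2%:R :> R by rewrite ltr0n.
rewrite mulrBr mulr1 ltrBrDr -ltrBrDl ltr_pdivrMr//.
rewrite mulrC -ltr_pdivrMr//; apply: (lt_le_trans h).
by rewrite ler_nat -addn2 leq_addr.
Qed.

End ExtendedReals.

Section CaloricGrowth.
Context {R : realType}.
Local Notation C := (R[i]).
Local Notation mu := (@lebesgue_measure R).
Variable F : C * C -> C.
Hypotheses (eF : entire2 F) (hF : heat_equation F).
Variable rho : R.
Hypotheses (Hrho : z_order F = rho%:E) (rho02 : 0 < rho < 2).
Local Notation f := (slice_z F 0).
Local Notation b := (tcoef F).
Local Notation b1 := (tcoef1 F).
Local Notation K := (caloric_type rho).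
Implicit Types (B d s T x : R) (z : C).

Let sigma : R := rho / (2 - rho).
Let rho_gt0 : 0 < rho. Proof. by case/andP: rho02. Qed.
Let rho_lt2 : 0 < 2 - rho. Proof. by case/andP: rho02 => _; rewrite subr_gt0. Qed.
Let sigma_gt0 : 0 < sigma. Proof. by rewrite divr_gt0. Qed.
Let ef : entire f. Proof. exact: (entire_slice_z eF (t := 0)). Qed.

(* inverse of [rho |-> rho / (2 - rho)] *)
Let zord s := 2 * s / (1 + s).

Let zordP s : 0 < s -> 0 < zord s < 2 /\ zord s / (2 - zord s) = s.
Proof.
move=> s0; have s1 : 0 < 1 + s by rewrite addr_gt0.
split; last first.
  have n1 : 1 + s != 0 by rewrite gt_eqF.
  have -> : 2 - zord s = 2 / (1 + s) by rewrite /zord; field.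
  by rewrite /zord; field.
rewrite divr_gt0 ?mulr_gt0//= ltr_pdivrMr// mulrDr mulr1; lra.
Qed.

Let zord_lt s s' : 0 < s -> s < s' -> zord s < zord s'.
Proof.
move=> s0 ss'; have s1 : 0 < 1 + s by rewrite addr_gt0.
have s'1 : 0 < 1 + s' by rewrite addr_gt0// (lt_trans s0).
by rewrite /zord ltr_pdivrMr// mulrAC ltr_pdivlMr//; nra.
Qed.

Let zord_sigma : zord sigma = rho.
Proof.
have n1 : 2 - rho != 0 by rewrite gt_eqF.
have -> : zord sigma = 2 * sigma / (2 / (2 - rho)).
  by rewrite /zord; congr (_ / _); rewrite /sigma; field.
by rewrite /sigma; field.
Qed.

Let both_le z B s T : Prop :=
  coef_le_growth (b ^~ z) B s T /\ coef_le_growth (b1 ^~ z) B s T.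

Lemma tcoef_upper_order s : sigma < s -> exists2 T, 0 < T &
  forall d, 0 <= d -> exists B, forall z, nrm z <= d -> both_le z B s T.
Proof.
move=> ss; have s0 : 0 < s by exact: lt_trans ss.
have [zo02 zoE] := zordP s0.
have lt : (growth_order f < (zord s)%:E)%E.
  by rewrite -/(z_order F) Hrho lte_fin -zord_sigma zord_lt.
have zo0 : 0 < zord s by case/andP: zo02.
have [B HB] := growth_of_order ef zo0 lt.
exists (caloric_type (zord s) 2); first exact: caloric_type_gt0.
move=> d d0.
have := heat_growth_up eF hF zo02 ltr01 (ltr1n R 2) d0 HB.
by rewrite zoE.
Qed.

Lemma tcoef_upper_type T T' : 0 < T -> T < T' -> (z_type F < T%:E)%E ->
  forall d, 0 <= d -> exists B, forall z, nrm z <= d -> both_le z B sigma (K T').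
Proof.
move=> T0 TT' tT d d0.
have [B HB] := growth_of_type ef rho_gt0 Hrho tT.
exact: (heat_growth_up eF hF rho02 T0 TT' d0 HB).
Qed.

Lemma tcoef_lower_order z B s T : 0 < s -> s < sigma -> 0 < T ->
  both_le z B s T -> False.
Proof.
move=> s0 ss T0 [H0 H1]; have [zo02 zoE] := zordP s0.
have zo0 : 0 < zord s by case/andP: zo02.
have [T1 T10 TE] := caloric_type_surj zo02 T0.
have T12 : T1 < T1 + 1 by rewrite ltrDl.
rewrite -zoE -TE in H0 H1.
have [B' HB'] := heat_growth_down eF hF zo02 T10 T12 H0 H1.
have T20 : 0 <= T1 + 1 by rewrite addr_ge0// ltW.
have := order_of_growth zo0 T20 HB'.
by rewrite -/(z_order F) Hrho lee_fin leNgt -zord_sigma zord_lt.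
Qed.

Lemma tcoef_lower_type z B T : 0 < T -> both_le z B sigma (K T) ->
  (z_type F <= T%:E)%E.
Proof.
move=> T0 [H0 H1]; apply: lee_add_pos => e e0.
have Te : T < T + e by rewrite ltrDl.
have [B' HB'] := heat_growth_down eF hF rho02 T0 Te H0 H1.
apply: type_of_growth HB' => //.
by rewrite addr_ge0// ltW.
Qed.

Lemma tcoef_of_growth z B s T : growth_le (slice_t F z) B s T ->
  coef_le_growth (b ^~ z) (2 * B) s T.
Proof. exact: growth_le_coef (entire_slice_t eF (z := z)). Qed.

Lemma tcoef1_of_growth z B s T : growth_le (fun t => dz F t z) B s T ->
  coef_le_growth (b1 ^~ z) (2 * B) s T.
Proof. exact: growth_le_coef (entire_dz eF (z := z)). Qed.

Lemma both_of_growth z B B' s T : growth_le (slice_t F z) B s T ->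
  growth_le (fun t => dz F t z) B' s T -> exists B'', both_le z B'' s T.
Proof.
move=> /tcoef_of_growth H0 /tcoef1_of_growth H1.
exists (Num.max (2 * B) (2 * B')); split.
  by apply: coef_le_growth_weaken H0 => //; rewrite le_max lexx.
by apply: coef_le_growth_weaken H1 => //; rewrite le_max lexx orbT.
Qed.

Lemma t_order_le z : (t_order0 F z <= sigma%:E)%E /\ (t_order1 F z <= sigma%:E)%E.
Proof.
suff H e : 0 < e -> (t_order0 F z <= (sigma + e)%:E)%E /\
    (t_order1 F z <= (sigma + e)%:E)%E.
  by split; apply: lee_add_pos => e /H[].
move=> e0; have se : sigma < sigma + e by rewrite ltrDl.
have [T T0 HT] := tcoef_upper_order se.
have s0 : 0 < sigma + e by rewrite addr_gt0.
have T12 : T < T + 1 by rewrite ltrDl.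
have T20 : 0 <= T + 1 by rewrite addr_ge0// ltW.
have [B HB] := HT _ (nrm_ge0 z).
have [B0 H0] := tcoef_growth_le eF s0 T0 T12 (fun w wz => proj1 (HB w wz)).
have [B1 H1] := tcoef1_growth_le eF s0 T0 T12 (fun w wz => proj2 (HB w wz)).
by split; apply: order_of_growth s0 T20 _; [exact: H0|exact: H1].
Qed.

(** If both slices had order less than [sigma], the converse estimate would bound
    the [z]-order below [rho]. *)
Lemma caloric_t_orderE z : caloric_t_order F z = sigma%:E.
Proof.
have [le0 le1] := t_order_le z.
apply: le_anti; apply/andP; split; first exact: ge_maxe.
rewrite leNgt; apply/negP => lt.
have [s /andP[s0 ss]] := ereal_between lt sigma_gt0.
move=> /gt_maxe[lt0 lt1].
have [B HB] := growth_of_order (entire_slice_t eF (z := z)) s0 lt0.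
have [B' HB'] := growth_of_order (entire_dz eF (z := z)) s0 lt1.
have [B'' H] := both_of_growth HB HB'.
exact: tcoef_lower_order s0 ss ltr01 H.
Qed.

Lemma z_type_ge0 : (0 <= z_type F)%E.
Proof. exact: growth_type_ge0 ef rho_gt0 Hrho. Qed.

Lemma t_type_le x z : 0 <= x -> z_type F = x%:E ->
  (t_order0 F z = sigma%:E -> (t_type0 F z <= (K x)%:E)%E) /\
  (t_order1 F z = sigma%:E -> (t_type1 F z <= (K x)%:E)%E).
Proof.
move=> x0 tx.
have Kx0 : 0 <= K x.
  rewrite !mulr_ge0 ?powR_ge0// subr_ge0 ler_pdivrMr// mul1r ltW//.
  by rewrite -subr_gt0.
suff H e : 0 < e ->
    (t_order0 F z = sigma%:E -> (t_type0 F z <= (K x + e)%:E)%E) /\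
    (t_order1 F z = sigma%:E -> (t_type1 F z <= (K x + e)%:E)%E).
  by split=> o; apply: lee_add_pos => e /H[h0 h1]; [exact: h0|exact: h1].
move=> e0; have Ke : 0 < K x + e by rewrite ltr_wpDl.
have [T T0 KT] := caloric_type_surj rho02 Ke.
have xT : x < T.
  rewrite ltNge; apply/negP; rewrite le_eqVlt => /orP[/eqP Tx|Tx].
    by move: KT; rewrite Tx => /eqP; rewrite eq_sym -subr_eq0 addrC addKr gt_eqF.
  have := caloric_type_lt rho02 (ltW T0) Tx; rewrite KT; lra.
pose T1 := (2 * x + T) / 3; pose T2 := (x + 2 * T) / 3.
have T10 : 0 < T1 by rewrite /T1; lra.
have T12 : T1 < T2 by rewrite /T1 /T2; lra.
have T2T : T2 < T by rewrite /T2; lra.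
have T20 : 0 < T2 by exact: lt_trans T12.
have tT1 : (z_type F < T1%:E)%E by rewrite tx lte_fin /T1; lra.
have [B HB] := tcoef_upper_type T10 T12 tT1 (nrm_ge0 z).
have KT2 := caloric_type_gt0 rho02 T20.
have KT2T := caloric_type_lt rho02 (ltW T20) T2T.
have [B0 H0] := tcoef_growth_le eF sigma_gt0 KT2 KT2T (fun w wz => proj1 (HB w wz)).
have [B1 H1] := tcoef1_growth_le eF sigma_gt0 KT2 KT2T (fun w wz => proj2 (HB w wz)).
rewrite -KT; have KT0 : 0 <= K T by rewrite ltW// caloric_type_gt0.
split=> o.
  exact: type_of_growth sigma_gt0 KT0 o (H0 z (lexx _)).
exact: type_of_growth sigma_gt0 KT0 o (H1 z (lexx _)).
Qed.

Lemma z_type_le z T : t_order0 F z = sigma%:E -> t_order1 F z = sigma%:E ->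
  0 < T -> (caloric_t_type F z < (K T)%:E)%E -> (z_type F <= T%:E)%E.
Proof.
move=> o0 o1 T0 /gt_maxe[t0 t1].
have [B HB] := growth_of_type (entire_slice_t eF (z := z)) sigma_gt0 o0 t0.
have [B' HB'] := growth_of_type (entire_dz eF (z := z)) sigma_gt0 o1 t1.
have [B'' H] := both_of_growth HB HB'.
exact: tcoef_lower_type T0 H.
Qed.

Lemma caloric_t_typeE_fin x z : 0 <= x -> z_type F = x%:E ->
  t_order0 F z = sigma%:E -> t_order1 F z = sigma%:E ->
  caloric_t_type F z = (K x)%:E.
Proof.
move=> x0 tx o0 o1; have [le0 le1] := t_type_le z x0 tx.
apply: le_anti; apply/andP; split; first exact: (ge_maxe (le0 o0) (le1 o1)).
have ge0 : (0 <= caloric_t_type F z)%E.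
  apply: le_maxe.
  exact: growth_type_ge0 (entire_slice_t eF (z := z)) sigma_gt0 o0.
rewrite leNgt; apply/negP => lt.
have Kx0 : 0 < K x by rewrite -lte_fin; exact: le_lt_trans lt.
have [y /andP[y0 yK] ty] := ereal_between lt Kx0.
have [T T0 KT] := caloric_type_surj rho02 y0.
rewrite -KT in ty; have := z_type_le o0 o1 T0 ty; rewrite tx lee_fin => xT.
have : K x <= K T.
  move: xT; rewrite le_eqVlt => /orP[/eqP -> //|xT].
  by apply: ltW; exact: caloric_type_lt.
by rewrite KT leNgt yK.
Qed.

Lemma caloric_t_typeE_pinfty z : z_type F = +oo%E ->
  t_order0 F z = sigma%:E -> t_order1 F z = sigma%:E ->
  caloric_t_type F z = +oo%E.
Proof.
move=> tx o0 o1.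
have ge0 : (0 <= caloric_t_type F z)%E.
  apply: le_maxe.
  exact: growth_type_ge0 (entire_slice_t eF (z := z)) sigma_gt0 o0.
case E : (caloric_t_type F z) ge0 => [y| |]// y0.
have [T T0 KT] : exists2 T, 0 < T & K T = y + 1.
  by apply: caloric_type_surj => //; rewrite ltr_wpDl// -lee_fin.
have lt : (caloric_t_type F z < (K T)%:E)%E by rewrite E KT lte_fin ltrDl.
by have := z_type_le o0 o1 T0 lt; rewrite tx leye_eq.
Qed.

(** By the heat equation the derivative of [tcoef1 k] is [k + 1] times
    [tcoef k.+1], so Cauchy's estimate applies; the shift of the index costs a
    factor [r]. *)
Lemma tcoef_of_tcoef1 B s T T' : 0 < s -> 0 < T -> T < T' ->
  (forall z, nrm z <= 1 -> coef_le_growth (b1 ^~ z) B s T) ->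
  exists B', coef_le_growth (b ^~ 0) B' s T'.
Proof.
move=> s0 T0 TT' H; have e0 : 0 < T' - T by rewrite subr_gt0.
have [L L0 HL] := linear_le_exp s0 e0.
have B0 : 0 <= B by apply: (coef_le_growth_ge0 (H 0 _)); rewrite nrm0.
exists (nrm (b 0 0) + 2 * B * L); case=> [|k] r r0.
  rewrite expr0 mulr1.
  apply: (@le_trans _ _ (nrm (b 0 0) + 2 * B * L)).
    by rewrite lerDl !mulr_ge0// ltW.
  rewrite ler_peMr//; first by rewrite addr_ge0 ?nrm_ge0// !mulr_ge0// ltW.
  rewrite -expR0 ler_expR mulr_ge0 ?powR_ge0// ltW//.
  exact: lt_trans TT'.
apply: (@le_trans _ _ (2 * B * L * expR (T' * r `^ s))); last first.
  by rewrite ler_wpM2r ?expR_ge0// lerDr nrm_ge0.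
have r' : 0 < r ^+ k by rewrite exprn_gt0.
have D : nrm ('D_1 (b1 k) 0) <= 2 * (B * expR (T * r `^ s) / r ^+ k).
  apply: derive_le; first exact: entire_tcoef1.
  move=> h h1; rewrite add0r ler_pdivlMr//; apply: H => //.
  by rewrite h1.
have {}D : nrm (b k.+1 0) <= 2 * (B * expR (T * r `^ s) / r ^+ k).
  apply: le_trans D; rewrite (derive_tcoef1 eF hF) nrmM nrm_nat.
  by rewrite ler_peMl ?nrm_ge0// ler1n.
apply: (@le_trans _ _ (2 * B * expR (T * r `^ s) * r)).
  have -> : 2 * B * expR (T * r `^ s) * r =
     2 * (B * expR (T * r `^ s) / r ^+ k) * (r ^+ k.+1).
    by rewrite exprS; field; rewrite gt_eqF.
  by rewrite ler_wpM2r// exprn_ge0// ltW.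
have -> : expR (T' * r `^ s) = expR (T * r `^ s) * expR ((T' - T) * r `^ s).
  by rewrite -expRD -mulrDl subrKC.
have -> : 2 * B * L * (expR (T * r `^ s) * expR ((T' - T) * r `^ s)) =
  2 * B * expR (T * r `^ s) * (L * expR ((T' - T) * r `^ s)) by ring.
rewrite ler_wpM2l ?mulr_ge0 ?expR_ge0//.
by apply: HL; exact: ltW.
Qed.

(** If bounds of order [s] and type [T] mixed with the global ones would beat
    the lower bound, then they hold almost nowhere. *)
Lemma small_growth_negligible s T s2 T2 s' T' T'' :
  (forall d, 0 <= d -> exists B, forall z, nrm z <= d -> both_le z B s2 T2) ->
  (forall r, 0 < r -> exists r1 r2, [/\ 0 < r1, 0 < r2, r1 * r2 = r ^+ 2 &
    T * r1 `^ s + T2 * r2 `^ s2 = 2 * T' * r `^ s']) ->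
  0 < s' -> 0 < T' -> T' < T'' ->
  (forall z B, ~ both_le z B s' T'') ->
  (mu \x mu)%E.-negligible
    [set p : R * R | exists B, coef_le_growth (b ^~ (cplx p)) B s T] /\
  (mu \x mu)%E.-negligible
    [set p : R * R | exists B, coef_le_growth (b1 ^~ (cplx p)) B s T].
Proof.
move=> Hup Hmix s'0 T'0 T'T'' Hlow.
have up (c : nat -> C -> C) :
    (forall z B, both_le z B s2 T2 -> coef_le_growth (c ^~ z) B s2 T2) ->
    forall r, exists B, forall z, nrm z <= r -> coef_le_growth (c ^~ z) B s2 T2.
  move=> Hc r; have [B HB] := Hup `|r| (normr_ge0 r).
  exists B => z zr; apply/Hc/HB; exact: le_trans (ler_norm r).
split.
  apply: growth_set_negligible; first exact: entire_tcoef.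
  move=> B a L S mS SL HS muS.
  have [B' HB'] := line_improvement (entire_tcoef eF) mS SL muS ler01 HS
    (up b (fun z B h => proj1 h)) Hmix.
  have HB1 z : nrm z <= 0 -> coef_le_growth (b1 ^~ z) (2 * B') s' T'.
    by apply: tcoef1_le => // w; rewrite add0r; exact: HB'.
  have n0 : nrm (0 : C) <= 0 by rewrite nrm0.
  have n01 : nrm (0 : C) <= 1 by rewrite nrm0.
  have B'0 := coef_le_growth_ge0 (HB' _ n01).
  apply: (Hlow 0 (2 * B')); split.
    apply: coef_le_growth_weaken (HB' _ n01); last exact: ltW.
    by rewrite ler_peMl// ler1n.
  by apply: coef_le_growth_weaken (HB1 _ n0) => //; exact: ltW.
apply: growth_set_negligible; first exact: entire_tcoef1.
move=> B a L S mS SL HS muS.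
have [B' HB'] := line_improvement (entire_tcoef1 eF hF) mS SL muS ler01 HS
  (up b1 (fun z B h => proj2 h)) Hmix.
have [B'' HB''] := tcoef_of_tcoef1 s'0 T'0 T'T'' HB'.
have n01 : nrm (0 : C) <= 1 by rewrite nrm0.
apply: (Hlow 0 (Num.max B' B'')); split.
  by apply: coef_le_growth_weaken HB'' => //; rewrite le_max lexx orbT.
apply: coef_le_growth_weaken (HB' _ n01); last exact: ltW.
by rewrite le_max lexx.
Qed.

(** A type [T] smaller than the maximal one is mixed with a global type [T2] so
    close to the maximal one that the geometric mean [T'] remains smaller. *)
Lemma small_type_negligible x T : 0 <= x -> z_type F = x%:E -> 0 < T -> T < K x ->
  (mu \x mu)%E.-negligible
    [set p : R * R | exists B, coef_le_growth (b ^~ (cplx p)) B sigma T] /\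
  (mu \x mu)%E.-negligible
    [set p : R * R | exists B, coef_le_growth (b1 ^~ (cplx p)) B sigma T].
Proof.
move=> x0 tx T0 TK; have K0 : 0 < K x by exact: lt_trans TK.
pose m := (T + K x) / 2.
have m0 : 0 < m by rewrite /m; lra.
have mK : m < K x by rewrite /m; lra.
have Tm : T < m by rewrite /m; lra.
pose T2 := K x ^+ 2 / m.
have KT2 : K x < T2 by rewrite ltr_pdivlMr// expr2 ltr_pM2l.
have T20 : 0 < T2 by exact: lt_trans KT2.
pose T' := Num.sqrt (T * T2).
have T'0 : 0 < T' by rewrite sqrtr_gt0 mulr_gt0.
have T'E : T' ^+ 2 = T * T2 by rewrite sqr_sqrtr// mulr_ge0// ltW.
have T'K : T' < K x.
  rewrite -(ltr_pXn2r (ltn0Sn 1)) ?nnegrE ?(ltW T'0) ?(ltW K0)// T'E /T2.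
  by rewrite mulrA ltr_pdivrMr// mulrC ltr_pM2l// exprn_gt0.
have [U U0 KU] := caloric_type_surj rho02 T20.
have xU : x < U.
  rewrite ltNge; apply/negP; rewrite le_eqVlt => /orP[/eqP Ux|Ux].
    by move: KT2; rewrite -KU Ux ltxx.
  by have := caloric_type_lt rho02 (ltW U0) Ux; rewrite KU; lra.
pose T'' := (T' + K x) / 2.
have T'T'' : T' < T'' by rewrite /T''; lra.
have T''K : T'' < K x by rewrite /T''; lra.
have T''0 : 0 < T'' by exact: lt_trans T'T''.
have [V V0 KV] := caloric_type_surj rho02 T''0.
have Vx : V < x.
  rewrite ltNge; apply/negP; rewrite le_eqVlt => /orP[/eqP Ux|Ux].
    by move: T''K; rewrite -KV -Ux ltxx.
  by have := caloric_type_lt rho02 x0 Ux; rewrite KV; lra.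
pose U1 := (x + U) / 2.
have U10 : 0 < U1 by rewrite /U1; lra.
have U1U : U1 < U by rewrite /U1; lra.
have tU1 : (z_type F < U1%:E)%E by rewrite tx lte_fin /U1; lra.
apply: (@small_growth_negligible sigma T sigma T2 sigma T' T'') => //.
- by rewrite -KU; exact: tcoef_upper_type U10 U1U tU1.
- by move=> r r0; exact: mix_same_order.
- move=> z B; rewrite -KV => /(tcoef_lower_type V0).
  by rewrite tx lee_fin leNgt Vx.
Qed.

(** As for types, with the harmonic mean of [s] and of some [s2 > sigma]; the
    bound [sigma / 2 <= s] makes [s2] positive. *)
Lemma small_order_negligible s : sigma / 2 <= s -> s < sigma ->
  (mu \x mu)%E.-negligible
    [set p : R * R | exists B, coef_le_growth (b ^~ (cplx p)) B s 1] /\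
  (mu \x mu)%E.-negligible
    [set p : R * R | exists B, coef_le_growth (b1 ^~ (cplx p)) B s 1].
Proof.
move=> ss s_lt; have s0 : 0 < s by have := sigma_gt0; move: ss; lra.
have d0 : 0 < 3 * s - sigma by have := sigma_gt0; move: ss; lra.
(* [1 / s2] is [1 / sigma] minus half of [1 / s - 1 / sigma]. *)
pose s2 := 2 * s * sigma / (3 * s - sigma).
have s2s : sigma < s2.
  rewrite ltr_pdivlMr// mulrC ltr_pM2r//; move: s_lt; lra.
have s20 : 0 < s2 by exact: lt_trans s2s.
have s'E : 2 * s * s2 / (s + s2) = 4 * s * sigma / (3 * s + sigma).
  have n1 : s != 0 by rewrite gt_eqF.
  have n2 : 3 * s - sigma != 0 by rewrite gt_eqF.
  have n3 : 3 * s + sigma != 0 by rewrite gt_eqF// addr_gt0// mulr_gt0.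
  have -> : s + s2 = s * (3 * s + sigma) / (3 * s - sigma) by rewrite /s2; field.
  by rewrite /s2; field; rewrite ?n1 ?n2 ?n3.
have s'0 : 0 < 2 * s * s2 / (s + s2).
  by apply: divr_gt0; [rewrite mulr_gt0// mulr_gt0|rewrite addr_gt0].
have s's : 2 * s * s2 / (s + s2) < sigma.
  rewrite s'E ltr_pdivrMr; last by rewrite addr_gt0// mulr_gt0.
  by rewrite mulrC ltr_pM2l//; move: s_lt; lra.
have [T2 T20 HT2] := tcoef_upper_order s2s.
have T'0 : 0 < (1 + T2) / 2 by rewrite divr_gt0// addr_gt0.
apply: (@small_growth_negligible s 1 s2 T2 (2 * s * s2 / (s + s2))
   ((1 + T2) / 2) ((1 + T2) / 2 + 1)) => //.
- by move=> r r0; exact: mix_orders.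
- by rewrite ltrDl.
- by move=> z B; apply: tcoef_lower_order => //; rewrite addr_gt0.
Qed.

Lemma growth_le_order (g : C -> C) B s T : 0 < s -> s < sigma -> 0 < T ->
  growth_le g B s 1 -> exists B', growth_le g B' sigma T.
Proof.
move=> s0 ss T0 H; have B0 := growth_le_ge0 H.
(* Beyond radius [c], order [sigma] and type [T] dominate order [s]. *)
pose c := T^-1 `^ (sigma - s)^-1.
have c0 : 0 <= c by exact: powR_ge0.
exists (B * expR (c `^ s)) => w; apply: le_trans (H w) _.
rewrite -mulrA ler_wpM2l// -expRD ler_expR mul1r.
have n0 := nrm_ge0 w; have [wc|wc] := leP (nrm w) c.
  apply: (@le_trans _ _ (c `^ s)); first by apply: powR_mono => //; exact: ltW.
  by rewrite lerDl mulr_ge0 ?powR_ge0// ltW.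
apply: (@le_trans _ _ (T * nrm w `^ sigma)); last by rewrite lerDr powR_ge0.
have w0 : 0 < nrm w by exact: le_lt_trans wc.
have -> : nrm w `^ sigma = nrm w `^ s * nrm w `^ (sigma - s).
  by rewrite -powRD ?subrKC// (gt_eqF w0) implybT.
rewrite mulrCA ler_peMr ?powR_ge0// -ler_pdivrMl// mulr1.
have ss0 : 0 < sigma - s by rewrite subr_gt0.
have -> : T^-1 = c `^ (sigma - s).
  by rewrite -powRrM mulVf ?gt_eqF// powRr1// invr_ge0 ltW.
by apply: powR_mono; [exact: ltW|exact: c0|exact: ltW].
Qed.

(** A point where the growth is not maximal satisfies one bound of a countable
    family, of order [sigma] and type [K x * (1 - 1 / (j + 2))]; when [K x = 0]
    the order must be smaller, and the bounds have order
    [sigma * (1 - 1 / (j + 2))] and type 1. *)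
Lemma ae_maximal_growth (g : C -> C -> C) (c : nat -> C -> C) x :
  0 <= x -> z_type F = x%:E -> (forall z, entire (g z)) ->
  (forall z B s T, growth_le (g z) B s T -> coef_le_growth (c ^~ z) (2 * B) s T) ->
  (forall z, (growth_order (g z) <= sigma%:E)%E) ->
  (forall z, growth_order (g z) = sigma%:E -> (growth_type (g z) <= (K x)%:E)%E) ->
  (forall T, 0 < T -> T < K x -> (mu \x mu)%E.-negligible
    [set p : R * R | exists B, coef_le_growth (c ^~ (cplx p)) B sigma T]) ->
  (forall s, sigma / 2 <= s -> s < sigma -> (mu \x mu)%E.-negligible
    [set p : R * R | exists B, coef_le_growth (c ^~ (cplx p)) B s 1]) ->
  ae_area (fun z => growth_order (g z) = sigma%:E /\ growth_type (g z) = (K x)%:E).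
Proof.
move=> x0 tx eg gc ord_le typ_le negT negs.
have frac j : 2^-1 <= (1 - j.+2%:R^-1 : R) < 1.
  have u1 : (j.+2%:R^-1 : R) <= 2^-1 by rewrite lef_pV2 ?posrE ?ltr0n// ler_nat.
  have u0 : (0 : R) < j.+2%:R^-1 by rewrite invr_gt0 ltr0n.
  by move: (j.+2%:R^-1) u0 u1 => u u0 u1; apply/andP; split; lra.
have Kx_ge0 : 0 <= K x.
  rewrite !mulr_ge0 ?powR_ge0// subr_ge0 ler_pdivrMr// mul1r ltW//.
  by rewrite -subr_gt0.
suff [s [T [neg bad]]] : exists s T : nat -> R,
    (forall j, (mu \x mu)%E.-negligible
      [set p : R * R | exists B, coef_le_growth (c ^~ (cplx p)) B (s j) (T j)]) /\
    (forall z, ~ (growth_order (g z) = sigma%:E /\ growth_type (g z) = (K x)%:E) ->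
      exists j B, coef_le_growth (c ^~ z) B (s j) (T j)).
  apply: (@negligibleS _ _ _ _ _ _ _ (negligible_bigcup neg)) => p /= Hp.
  by have [j [B HB]] := bad _ Hp; exists j => //; exists B.
have [Kx0|Kx0] := ltP 0 (K x); last first.
  exists (fun j => sigma * (1 - j.+2%:R^-1)), (fun=> 1); split.
    move=> j; have /andP[j1 j2] := frac j; apply: negs.
      by rewrite ler_pM2l.
    by rewrite -[ltRHS]mulr1 ltr_pM2l.
  move=> z Hz; have olt : (growth_order (g z) < sigma%:E)%E.
    rewrite lt_neqAle ord_le andbT; apply/negP => /eqP o; apply: Hz; split=> //.
    have Kx : K x = 0 by apply/eqP; rewrite eq_le Kx0.
    apply/eqP; rewrite eq_le typ_le//= Kx.
    exact: growth_type_ge0 (eg z) sigma_gt0 o.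
  have [j Hj] := exists_fraction olt sigma_gt0.
  have /andP[j1 _] := frac j.
  have sj0 : 0 < sigma * (1 - j.+2%:R^-1) by rewrite mulr_gt0// (lt_le_trans _ j1)// invr_gt0.
  have [B HB] := growth_of_order (eg z) sj0 Hj.
  by exists j, (2 * B); exact: gc.
exists (fun=> sigma), (fun j => K x * (1 - j.+2%:R^-1)); split.
  move=> j; have /andP[j1 j2] := frac j; apply: negT.
    by rewrite mulr_gt0// (lt_le_trans _ j1)// invr_gt0.
  by rewrite -[ltRHS]mulr1 ltr_pM2l.
move=> z Hz; have := ord_le z; rewrite le_eqVlt => /orP[/eqP o|olt].
  have tlt : (growth_type (g z) < (K x)%:E)%E.
    rewrite lt_neqAle typ_le// andbT; apply/negP => /eqP t.
    by apply: Hz.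
  have [j Hj] := exists_fraction tlt Kx0.
  have [B HB] := growth_of_type (eg z) sigma_gt0 o Hj.
  by exists j, (2 * B); exact: gc.
have [s /andP[s0 ss] os] := ereal_between olt sigma_gt0.
have [B HB] := growth_of_order (eg z) s0 os.
have /andP[j1 _] := frac 0%N.
have T0 : 0 < K x * (1 - 2%:R^-1) by rewrite mulr_gt0// (lt_le_trans _ j1)// invr_gt0.
have [B' HB'] := growth_le_order s0 ss T0 HB.
by exists 0%N, (2 * B'); exact: gc.
Qed.

Lemma ae_caloric_growth x : 0 <= x -> z_type F = x%:E ->
  ae_area (fun z => t_order0 F z = sigma%:E /\ t_type0 F z = (K x)%:E) /\
  ae_area (fun z => t_order1 F z = sigma%:E /\ t_type1 F z = (K x)%:E).
Proof.
move=> x0 tx.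
have T0 := fun T (p : 0 < T) (q : T < K x) => proj1 (small_type_negligible x0 tx p q).
have T1 := fun T (p : 0 < T) (q : T < K x) => proj2 (small_type_negligible x0 tx p q).
have O0 := fun s (p : sigma / 2 <= s) (q : s < sigma) => proj1 (small_order_negligible p q).
have O1 := fun s (p : sigma / 2 <= s) (q : s < sigma) => proj2 (small_order_negligible p q).
split.
  exact: (@ae_maximal_growth (slice_t F) b x x0 tx
    (fun z => entire_slice_t eF (z := z)) tcoef_of_growth
    (fun z => proj1 (t_order_le z)) (fun z => proj1 (t_type_le z x0 tx)) T0 O0).
exact: (@ae_maximal_growth (fun z t => dz F t z) b1 x x0 tx
  (fun z => entire_dz eF (z := z)) tcoef1_of_growth
  (fun z => proj2 (t_order_le z)) (fun z => proj2 (t_type_le z x0 tx)) T1 O1).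
Qed.

End CaloricGrowth.

Theorem theorem5 (R : realType) (F : R[i] * R[i] -> R[i]) (rho : R) (z0 : R[i]) :
  entire2 F -> heat_equation F ->
  z_order F = rho%:E -> 0 < rho < 2 ->
  let tau := z_type F in
  let rho_t := caloric_t_order F z0 in
  let E0 := max_order_set0 F rho_t in
  let E1 := max_order_set1 F rho_t in
  let E := E0 `&` E1 in
  exists tau_t : \bar R,
    [/\ (forall z, E z -> caloric_t_type F z = tau_t),
        tau_t = (((1 - rho / 2) * ((2 * rho) `^ (rho / (2 - rho))))%:E
                 * poweR tau (2 / (2 - rho)))%E,
        (tau_t = 0%E <-> tau = 0%E) /\ (tau_t = +oo%E <-> tau = +oo%E) &
        ((tau_t < +oo)%E ->
          ae_area (fun z => E0 z /\ t_type0 F z = tau_t) /\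
          ae_area (fun z => E1 z /\ t_type1 F z = tau_t))].
Proof.
move=> eF hF Hrho rho02 tau rho_t E0 E1 E.
have rE : rho_t = (rho / (2 - rho))%:E := caloric_t_orderE eF hF Hrho rho02 z0.
have /andP[rho0 rho2] := rho02.
have r2 : 0 < 2 - rho by rewrite subr_gt0.
have e0 : 0 < 2 / (2 - rho) by rewrite divr_gt0.
set c := (1 - rho / 2) * (2 * rho) `^ (rho / (2 - rho)).
have c0 : 0 < c.
  rewrite mulr_gt0 ?powR_gt0 ?mulr_gt0//.
  by rewrite subr_gt0 ltr_pdivrMr// mul1r.
have tau0 : (0 <= tau)%E := z_type_ge0 eF Hrho rho02.
case tauE : tau => [x| |]; last by move: tau0; rewrite tauE.
- have x0 : 0 <= x by rewrite -lee_fin -tauE.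
  have KE : (caloric_type rho x)%:E = (c%:E * poweR x%:E (2 / (2 - rho)))%E.
    by rewrite poweR_EFin -EFinM.
  exists (caloric_type rho x)%:E; split => //.
  + move=> z [/= z1 z2]; apply: (caloric_t_typeE_fin eF hF Hrho rho02 x0 tauE).
      by rewrite -rE.
    by rewrite -rE.
  + split; last by split.
    split=> [[] /eqP|[->]].
      rewrite /caloric_type -/c mulf_eq0 (gt_eqF c0) /= powR_eq0.
      by move=> /andP[/eqP -> _].
    by rewrite /caloric_type powR0 ?mulr0// gt_eqF.
  + move=> _; rewrite /E0 /E1 /max_order_set0 /max_order_set1 rE /=.
    exact: (ae_caloric_growth eF hF Hrho rho02 x0 tauE).
- have KE : (c%:E * poweR +oo (2 / (2 - rho)))%E = +oo%E.
    by rewrite poweRyr ?gt_eqF// mulry gtr0_sg// mul1e.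
  exists +oo%E; split => //.
  move=> z [/= z1 z2]; apply: (caloric_t_typeE_pinfty eF hF Hrho rho02 tauE).
    by rewrite -rE.
  by rewrite -rE.
Qed.
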